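(* Let $q\in\mathbf{C}^\times$ and let $(\Omega^\bullet_q(S^2),\ \mathrm{d}=\partial+\overline{\partial})$ be the $q$-deformed Dolbeault double complex of the standard Podleś sphere, with de Rham cohomology groups $H^k$ and holomorphic and anti-holomorphic Dolbeault cohomology groups $H_\partial^{(a,b)}$, $H_{\overline{\partial}}^{(a,b)}$. Then: 1. $H^0\cong H^2$, with each having dimension greater than or equal to $1$; 2. $H_\partial^{(1,0)}\cong H_\partial^{(0,1)}$ and $H_{\overline{\partial}}^{(1,0)}\cong H_{\overline{\partial}}^{(0,1)}$.
   Context: Algebra. $q\in\mathbf{C}^\times$. $\mathbf{C}_q[SU_2]$ is the Hopf $*$-algebra generated by $a,b,c,d$ with $ab=qba$, $ac=qca$, $bd=qdb$, $cd=qdc$, $bc=cb$, $ad-da=(q-q^{-1})bc$, $ad-qbc=1$; coproduct $\Delta(a)=a\otimes a+b\otimes c$, $\Delta(b)=a\otimes b+b\otimes d$, $\Delta(c)=c\otimes a+d\otimes c$, $\Delta(d)=c\otimes b+d\otimes d$; counit $\varepsilon(a)=\varepsilon(d)=1$, $\varepsilon(b)=\varepsilon(c)=0$; and $a^*=d$, $d^*=a$, $b^*=-qc$, $c^*=-q^{-1}b$. It is $\mathbf{Z}$-graded by $\deg a=\deg c=-1$, $\deg b=\deg d=1$; $\mathcal{E}_k$ is the degree-$k$ part. The Podleś sphere is $M=\mathbf{C}_q[S^2]=\mathcal{E}_0$, generated by $b_-=ab$, $b_0=bc$, $b_+=cd$; $\Delta_L:M\to\mathbf{C}_q[SU_2]\otimes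 M$ is the coaction given by the coproduct, and $M^+=M\cap\ker\varepsilon$. Calculus. A total differential calculus over $M$ is a graded algebra $\Omega^\bullet=\bigoplus_{k\ge0}\Omega^k$ with $\Omega^0=M$ and a degree-one map $\mathrm{d}$ with $\mathrm{d}^2=0$ satisfying the graded Leibniz rule, such that $\Omega^k$ is spanned by the $m_0\mathrm{d}m_1\wedge\cdots\wedge \mathrm{d}m_k$; it is a $*$-calculus if $*$ extends to a conjugate-linear involution with $(\mathrm{d}\omega)^*=\mathrm{d}\omega^*$ and $(\omega\wedge\nu)^*=(-1)^{kl}\nu^*\wedge\omega^*$ for forms of degrees $k,l$; it is covariant if $\Delta_L$ extends to a left coaction on $\Omega^\bullet$ with $\Delta_L\mathrm{d}=(\mathrm{id}\otimes \mathrm{d})\Delta_L$. An almost complex structure on a $*$-calculus is an $\mathbf{N}_0^2$-algebra grading $\Omega^{(p,r)}$ with $\Omega^k=\bigoplus_{p+r=k}\Omega^{(p,r)}$, $(\Omega^{(p,r)})^*=\Omega^{(r,p)}$, and $\wedge$ restricting to isomorphisms $\Omega^{(p,0)}\otimes_M\Omega^{(0,r)}\to\Omega^{(p,r)}$ and $\Omega^{(0,r)}\otimes_M\Omega^{(p,0)}\to\Omega^{(p,r)}$; it is covariant if $\Delta_L$ preserves each $\Omega^{(p,r)}$. $\Omega^\bullet_q(S^2)$ is the unique covariant total differential calculus over $M$ whose 1-forms have classical dimension and which admits a covariant almost complex structure; that structure is unique and integrable, so $\mathrm{d}=\partial+\overline{\partial}$ with $\partial$, $\overline{\partial}$ of bidegrees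 $(1,0)$, $(0,1)$. Identifying a form $\omega$ with $\omega_{(-1)}\otimes[\omega_{(0)}]$, where $\Delta_L\omega=\omega_{(-1)}\otimes\omega_{(0)}$ and $[\cdot]$ is the class modulo $M^+\Omega^\bullet$, and putting $e^\pm=[\mathrm{d}b_\pm]$, $\tau=[\mathrm{d}b_+\wedge \mathrm{d}b_-]$, one has $\Omega^{(1,0)}=\mathcal{E}_2e^+$, $\Omega^{(0,1)}=\mathcal{E}_{-2}e^-$, $\Omega^2=\Omega^{(1,1)}=\mathcal{E}_0\tau$, and $\Omega^k=0$ for $k>2$. Cohomology. $H^k=\ker(\mathrm{d}|_{\Omega^k})/\mathrm{im}(\mathrm{d}|_{\Omega^{k-1}})$, $H^{(a,b)}_\partial=\ker(\partial|_{\Omega^{(a,b)}})/\mathrm{im}(\partial|_{\Omega^{(a-1,b)}})$, $H^{(a,b)}_{\overline{\partial}}=\ker(\overline{\partial}|_{\Omega^{(a,b)}})/\mathrm{im}(\overline{\partial}|_{\Omega^{(a,b-1)}})$ (here $a,b$ are integers). *)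

(* Defs.v *)
From HB Require Import structures.
From mathcomp Require Import all_boot all_algebra.
From mathcomp Require Import boolp classical_sets reals complex.

Set Implicit Arguments.
Unset Strict Implicit.
Unset Printing Implicit Defensive.

Import GRing.Theory Num.Theory.

Local Open Scope ring_scope.
Local Open Scope quotient_scope.

Notation bilin f := (bilinear_for *:%R *:%R f).

Record subspace (K : fieldType) (V : lmodType K) := Subspace {
  sp_set :> V -> Prop;
  sp_set0 : sp_set 0;
  sp_setP : forall k u v, sp_set u -> sp_set v -> sp_set (k *: u + v) }.

Section Subspaces.
Variables (K : fieldType) (V : lmodType K).
Implicit Types (S B : subspace V).

Definition sp_pred S : {pred V} := [pred x | `[< S x >]].

Lemma sp_predE S x : (x \in sp_pred S) = `[< S x >].
Proof. by []. Qed.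

Lemma sp_pred_closed S : subsemimod_closed (sp_pred S).
Proof.
have Z0 : S 0 by exact: sp_set0.
split=> [|k u]; last first.
  by rewrite !sp_predE => /asboolP Su; apply/asboolP; rewrite -[_ *: _]addr0;
     exact: sp_setP.
split; first exact/asboolP.
move=> u v; rewrite !sp_predE => /asboolP Su /asboolP Sv; apply/asboolP.
by rewrite -[u]scale1r; exact: sp_setP.
Qed.

Lemma sp_pred_submod S : submod_closed (sp_pred S).
Proof.
split; first by rewrite sp_predE; apply/asboolP; exact: sp_set0.
move=> k u v; rewrite !sp_predE => /asboolP Su /asboolP Sv; apply/asboolP.
exact: sp_setP.
Qed.

HB.instance Definition _ S :=
  GRing.isSubmodClosed.Build K V (sp_pred S) (sp_pred_submod S).

Definition sp_type S := {x : V | x \in sp_pred S}.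
HB.instance Definition _ S := SubChoice.on (sp_type S).
HB.instance Definition _ S :=
  GRing.SubChoice_isSubLmodule.Build K V (sp_pred S) (sp_type S)
    (sp_pred_closed S).

Definition qmod B : Type := Quotient.quot (sp_pred B : zmodClosed V).
HB.instance Definition _ B := GRing.Zmodule.on (qmod B).
HB.instance Definition _ B := Quotient.on (qmod B).

Definition qclass B (x : V) : qmod B := \pi_(qmod B) x.

Lemma qclassE B x y : qclass B x = qclass B y <-> B (x - y).
Proof.
split=> [h|h].
  apply/asboolP; change (x - y \in sp_pred B).
  by rewrite Quotient.idealrBE; apply/eqP.
by apply/eqP; rewrite /qclass -Quotient.idealrBE sp_predE; apply/asboolP.
Qed.

Lemma qclass_repr B (x : qmod B) : qclass B (repr x) = x.
Proof. exact: reprK. Qed.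

Lemma qclass_add B x y : qclass B (x + y) = qclass B x + qclass B y.
Proof. by rewrite /qclass; exact: (Quotient.pi_add (sp_pred B) x y). Qed.

Definition qscale B (k : K) (x : qmod B) : qmod B := qclass B (k *: repr x).

Lemma qclass_scale B k x : qclass B (k *: x) = qscale k (qclass B x).
Proof.
apply/qclassE; rewrite -scalerBr -[_ *: _]addr0; apply: sp_setP (sp_set0 _).
by apply/qclassE; rewrite qclass_repr.
Qed.

Lemma qscaleA B a b (x : qmod B) : qscale a (qscale b x) = qscale (a * b) x.
Proof. by rewrite -[x]qclass_repr -!qclass_scale scalerA. Qed.
Lemma qscale1 B : left_id 1 (@qscale B).
Proof. by move=> x; rewrite -[x]qclass_repr -!qclass_scale scale1r. Qed.
Lemma qscaleDr B : right_distributive (@qscale B) +%R.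
Proof.
move=> a x y; rewrite -[x]qclass_repr -[y]qclass_repr.
by rewrite -qclass_add -!qclass_scale -qclass_add scalerDr.
Qed.
Lemma qscaleDl B (x : qmod B) : {morph (@qscale B)^~ x : a b / a + b}.
Proof.
move=> a b; rewrite -[x]qclass_repr.
by rewrite -!qclass_scale -qclass_add scalerDl.
Qed.

HB.instance Definition _ B :=
  GRing.Zmodule_isLmodule.Build K (qmod B) (@qscaleA B) (@qscale1 B)
    (@qscaleDr B) (@qscaleDl B).

Lemma qclass_linear B : linear (qclass B).
Proof. by move=> k x y; rewrite qclass_add qclass_scale. Qed.

HB.instance Definition _ B :=
  GRing.isLinear.Build K V (qmod B) *:%R (qclass B) (qclass_linear B).

Definition sp_full : subspace V.
Proof. by exists (fun=> True). Defined.

Definition sp_zero : subspace V.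
Proof. by exists (fun v => v = 0) => //= k u v -> ->; rewrite scaler0 addr0. Defined.

Definition sp_cap S B : subspace V.
Proof.
exists (fun v => S v /\ B v); first by split; exact: sp_set0.
by move=> k u v [? ?] [? ?]; split; exact: sp_setP.
Defined.

Definition span (X : set V) : subspace V.
Proof.
exists (fun v => exists s : seq (K * V),
          {in s, forall p, X p.2} /\ v = \sum_(p <- s) p.1 *: p.2).
  by exists [::]; split=> //; rewrite big_nil.
move=> k _ _ [s [Xs ->]] [t [Xt ->]].
exists ([seq (k * p.1, p.2) | p <- s] ++ t); split.
  move=> p; rewrite mem_cat => /orP[/mapP[p' sp' ->]|/Xt//]; exact: (Xs _ sp').
rewrite big_cat big_map scaler_sumr; congr (_ + _).
by apply: eq_bigr => p _; rewrite scalerA.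
Defined.

(** [S] is the internal direct sum of the [G i] with [P i]. *)
Definition direct_sum (I : eqType) (P : pred I) (G : I -> subspace V) S :=
  (forall v, S v <-> exists (r : seq I) (f : I -> V),
     [/\ uniq r, all P r, forall i, i \in r -> G i (f i)
       & v = \sum_(i <- r) f i]) /\
  (forall (r : seq I) (f : I -> V), uniq r -> all P r ->
     (forall i, i \in r -> G i (f i)) -> \sum_(i <- r) f i = 0 ->
     forall i, i \in r -> f i = 0).

Definition lin_indep n (e : 'I_n -> V) :=
  forall k : 'I_n -> K, \sum_i k i *: e i = 0 -> forall i, k i = 0.

Definition sp_dim (n : nat) S :=
  exists2 e : 'I_n -> V, lin_indep e &
    forall v, S v <-> exists k : 'I_n -> K, v = \sum_i k i *: e i.

End Subspaces.

Arguments sp_full {K V}.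
Arguments sp_zero {K V}.

Definition dim_ge (K : fieldType) (V : lmodType K) (n : nat) :=
  exists e : 'I_n -> V, lin_indep e.

Definition lmod_iso (K : fieldType) (U V : lmodType K) :=
  exists f : {linear U -> V}, bijective f.

Section LinearMaps.
Variables (K : fieldType) (U V : lmodType K) (f : {linear U -> V}).

Definition sp_preim (S : subspace V) : subspace U.
Proof.
exists (fun u => S (f u)) => [|k u v Su Sv] /=.
  by rewrite linear0; exact: sp_set0.
by rewrite linearP; exact: sp_setP.
Defined.

Definition sp_img (S : subspace U) : subspace V.
Proof.
exists (fun v => exists2 u, S u & f u = v) => [|k _ _ [u Su <-] [v Sv <-]].
  by exists 0; [exact: sp_set0|rewrite linear0].
by exists (k *: u + v); [exact: sp_setP|rewrite linearP].
Defined.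

Definition sp_ker : subspace U := sp_preim sp_zero.

End LinearMaps.

(** [Z / B] when [B] is contained in [Z], and [Z / (Z /\ B)] in general. *)
Definition subquot (K : fieldType) (V : lmodType K) (Z B : subspace V)
  : lmodType K := qmod (sp_preim (val : {linear sp_type Z -> V}) B).

Section Tensor.
Variables (K : fieldType) (V W : lmodType K).
Implicit Types s t : seq (V * W).

(** A list of pairs stands for the formal sum of the corresponding pure
    tensors; two formal sums agree in the tensor product exactly when no
    bilinear map to a vector space tells them apart. *)
Definition fsum (U : lmodType K) (f : V -> W -> U) s : U :=
  \sum_(p <- s) f p.1 p.2.

Definition tens_eq : rel (seq (V * W)) := fun s t =>
  `[< forall (U : lmodType K) (f : V -> W -> U), bilin f ->
        fsum f s = fsum f t >].

Lemma tens_eq_refl : reflexive tens_eq.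
Proof. by move=> s; apply/asboolP. Qed.
Lemma tens_eq_sym : symmetric tens_eq.
Proof.
by move=> s t; apply/asboolP/asboolP => h U f /h ->.
Qed.
Lemma tens_eq_trans : transitive tens_eq.
Proof.
move=> s t u /asboolP h /asboolP h'; apply/asboolP => U f hf.
by rewrite h // h'.
Qed.
Canonical tens_equiv := EquivRel tens_eq tens_eq_refl tens_eq_sym tens_eq_trans.

Definition tensor : Type := {eq_quot tens_eq}.
HB.instance Definition _ := Choice.on tensor.
HB.instance Definition _ := Quotient.on tensor.

Definition tpure (v : V) (w : W) : tensor := \pi_tensor [:: (v, w)].

(** Meaningful for bilinear [f] only. *)
Definition teval (U : lmodType K) (f : V -> W -> U) (x : tensor) : U :=
  fsum f (repr x).

Lemma teval_pi (U : lmodType K) (f : V -> W -> U) s :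
  bilin f -> teval f (\pi_tensor s) = fsum f s.
Proof.
move=> hf; rewrite /teval; set t := repr _.
have /eqmodP/asboolP : t = s %[mod tensor] by rewrite /t reprK.
exact.
Qed.

Lemma tensor_ext (x y : tensor) :
  (forall (U : lmodType K) (f : V -> W -> U), bilin f ->
     teval f x = teval f y) -> x = y.
Proof.
move=> h; rewrite -[x]reprK -[y]reprK; apply/eqmodP/asboolP => U f hf.
by have := h U f hf.
Qed.

Definition tzero : tensor := \pi_tensor [::].
Definition tadd (x y : tensor) : tensor := \pi_tensor (repr x ++ repr y).
Definition tscale (k : K) (x : tensor) : tensor :=
  \pi_tensor [seq (k *: p.1, p.2) | p <- repr x].

Lemma teval0 (U : lmodType K) (f : V -> W -> U) : bilin f -> teval f tzero = 0.
Proof. by move=> hf; rewrite teval_pi // /fsum big_nil. Qed.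
Lemma tevalD (U : lmodType K) (f : V -> W -> U) x y :
  bilin f -> teval f (tadd x y) = teval f x + teval f y.
Proof. by move=> hf; rewrite teval_pi // /fsum big_cat. Qed.

Section Bilin.
Variables (U : lmodType K) (f : V -> W -> U).
Hypothesis hf : bilin f.

Lemma bilin0l w : f 0 w = 0.
Proof.
by have /= := hf.1 w (-1) 0 0; rewrite scaler0 addr0 scaleN1r addNr.
Qed.
Lemma bilin0r v : f v 0 = 0.
Proof.
by have /= := hf.2 v (-1) 0 0; rewrite scaler0 addr0 scaleN1r addNr.
Qed.
Lemma bilinZl k v w : f (k *: v) w = k *: f v w.
Proof. by have /= := hf.1 w k v 0; rewrite !addr0 bilin0l addr0. Qed.
Lemma bilinZr k v w : f v (k *: w) = k *: f v w.
Proof. by have /= := hf.2 v k w 0; rewrite !addr0 bilin0r addr0. Qed.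
Lemma bilinDl v v' w : f (v + v') w = f v w + f v' w.
Proof. by have /= := hf.1 w 1 v v'; rewrite !scale1r. Qed.
Lemma bilinDr v w w' : f v (w + w') = f v w + f v w'.
Proof. by have /= := hf.2 v 1 w w'; rewrite !scale1r. Qed.
Lemma tevalZ k x : teval f (tscale k x) = k *: teval f x.
Proof.
rewrite teval_pi // /fsum big_map scaler_sumr.
by apply: eq_bigr => p _; rewrite bilinZl.
Qed.
Lemma teval_pure v w : teval f (tpure v w) = f v w.
Proof. by rewrite teval_pi // /fsum big_seq1. Qed.
End Bilin.

Lemma taddA : associative tadd.
Proof. by move=> x y z; apply: tensor_ext => U f hf; rewrite !tevalD // addrA. Qed.
Lemma taddC : commutative tadd.
Proof. by move=> x y; apply: tensor_ext => U f hf; rewrite !tevalD // addrC. Qed.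
Lemma tadd0 : left_id tzero tadd.
Proof. by move=> x; apply: tensor_ext => U f hf; rewrite tevalD // teval0 // add0r. Qed.
Lemma taddN : left_inverse tzero (tscale (-1)) tadd.
Proof.
move=> x; apply: tensor_ext => U f hf.
by rewrite tevalD // tevalZ // teval0 // scaleN1r addNr.
Qed.
HB.instance Definition _ := GRing.isZmodule.Build tensor taddA taddC tadd0 taddN.

Lemma tscaleA a b x : tscale a (tscale b x) = tscale (a * b) x.
Proof. by apply: tensor_ext => U f hf; rewrite !tevalZ // scalerA. Qed.
Lemma tscale1 : left_id 1 tscale.
Proof. by move=> x; apply: tensor_ext => U f hf; rewrite tevalZ // scale1r. Qed.
Lemma tscaleDr : right_distributive tscale +%R.
Proof.
move=> a x y; apply: tensor_ext => U f hf.
by rewrite tevalZ // !tevalD // !tevalZ // scalerDr.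
Qed.
Lemma tscaleDl x : {morph tscale^~ x : a b / a + b}.
Proof.
move=> a b; apply: tensor_ext => U f hf.
by rewrite tevalZ // !tevalD // !tevalZ // scalerDl.
Qed.
HB.instance Definition _ :=
  GRing.Zmodule_isLmodule.Build K tensor tscaleA tscale1 tscaleDr tscaleDl.

Lemma teval_linear (U : lmodType K) (f : V -> W -> U) :
  bilin f -> linear (teval f).
Proof.
move=> hf k x y.
by rewrite -[k *: x + y]/(tadd (tscale k x) y) tevalD // tevalZ.
Qed.

Lemma tpure_bilin : bilin tpure.
Proof.
split=> u k x y; apply: tensor_ext => U f hf;
  rewrite (teval_linear hf) !teval_pure //.
  by rewrite bilinDl // bilinZl.
by rewrite bilinDr // bilinZr.
Qed.

Lemma tensor_pi s : \pi_tensor s = \sum_(p <- s) tpure p.1 p.2.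
Proof.
apply: tensor_ext => U f hf; rewrite teval_pi //.
elim: s => [|p s IHs]; first by rewrite /fsum !big_nil (teval0 hf).
rewrite /fsum !big_cons -[X in _ = teval f X]/(tadd _ _) tevalD //.
by rewrite teval_pure // -IHs.
Qed.

Lemma tensorE (x : tensor) : x = \sum_(p <- repr x) tpure p.1 p.2.
Proof. by rewrite -tensor_pi reprK. Qed.

Lemma tensor_lin_ext (U : lmodType K) (f g : tensor -> U) :
  linear f -> linear g ->
  (forall v w, f (tpure v w) = g (tpure v w)) -> f =1 g.
Proof.
move=> lf lg fg x; rewrite [x]tensorE.
pose F := GRing.isLinear.Build _ _ _ _ f lf.
pose G := GRing.isLinear.Build _ _ _ _ g lg.
pose f' : {linear tensor -> U} := HB.pack f F.
pose g' : {linear tensor -> U} := HB.pack g G.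
rewrite -[f]/(f' : _ -> _) -[g]/(g' : _ -> _) !linear_sum /=.
by apply: eq_bigr => p _; exact: fg.
Qed.

End Tensor.

Notation "v \tensor w" := (tpure v w) (at level 40, left associativity).

(** [f (x) g], for linear [f] and [g]. *)
Definition tmap (K : fieldType) (V W V' W' : lmodType K)
    (f : V -> V') (g : W -> W') : tensor V W -> tensor V' W' :=
  teval (fun v w => f v \tensor g w).

Definition tassoc (K : fieldType) (V W X : lmodType K) :
    tensor (tensor V W) X -> tensor V (tensor W X) :=
  teval (fun t x => teval (fun v w => v \tensor (w \tensor x)) t).

Section TensorMul.
Variables (K : fieldType) (A B : algType K).
Implicit Types x y z : tensor A B.

Definition tone : tensor A B := 1 \tensor 1.
Definition tmul_pure (a : A) (b : B) : tensor A B -> tensor A B :=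
  teval (fun a' b' => (a * a') \tensor (b * b')).
Definition tmul x y : tensor A B := teval (fun a b => tmul_pure a b y) x.

Lemma tmul_pure_aux a b :
  bilin (fun a' b' => (a * a') \tensor (b * b') : tensor A B).
Proof.
have h := @tpure_bilin K A B.
split=> u k x y /=; rewrite mulrDr -scalerAr.
  by rewrite (bilinDl h) (bilinZl h).
by rewrite (bilinDr h) (bilinZr h).
Qed.

Lemma tmul_pure_linear a b : linear (tmul_pure a b).
Proof. exact: teval_linear (tmul_pure_aux a b). Qed.

Lemma tmul_pureE a b a' b' :
  tmul_pure a b (a' \tensor b') = (a * a') \tensor (b * b').
Proof. exact: (teval_pure (tmul_pure_aux a b)). Qed.

Lemma tmul_aux y : bilin (fun a b => tmul_pure a b y).
Proof.
have h := @tpure_bilin K A B.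
split=> u k v w /=; move: y; apply: tensor_lin_ext.
- exact: tmul_pure_linear.
- move=> c x y; rewrite !(tmul_pure_linear _ _ c) scalerDr !scalerA.
  by rewrite (mulrC k c) addrACA scalerDr -!scalerA.
- move=> a b; rewrite !tmul_pureE mulrDl -scalerAl.
  by rewrite (bilinDl h) (bilinZl h).
- exact: tmul_pure_linear.
- move=> c x y; rewrite !(tmul_pure_linear _ _ c) scalerDr !scalerA.
  by rewrite (mulrC k c) addrACA scalerDr -!scalerA.
- move=> a b; rewrite !tmul_pureE mulrDl -scalerAl.
  by rewrite (bilinDr h) (bilinZr h).
Qed.

Lemma tmul_linearl y : linear (tmul^~ y).
Proof. exact: (teval_linear (tmul_aux y)). Qed.

Lemma tmul_purel a b y : tmul (a \tensor b) y = tmul_pure a b y.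
Proof. exact: (teval_pure (tmul_aux y)). Qed.

Lemma tmulE a b a' b' :
  tmul (a \tensor b) (a' \tensor b') = (a * a') \tensor (b * b').
Proof. by rewrite tmul_purel tmul_pureE. Qed.

Lemma tmul_linearr x : linear (tmul x).
Proof.
move=> k y z; move: x; apply: tensor_lin_ext.
- exact: tmul_linearl.
- move=> c u v; rewrite !(tmul_linearl _ c) scalerDr !scalerA (mulrC k c).
  by rewrite addrACA scalerDr -!scalerA.
- by move=> a b; rewrite !tmul_purel tmul_pure_linear.
Qed.

Lemma tmulA : associative tmul.
Proof.
move=> x y z; move: x; apply: tensor_lin_ext.
- exact: tmul_linearl.
- by move=> c u v; rewrite !tmul_linearl.
move=> a b; move: y; apply: tensor_lin_ext.
- by move=> c u v; rewrite tmul_linearl tmul_linearr.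
- by move=> c u v; rewrite tmul_linearr tmul_linearl.
move=> a' b'; move: z; apply: tensor_lin_ext.
- by move=> c u v; rewrite !tmul_linearr.
- exact: tmul_linearr.
by move=> a'' b''; rewrite !tmulE !mulrA.
Qed.

Lemma tmul1l : left_id tone tmul.
Proof.
apply: tensor_lin_ext => [|//|a b]; first exact: tmul_linearr.
by rewrite tmulE !mul1r.
Qed.

Lemma tmul1r : right_id tone tmul.
Proof.
apply: tensor_lin_ext => [|//|a b]; first exact: tmul_linearl.
by rewrite tmulE !mulr1.
Qed.

Lemma tmulDl : left_distributive tmul +%R.
Proof.
move=> x y z; have := tmul_linearl z 1 x y.
by rewrite !scale1r.
Qed.

Lemma tmulDr : right_distributive tmul +%R.
Proof.
move=> x y z; have := tmul_linearr x 1 y z.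
by rewrite !scale1r.
Qed.

Lemma tmulZl k x y : k *: tmul x y = tmul (k *: x) y.
Proof.
have z0 : tmul 0 y = 0.
  by have := tmul_linearl y (-1) 0 0; rewrite scaler0 addr0 scaleN1r addNr.
by have := tmul_linearl y k x 0; rewrite z0 !addr0.
Qed.

Lemma tmulZr k x y : k *: tmul x y = tmul x (k *: y).
Proof.
have z0 : tmul x 0 = 0.
  by have := tmul_linearr x (-1) 0 0; rewrite scaler0 addr0 scaleN1r addNr.
by have := tmul_linearr x k y 0; rewrite z0 !addr0.
Qed.

End TensorMul.

Inductive gen := Ga | Gb | Gc | Gd.
HB.instance Definition _ := gen_eqMixin gen.
HB.instance Definition _ := gen_choiceMixin gen.

Section QuantumSU2.
Variables (C : numClosedFieldType) (q : C).

Definition SU2_rel (B : algType C) (x : gen -> B) : Prop :=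
  let a := x Ga in let b := x Gb in let c := x Gc in let d := x Gd in
  (a * b = q *: (b * a) /\ a * c = q *: (c * a) /\
   b * d = q *: (d * b) /\ c * d = q *: (d * c) /\ b * c = c * b) /\
  (a * d - d * a = (q - q^-1) *: (b * c) /\ a * d - q *: (b * c) = 1).

(** A noncommutative polynomial is a list of coefficients and words. *)
Definition ncpoly := seq (C * seq gen).

Definition nceval (B : algType C) (x : gen -> B) (s : ncpoly) : B :=
  \sum_(p <- s) p.1 *: \prod_(i <- p.2) x i.

(** Equality modulo the two-sided ideal generated by the relations: two
    polynomials are identified when they take the same value in every algebra
    on all quadruples satisfying the relations. *)
Definition SU2_eq : rel ncpoly := fun s t =>
  `[< forall (B : algType C) (x : gen -> B), SU2_rel x ->
        nceval x s = nceval x t >].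

Lemma SU2_eq_refl : reflexive SU2_eq.
Proof. by move=> s; apply/asboolP. Qed.
Lemma SU2_eq_sym : symmetric SU2_eq.
Proof. by move=> s t; apply/asboolP/asboolP => h B x /h ->. Qed.
Lemma SU2_eq_trans : transitive SU2_eq.
Proof.
by move=> s t u /asboolP h /asboolP h'; apply/asboolP => B x hx; rewrite h // h'.
Qed.
Canonical SU2_equiv := EquivRel SU2_eq SU2_eq_refl SU2_eq_sym SU2_eq_trans.

Definition SU2 : Type := {eq_quot SU2_eq}.
HB.instance Definition _ := Choice.on SU2.
HB.instance Definition _ := Quotient.on SU2.

(** For [x] satisfying the relations, the algebra map sending the
    generators to [x]. *)
Definition SU2_lift (B : algType C) (x : gen -> B) (u : SU2) : B :=
  nceval x (repr u).

Lemma SU2_lift_pi (B : algType C) (x : gen -> B) s :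
  SU2_rel x -> SU2_lift x (\pi_SU2 s) = nceval x s.
Proof.
move=> hx; rewrite /SU2_lift; set t := repr _.
have /eqmodP/asboolP : t = s %[mod SU2] by rewrite /t reprK.
exact.
Qed.

Lemma SU2_ext (u v : SU2) :
  (forall (B : algType C) (x : gen -> B), SU2_rel x ->
     SU2_lift x u = SU2_lift x v) -> u = v.
Proof.
move=> h; rewrite -[u]reprK -[v]reprK; apply/eqmodP/asboolP => B x hx.
by have := h B x hx.
Qed.

Definition ncmul (s t : ncpoly) : ncpoly :=
  [seq (p.1 * r.1, p.2 ++ r.2) | p <- s, r <- t].

Definition SU2_zero : SU2 := \pi_SU2 [::].
Definition SU2_one : SU2 := \pi_SU2 [:: (1, [::])].
Definition SU2_add (u v : SU2) : SU2 := \pi_SU2 (repr u ++ repr v).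
Definition SU2_scale (k : C) (u : SU2) : SU2 :=
  \pi_SU2 [seq (k * p.1, p.2) | p <- repr u].
Definition SU2_mul (u v : SU2) : SU2 := \pi_SU2 (ncmul (repr u) (repr v)).

Section Eval.
Variables (B : algType C) (x : gen -> B).
Hypothesis hx : SU2_rel x.

Lemma nceval_mul s t : nceval x (ncmul s t) = nceval x s * nceval x t.
Proof.
rewrite /nceval /ncmul big_allpairs_dep mulr_suml; apply: eq_bigr => p _.
rewrite mulr_sumr; apply: eq_bigr => r _ /=.
by rewrite big_cat -scalerAl -scalerAr scalerA.
Qed.

Lemma SU2_lift0 : SU2_lift x SU2_zero = 0.
Proof. by rewrite SU2_lift_pi // /nceval big_nil. Qed.
Lemma SU2_lift1 : SU2_lift x SU2_one = 1.
Proof. by rewrite SU2_lift_pi // /nceval big_seq1 big_nil scale1r. Qed.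
Lemma SU2_liftD u v : SU2_lift x (SU2_add u v) = SU2_lift x u + SU2_lift x v.
Proof. by rewrite SU2_lift_pi // /nceval big_cat. Qed.
Lemma SU2_liftZ k u : SU2_lift x (SU2_scale k u) = k *: SU2_lift x u.
Proof.
rewrite SU2_lift_pi // /nceval big_map scaler_sumr.
by apply: eq_bigr => p _; rewrite scalerA.
Qed.
Lemma SU2_liftM u v : SU2_lift x (SU2_mul u v) = SU2_lift x u * SU2_lift x v.
Proof. by rewrite SU2_lift_pi // nceval_mul. Qed.
End Eval.

Lemma SU2_addA : associative SU2_add.
Proof. by move=> u v w; apply: SU2_ext => B x hx; rewrite !SU2_liftD // addrA. Qed.
Lemma SU2_addC : commutative SU2_add.
Proof. by move=> u v; apply: SU2_ext => B x hx; rewrite !SU2_liftD // addrC. Qed.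
Lemma SU2_add0 : left_id SU2_zero SU2_add.
Proof.
by move=> u; apply: SU2_ext => B x hx; rewrite SU2_liftD // SU2_lift0 // add0r.
Qed.
Lemma SU2_addN : left_inverse SU2_zero (SU2_scale (-1)) SU2_add.
Proof.
move=> u; apply: SU2_ext => B x hx.
by rewrite SU2_liftD // SU2_liftZ // SU2_lift0 // scaleN1r addNr.
Qed.
HB.instance Definition _ :=
  GRing.isZmodule.Build SU2 SU2_addA SU2_addC SU2_add0 SU2_addN.

Lemma SU2_mulA : associative SU2_mul.
Proof. by move=> u v w; apply: SU2_ext => B x hx; rewrite !SU2_liftM // mulrA. Qed.
Lemma SU2_mul1 : left_id SU2_one SU2_mul.
Proof.
by move=> u; apply: SU2_ext => B x hx; rewrite SU2_liftM // SU2_lift1 // mul1r.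
Qed.
Lemma SU2_mulr1 : right_id SU2_one SU2_mul.
Proof.
by move=> u; apply: SU2_ext => B x hx; rewrite SU2_liftM // SU2_lift1 // mulr1.
Qed.
Lemma SU2_mulDl : left_distributive SU2_mul +%R.
Proof.
move=> u v w; apply: SU2_ext => B x hx.
by rewrite SU2_liftM // !SU2_liftD // !SU2_liftM // mulrDl.
Qed.
Lemma SU2_mulDr : right_distributive SU2_mul +%R.
Proof.
move=> u v w; apply: SU2_ext => B x hx.
by rewrite SU2_liftM // !SU2_liftD // !SU2_liftM // mulrDr.
Qed.

Definition counit_gen (i : gen) : C^o :=
  match i with Ga | Gd => 1 | Gb | Gc => 0 end.

Lemma counit_rel : SU2_rel counit_gen.
Proof. by rewrite /SU2_rel /= !(mul0r, mulr0, mulr1, scaler0, subrr, subr0). Qed.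

Definition counit : SU2 -> C^o := SU2_lift counit_gen.

Lemma SU2_one_neq0 : SU2_one != 0.
Proof.
apply/eqP => /(congr1 counit) /eqP; apply/negP.
rewrite /counit (SU2_lift1 counit_rel) -[0 : SU2]/SU2_zero.
by rewrite (SU2_lift0 counit_rel) oner_neq0.
Qed.

HB.instance Definition _ := GRing.Zmodule_isNzRing.Build SU2
  SU2_mulA SU2_mul1 SU2_mulr1 SU2_mulDl SU2_mulDr SU2_one_neq0.

Lemma SU2_scaleA a b u : SU2_scale a (SU2_scale b u) = SU2_scale (a * b) u.
Proof. by apply: SU2_ext => B x hx; rewrite !SU2_liftZ // scalerA. Qed.
Lemma SU2_scale1 : left_id 1 SU2_scale.
Proof. by move=> u; apply: SU2_ext => B x hx; rewrite SU2_liftZ // scale1r. Qed.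
Lemma SU2_scaleDr : right_distributive SU2_scale +%R.
Proof.
move=> a u v; apply: SU2_ext => B x hx.
by rewrite SU2_liftZ // !SU2_liftD // !SU2_liftZ // scalerDr.
Qed.
Lemma SU2_scaleDl u : {morph SU2_scale^~ u : a b / a + b}.
Proof.
move=> a b; apply: SU2_ext => B x hx.
by rewrite SU2_liftZ // !SU2_liftD // !SU2_liftZ // scalerDl.
Qed.
HB.instance Definition _ := GRing.Zmodule_isLmodule.Build C SU2
  SU2_scaleA SU2_scale1 SU2_scaleDr SU2_scaleDl.

Lemma SU2_scaleAl (k : C) (u v : SU2) : k *: (u * v) = (k *: u) * v.
Proof.
apply: SU2_ext => B x hx; rewrite [LHS]SU2_liftZ // !SU2_liftM //.
by rewrite SU2_liftZ // scalerAl.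
Qed.
HB.instance Definition _ :=
  GRing.Lmodule_isLalgebra.Build C SU2 SU2_scaleAl.
Lemma SU2_scaleAr (k : C) (u v : SU2) : k *: (u * v) = u * (k *: v).
Proof.
apply: SU2_ext => B x hx; rewrite [LHS]SU2_liftZ // !SU2_liftM //.
by rewrite SU2_liftZ // scalerAr.
Qed.
HB.instance Definition _ :=
  GRing.Lalgebra_isAlgebra.Build C SU2 SU2_scaleAr.

Definition SU2_word (w : seq gen) : SU2 := \pi_SU2 [:: (1, w)].
Definition SU2_gen (i : gen) : SU2 := SU2_word [:: i].

Section LiftMorphism.
Variables (B : algType C) (x : gen -> B).
Hypothesis hx : SU2_rel x.

Lemma SU2_lift_linear : linear (SU2_lift x).
Proof.
move=> k u v.
by rewrite -[k *: u + v]/(SU2_add (SU2_scale k u) v) SU2_liftD // SU2_liftZ.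
Qed.
Lemma SU2_lift_monoid : monoid_morphism (SU2_lift x).
Proof. by split; [exact: SU2_lift1|exact: SU2_liftM]. Qed.
Lemma SU2_lift_gen i : SU2_lift x (SU2_gen i) = x i.
Proof. by rewrite SU2_lift_pi // /nceval big_seq1 scale1r big_seq1. Qed.
End LiftMorphism.


Definition SU2_lift_morph (B : algType C) (x : gen -> B) (hx : SU2_rel x)
    : {lrmorphism SU2 -> B} :=
  HB.pack (SU2_lift x)
    (GRing.isLinear.Build C SU2 B *:%R (SU2_lift x) (SU2_lift_linear hx))
    (GRing.isMonoidMorphism.Build SU2 B (SU2_lift x) (SU2_lift_monoid hx)).

Lemma SU2_genP : SU2_rel SU2_gen.
Proof.
rewrite /SU2_rel /=; split; [do !split|split]; apply: SU2_ext => B x hx;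
  rewrite -[SU2_lift x]/(SU2_lift_morph hx : _ -> _)
    !(linearB, linearD, linearZ, rmorphM, rmorph1) /= !SU2_lift_gen ?scalerN //;
  by case: hx => [[? [? [? [? ?]]]] [? ?]].
Qed.

Section TensorSU2.
Variable B : algType C.

Lemma tone_neq0 : tone SU2 B != 0.
Proof.
have hf : bilin (fun (u : SU2) (b : B) => (counit u : C) *: b).
  split=> u k v w /=; last by rewrite scalerDr !scalerA mulrC.
  by rewrite /counit (SU2_lift_linear counit_rel) scalerDl scalerA.
apply/eqP => /(congr1 (teval (fun (u : SU2) (b : B) => (counit u : C) *: b))).
rewrite (teval_pure hf) -[0]/(tzero SU2 B) (teval0 hf).
by rewrite /counit (SU2_lift1 counit_rel) scale1r => /eqP; rewrite oner_eq0.
Qed.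

HB.instance Definition _ := GRing.Zmodule_isNzRing.Build (tensor SU2 B)
  (@tmulA C SU2 B) (@tmul1l C SU2 B) (@tmul1r C SU2 B) (@tmulDl C SU2 B)
  (@tmulDr C SU2 B) tone_neq0.
HB.instance Definition _ :=
  GRing.Lmodule_isLalgebra.Build C (tensor SU2 B) (@tmulZl C SU2 B).
HB.instance Definition _ :=
  GRing.Lalgebra_isAlgebra.Build C (tensor SU2 B) (@tmulZr C SU2 B).

End TensorSU2.

Definition coprod_gen (i : gen) : tensor SU2 SU2 :=
  let a := SU2_gen Ga in let b := SU2_gen Gb in
  let c := SU2_gen Gc in let d := SU2_gen Gd in
  match i with
  | Ga => a \tensor a + b \tensor c
  | Gb => a \tensor b + b \tensor d
  | Gc => c \tensor a + d \tensor c
  | Gd => c \tensor b + d \tensor d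
  end.

(** For nonzero [q] the images [coprod_gen] satisfy the relations. *)
Definition coprod : SU2 -> tensor SU2 SU2 := SU2_lift coprod_gen.


(** Conjugate-linear involutive anti-automorphisms with the prescribed values
    on generators; there is none unless [q] is real, since
    [b = b^* ^* = (- q c)^* = q^* q^-1 b]. *)
Definition is_SU2_star (s : SU2 -> SU2) :=
  [/\ forall (k : C) u v, s (k *: u + v) = k^* *: s u + s v,
      forall u v, s (u * v) = s v * s u,
      involutive s
    & [/\ s (SU2_gen Ga) = SU2_gen Gd, s (SU2_gen Gd) = SU2_gen Ga,
          s (SU2_gen Gb) = - q *: SU2_gen Gc
        & s (SU2_gen Gc) = - q^-1 *: SU2_gen Gb]].

Definition deg_gen (i : gen) : int :=
  match i with Ga | Gc => -1 | Gb | Gd => 1 end.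
Definition deg (w : seq gen) : int := \sum_(i <- w) deg_gen i.

Definition SU2_part (k : int) : subspace SU2 :=
  span (fun u => exists2 w, deg w = k & u = SU2_word w).

Definition podles : Type := sp_type (SU2_part 0).
HB.instance Definition _ := SubChoice.on podles.

Lemma SU2_wordM w w' : SU2_word w * SU2_word w' = SU2_word (w ++ w').
Proof.
apply: SU2_ext => B x hx; rewrite [LHS]SU2_liftM // !SU2_lift_pi //.
by rewrite /nceval !big_seq1 !scale1r big_cat.
Qed.

Lemma mem_span (K : fieldType) (V : lmodType K) (X : set V) v :
  X v -> span X v.
Proof.
move=> Xv; exists [:: (1, v)]; split; last by rewrite big_seq1 scale1r.
by move=> p; rewrite inE => /eqP ->.
Qed.

Lemma SU2_part0_closed : GRing.subsemialg_closed (sp_pred (SU2_part 0)).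
Proof.
have W w : deg w = 0 -> SU2_word w \in sp_pred (SU2_part 0).
  by move=> dw; rewrite sp_predE; apply/asboolP/mem_span; exists w.
split.
- by apply: (W [::]); rewrite /deg big_nil.
- by case: (sp_pred_closed (SU2_part 0)).
- by case: (sp_pred_closed (SU2_part 0)).
- move=> u v; rewrite !sp_predE => /asboolP[s [Xs ->]] /asboolP[t [Xt ->]].
  rewrite -sp_predE mulr_suml big_seq; apply: rpred_sum => p ps.
  rewrite mulr_sumr big_seq; apply: rpred_sum => r rt.
  rewrite -scalerAl -scalerAr !rpredZ //.
  have [w dw ->] := Xs _ ps; have [w' dw' ->] := Xt _ rt.
  by rewrite SU2_wordM W // /deg big_cat -/(deg w) -/(deg w') dw dw'.
Qed.

HB.instance Definition _ := GRing.SubChoice_isSubAlgebra.Build C SU2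
  (sp_pred (SU2_part 0)) podles SU2_part0_closed.

Definition podles_val (m : podles) : SU2 := val m.

Lemma podles_word_subproof w :
  deg w = 0 -> SU2_word w \in sp_pred (SU2_part 0).
Proof. by move=> dw; rewrite sp_predE; apply/asboolP/mem_span; exists w. Qed.

Lemma deg_bplus : deg [:: Gc; Gd] = 0. Proof. by rewrite /deg unlock. Qed.
Lemma deg_bminus : deg [:: Ga; Gb] = 0. Proof. by rewrite /deg unlock. Qed.

Definition b_plus : podles := Sub (SU2_word [:: Gc; Gd])
  (podles_word_subproof deg_bplus).
Definition b_minus : podles := Sub (SU2_word [:: Ga; Gb])
  (podles_word_subproof deg_bminus).

(** [forms k] is the space of [k]-forms in the total algebra [Om]; [inc]
    identifies the Podles sphere with the 0-forms. *)
Record calculus := Calculus {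
  Om :> algType C;
  forms : nat -> subspace Om;
  inc : {lrmorphism podles -> Om};
  dif : {linear Om -> Om};
  forms_sum : direct_sum xpredT forms sp_full;
  formsM : forall k l u v, forms k u -> forms l v -> forms (k + l) (u * v);
  inc_inj : injective inc;
  forms0 : forall u, forms 0 u <-> exists m, u = inc m;
  dif_forms : forall k u, forms k u -> forms k.+1 (dif u);
  dif_dif : forall u, dif (dif u) = 0;
  dif_leibniz : forall k u v, forms k u ->
    dif (u * v) = dif u * v + (-1) ^+ k *: (u * dif v);
  forms_span : forall k u, forms k u <->
    span (fun v => exists (m0 : podles) (m : k.-tuple podles),
            v = inc m0 * \prod_(x <- m) dif (inc x)) u }.

Section Calculus.
Variable Om : calculus.

(** Left coactions of [SU2] on the calculus, compatible with the algebra
    structure, extending the coproduct on the 0-forms (the tensor [t] below is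
    the coaction of the Podles sphere applied to [m]) and commuting with the
    differential. *)
Definition is_coaction (D : {lrmorphism Om -> tensor SU2 Om}) :=
  [/\ forall w, tassoc (tmap coprod id (D w)) = tmap id D (D w),
      forall w, teval (fun u v => (counit u : C) *: v) (D w) = w,
      forall m, exists2 t : tensor SU2 podles,
        tmap id podles_val t = coprod (podles_val m) &
        D (inc Om m) = tmap id (inc Om) t
    & forall w, D (dif Om w) = tmap id (dif Om) (D w)].


(** The quotient by [M^+ Om], written [w |-> [w]] in the literature. *)
Definition Mplus_Om : subspace Om :=
  span (fun v => exists (m : podles) (w : Om),
          counit (podles_val m) = 0 /\ v = inc Om m * w).
Definition fibre : lmodType C := qmod Mplus_Om.
Definition cls (w : Om) : fibre := qclass Mplus_Om w.

Definition e_plus : fibre := cls (dif Om (inc Om b_plus)).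
Definition e_minus : fibre := cls (dif Om (inc Om b_minus)).
Definition tau : fibre :=
  cls (dif Om (inc Om b_plus) * dif Om (inc Om b_minus)).

Definition one_forms_classical :=
  sp_dim 2 (sp_img (qclass Mplus_Om) (forms Om 1)).

(** [S = E_k e] under the identification of [w] with [w_(-1) (x) [w_(0)]]. *)
Definition identified (D : Om -> tensor SU2 Om) (S : subspace Om) (k : int)
    (e : fibre) :=
  let Phi w := tmap id cls (D w) in
  [/\ e != 0,
      forall w, S w -> exists2 u, SU2_part k u & Phi w = u \tensor e
    & forall u, SU2_part k u -> exists! w, S w /\ Phi w = u \tensor e].

(** [P (x)_M Q] is the quotient of [P (x) Q] over [C] by the span of the
    [u m (x) v - u (x) m v]; here [u'] is [u m] and [v'] is [m v]. *)
Definition balanced (P Q : subspace Om) :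
    subspace (tensor (sp_type P) (sp_type Q)) :=
  span (fun t => exists (m : podles) (u u' : sp_type P) (v v' : sp_type Q),
    [/\ val u' = val u * inc Om m, val v' = inc Om m * val v
      & t = u' \tensor v - u \tensor v']).
Definition tensorM (P Q : subspace Om) : lmodType C := qmod (balanced P Q).

Definition wedge_iso (P Q S : subspace Om) :=
  exists2 f : {linear tensorM P Q -> sp_type S}, bijective f &
    forall u v, val (f (qclass (balanced P Q) (u \tensor v))) = val u * val v.

Definition is_calculus_star (s : SU2 -> SU2) (t : Om -> Om) :=
  [/\ forall (k : C) u v, t (k *: u + v) = k^* *: t u + t v,
      involutive t,
      forall m m', podles_val m' = s (podles_val m) ->
        t (inc Om m) = inc Om m',
      forall w, t (dif Om w) = dif Om (t w)
    & forall k l u v, forms Om k u -> forms Om l v ->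
        t (u * v) = (-1) ^+ (k * l) *: (t v * t u)].

(** An almost complex structure, apart from its compatibility with the
    involution. *)
Definition is_complex_grading (G : nat -> nat -> subspace Om) :=
  [/\ forall k, direct_sum (fun p : nat * nat => p.1 + p.2 == k)%N
        (fun p => G p.1 p.2) (forms Om k),
      forall p r p' r' u v, G p r u -> G p' r' v ->
        G (p + p')%N (r + r')%N (u * v),
      forall p r, wedge_iso (G p 0%N) (G 0%N r) (G p r)
    & forall p r, wedge_iso (G 0%N r) (G p 0%N) (G p r)].

Definition is_covariant_grading (D : Om -> tensor SU2 Om)
    (G : nat -> nat -> subspace Om) :=
  forall p r w, G p r w ->
    span (fun t => exists u v, G p r v /\ t = u \tensor v) (D w).

End Calculus.

(** The double complex of the standard Podles sphere. The involution is
    only required when [q] is real, which is the case in which [SU2] has its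
    [*]-structure. The last six fields fix which of the two summands of the
    one-forms has bidegree (1,0), and determine the calculus also for
    non-real [q]. *)
Record dolbeault := Dolbeault {
  calc :> calculus;
  coact : {lrmorphism calc -> tensor SU2 calc};
  bideg : nat -> nat -> subspace calc;
  del : {linear calc -> calc};
  delbar : {linear calc -> calc};
  coactP : is_coaction coact;
  bidegP : is_complex_grading bideg;
  bideg_covariant : is_covariant_grading coact bideg;
  bideg_star : q \is Num.real ->
    exists (s : SU2 -> SU2) (t : calc -> calc),
      [/\ is_SU2_star s, is_calculus_star s t
        & forall p r w, bideg p r w -> bideg r p (t w)];
  dif_split : forall w, dif calc w = del w + delbar w;
  del_bideg : forall p r w, bideg p r w -> bideg p.+1 r (del w);
  delbar_bideg : forall p r w, bideg p r w -> bideg p r.+1 (delbar w);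
  classical_dim : one_forms_classical calc;
  forms10 : identified coact (bideg 1 0) 2 (e_plus calc);
  forms01 : identified coact (bideg 0 1) (-2) (e_minus calc);
  forms2 : identified coact (forms calc 2) 0 (tau calc);
  forms11 : forall w, forms calc 2 w <-> bideg 1 1 w;
  forms_gt2 : forall k w, (2 < k)%N -> forms calc k w -> w = 0 }.

Section Cohomology.
Variable X : dolbeault.

Definition prev (S : nat -> subspace X) (k : nat) : subspace X :=
  if k is k'.+1 then S k' else sp_zero.

Definition deRham (k : nat) : lmodType C :=
  subquot (sp_cap (forms X k) (sp_ker (dif X)))
          (sp_img (dif X) (prev (forms X) k)).

Definition Hdel (a b : nat) : lmodType C :=
  subquot (sp_cap (bideg X a b) (sp_ker (del X)))
          (sp_img (del X) (prev (bideg X ^~ b) a)).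

Definition Hdelbar (a b : nat) : lmodType C :=
  subquot (sp_cap (bideg X a b) (sp_ker (delbar X)))
          (sp_img (delbar X) (prev (bideg X a) b)).

End Cohomology.
End QuantumSU2.

(* Main.v *)
(** Write S_t for the degree-t part of C_q[SU_2], and E, F for the two twisted
    derivations of C_q[SU_2] that replace a, c by b, d, respectively b, d by
    a, c. Sending a form to its coefficient of e^+, e^- or tau identifies
    Omega^(1,0), Omega^(0,1) and Omega^2 with S_2, S_-2 and S_0. Covariance and
    the Leibniz rule leave no choice for the differentials: on functions they
    become q^-1 E and F, on the (0,1)- and (1,0)-forms they become q E and - F
    (the last two constants come from a relation of the bimodule of one-forms,
    from d^2 = 0 and from the definition of tau).

    The cohomology is then computed in the basis a^n b^m z^i, with z = b c, and
    with a^-1, b^-1 standing for d, c. There E and F act by coefficients that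
    are, up to units, the q-integers [k] = 1 + q^-2 + ... + q^(-2(k-1)). If no
    [k] with k > 0 vanishes, then E and F are injective or surjective as for
    q = 1: all four Dolbeault groups are zero and H^0, H^2 are lines. If some
    [k] vanishes, each of the six groups contains an explicit infinite linearly
    independent family; since C_q[SU_2] has countable dimension, all six groups
    are vector spaces of countably infinite dimension, hence isomorphic. *)

(* The calculus is given by axioms alone, so its bimodule structure and differentials must be
   extracted from them. The recurring device is a degree count: id (x) L applied to the coproduct of
   b c has summands in degrees -2, 0 and 2, and when the result, after multiplication by a word, is
   known to be homogeneous, the values of L attached to the wrong degrees vanish. What remains
   undetermined are a few constants.

   The algebra is defined by its universal property, so independence of monomials must come from a
   representation, here on the localisation at a and b. There E and F acquire more kernel: b^-2 has
   degree -2 and is killed by E. Such elements are excluded by a degree bound. Since d = a^-1 (1 + q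
   z) and c = b^-1 z, an element of C_q[SU_2] has, at negative exponents of a or b, a coefficient in
   C[z] of correspondingly large degree, and this bound forces injectivity when all [k] are
   nonzero. *)
From HB Require Import structures.
From mathcomp Require Import all_boot all_algebra.
From mathcomp Require Import boolp classical_sets functions reals complex.
From mathcomp Require Import zify ring.
Require Import Defs.

Set Implicit Arguments.
Unset Strict Implicit.
Unset Printing Implicit Defensive.

Import GRing.Theory Num.Theory.

Local Open Scope ring_scope.

(** * Linear algebra over a field *)

Section LinearAlgebra.
Variable K : fieldType.
Implicit Types U V W : lmodType K.

Lemma spD V (S : subspace V) u v : S u -> S v -> S (u + v).
Proof. by move=> Su Sv; rewrite -[u]scale1r; exact: sp_setP. Qed.

Lemma spZ V (S : subspace V) k u : S u -> S (k *: u).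
Proof. by move=> Su; rewrite -[_ *: _]addr0; apply: sp_setP => //; exact: sp_set0. Qed.

Lemma spB V (S : subspace V) u v : S u -> S v -> S (u - v).
Proof. by move=> Su Sv; rewrite -scaleN1r; apply: spD => //; exact: spZ. Qed.

Lemma sp_sum V (S : subspace V) (I : eqType) (r : seq I) (f : I -> V) :
  (forall i, i \in r -> S (f i)) -> S (\sum_(i <- r) f i).
Proof.
move=> Sf; rewrite big_seq; elim/big_ind: _ => //; first exact: sp_set0.
by move=> x y; exact: spD.
Qed.

Lemma span_min V (X : set V) (S : subspace V) :
  (forall v, X v -> S v) -> forall v, span X v -> S v.
Proof.
move=> XS _ [s [Xs ->]]; apply: sp_sum => p ps; apply: spZ; exact/XS/Xs.
Qed.

Definition mk_linear V W (f : V -> W) (hf : linear f) : {linear V -> W} :=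
  HB.pack f (GRing.isLinear.Build K V W *:%R f hf).

Lemma linear_comb V W (f : V -> W) : linear f -> forall n (k : 'I_n -> K) (v : 'I_n -> V),
  f (\sum_i k i *: v i) = \sum_i k i *: f (v i).
Proof.
move=> hf n k v; rewrite -[f]/(mk_linear hf : V -> W) linear_sum.
by apply: eq_bigr => i _; rewrite linearZ.
Qed.

(** Zorn's lemma gives a complement C of U containing W. Conditions are put on [A x \/ W x] rather
    than on A because the chain in [Zorn_bigcup] may be empty, so the empty set has to be
    admissible. A vector outside U + C could be adjoined to C without meeting U, against maximality;
    p is the projection onto U along C. *)
Lemma complement_projection V (U W : subspace V) :
  (forall x, U x -> W x -> x = 0) ->
  exists p : {linear V -> V},
    [/\ forall x, U x -> p x = x, forall x, W x -> p x = 0 & forall x, U (p x)].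
Proof.
move=> UW0.
pose clos (A : set V) := forall x, A x \/ W x -> forall y, A y \/ W y ->
  forall k, A (k *: x + y) \/ W (k *: x + y).
pose P (A : set V) := clos A /\ forall x, A x \/ W x -> U x -> x = 0.
have [F FP Ftot|A [[Acl AU] Amax]] := @Zorn_bigcup V P.
  split.
    move=> x [[A FA Ax]|Wx] y [[B FB By]|Wy] k.
    - have [AB|BA] := Ftot _ _ FA FB.
        by case: ((FP _ FB).1 _ (or_introl (AB _ Ax)) _ (or_introl By) k);
          [left; exists B|right].
      by case: ((FP _ FA).1 _ (or_introl Ax) _ (or_introl (BA _ By)) k);
        [left; exists A|right].
    - by case: ((FP _ FA).1 _ (or_introl Ax) _ (or_intror Wy) k);
        [left; exists A|right].
    - by case: ((FP _ FB).1 _ (or_intror Wx) _ (or_introl By) k);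
        [left; exists B|right].
    - by right; exact: sp_setP.
  move=> x [[A FA Ax]|Wx] Ux; last exact: UW0.
  by apply: (FP _ FA).2 => //; left.
pose C x := A x \/ W x.
have C0 : C 0 by right; exact: sp_set0.
have CZ k x : C x -> C (k *: x).
  by move=> Cx; rewrite -[_ *: _]addr0; exact: Acl.
have dec v : exists u, U u /\ C (v - u).
  apply: contrapT => nv.
  have nCv : ~ C v by move=> Cv; apply: nv; exists 0; split; [exact: sp_set0|rewrite subr0].
  pose B x := exists k c, C c /\ x = c + k *: v.
  have CB x : C x -> B x by move=> Cx; exists 0, x; rewrite scale0r addr0.
  have BW x : B x \/ W x -> B x by case=> // Wx; apply: CB; right.
  apply: (Amax B); first split.
  - by move=> x Ax; apply: CB; left.
  - move=> BA; apply: nCv; left; apply: BA; exists 1, 0.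
    by rewrite scale1r add0r.
  - split.
      move=> x /BW [k [c [Cc ->]]] y /BW [k' [c' [Cc' ->]]] l; left.
      exists (l * k + k'), (l *: c + c'); split; first exact: Acl.
      by rewrite scalerDr scalerDl scalerA addrACA.
    move=> x /BW [k [c [Cc ->]]] Uu.
    have [k0|k0] := eqVneq k 0.
      by move: Uu; rewrite k0 scale0r addr0; exact: AU.
    exfalso; apply: nv; exists (k^-1 *: (c + k *: v)); split; first exact: spZ.
    rewrite scalerDr scalerA mulVf // scale1r opprD addrCA subrr addr0 -scaleNr.
    exact: CZ.
have [p pP] := choice dec.
have uniq v u u' : U u -> C (v - u) -> U u' -> C (v - u') -> u = u'.
  move=> Uu Cu Uu' Cu'; apply/eqP; rewrite -subr_eq0; apply/eqP.
  apply: AU; last exact: spB.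
  have -> : u - u' = (-1) *: (v - u) + (v - u').
    by rewrite scaleN1r opprB addrA subrK.
  exact: Acl.
have plin : linear p.
  move=> k x y; have [Ux Cx] := pP x; have [Uy Cy] := pP y.
  have [Uxy Cxy] := pP (k *: x + y).
  apply: (uniq (k *: x + y)) => //; first exact: sp_setP.
  by rewrite opprD addrACA -scalerBr; exact: Acl.
exists (mk_linear plin); split=> x //=; last by case: (pP x).
- move=> Ux; have [Up Cp] := pP x; apply: (uniq x) => //.
  by rewrite subrr.
- move=> Wx; have [Up Cp] := pP x; apply: (uniq x) => //; first exact: sp_set0.
  by rewrite subr0; right.
Qed.

Lemma line_proof V (e : V) : forall k u v,
  (exists c, u = c *: e) -> (exists c, v = c *: e) -> exists c, k *: u + v = c *: e.
Proof. by move=> k _ _ [c ->] [c' ->]; exists (k * c + c'); rewrite scalerDl scalerA. Qed.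

Definition line V (e : V) : subspace V :=
  Subspace (sp_set := fun v => exists c, v = c *: e)
    (ex_intro _ 0 (esym (scale0r e))) (@line_proof V e).

(** V need not be finite-dimensional, so the functional is obtained from a projection onto the line
    of e. The functionals dual to [e_plus], [e_minus] and [tau] come from here. *)
Lemma dual_vector V (e : V) (W : subspace V) : ~ W e ->
  exists f : {linear V -> K^o}, f e = 1 /\ forall x, W x -> f x = 0.
Proof.
move=> We.
have e0 : e != 0 by apply/eqP => e0; apply: We; rewrite e0; exact: sp_set0.
have [x [c ->] Wx|p [pe pW pU]] := complement_projection (U := line e) (W := W).
  have [->|c0] := eqVneq c 0; first exact: scale0r.
  by case: We; rewrite -[e]scale1r -(mulVf c0) -scalerA; exact: spZ.
have [f fP] := choice pU.
have inj c c' : c *: e = c' *: e -> c = c'.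
  move=> /eqP; rewrite -subr_eq0 -scalerBl scaler_eq0 (negPf e0) orbF subr_eq0.
  by move/eqP.
have flin : linear (f : V -> K^o).
  move=> k x y; apply: inj; rewrite -fP linearP !fP scalerDl -scalerA //.
exists (mk_linear flin); split=> [|x Wx] /=; apply: inj; rewrite -fP.
  by rewrite scale1r pe //; exists 1; rewrite scale1r.
by rewrite scale0r pW.
Qed.

Lemma functional_ext V (x y : V) :
  (forall f : {linear V -> K^o}, f x = f y) -> x = y.
Proof.
move=> h; apply/eqP; rewrite -subr_eq0; apply/eqP; apply: contrapT => n0.
have [|f [f1 _]] := @dual_vector V (x - y) sp_zero; first exact: n0.
by move: f1; rewrite linearB h subrr => /esym /eqP; rewrite oner_eq0.
Qed.

Lemma retraction U V (f : {linear U -> V}) : injective f ->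
  exists r : {linear V -> U}, forall x, r (f x) = x.
Proof.
move=> finj.
have [x _ ->//|p [pe _ pU]] := complement_projection (U := sp_img f sp_full) (W := sp_zero).
have h x : exists u, f u = p x by have [u _ <-] := pU x; exists u.
have [r' rP] := choice h.
have rlin : linear r'.
  by move=> k x y; apply: finj; rewrite linearP !rP linearP.
exists (mk_linear rlin) => x /=; apply: finj; rewrite rP pe //.
by exists x.
Qed.

Lemma bijective_linear U V (f : {linear U -> V}) :
  injective f -> (forall y, exists x, f x = y) -> bijective f.
Proof.
move=> finj fsurj; have [g gP] := choice fsurj.
by exists g => // x; apply: finj; rewrite gP.
Qed.

Lemma lmod_iso_sym U V : lmod_iso U V -> lmod_iso V U.
Proof.
move=> [f [g fK gK]].
have glin : linear g.
  by move=> k x y; apply: (can_inj fK); rewrite linearP !gK.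
by exists (mk_linear glin); exists f.
Qed.

Lemma lmod_iso_trans U V W : lmod_iso U V -> lmod_iso V W -> lmod_iso U W.
Proof.
by move=> [f fb] [g gb]; exists (g \o f : {linear U -> W}); exact: bij_comp.
Qed.

Lemma lmod_iso_zero U V :
  (forall x : U, x = 0) -> (forall x : V, x = 0) -> lmod_iso U V.
Proof.
move=> U0 V0; exists (\0 : {linear U -> V}).
by apply: bijective_linear => [x y _|y]; [rewrite (U0 x) (U0 y)|exists 0; rewrite (V0 y) (V0 (_ 0))].
Qed.

Definition is_line V := exists e : V, e <> 0 /\ forall v, exists c, v = c *: e.

Lemma is_line_iso V : is_line V -> lmod_iso K^o V.
Proof.
move=> [e [/eqP e0 eP]].
have flin : linear (fun c : K^o => c *: e).
  by move=> k x y; rewrite scalerDl -scalerA.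
exists (mk_linear flin); apply: bijective_linear => [x y /= /eqP|v].
  by rewrite -subr_eq0 -scalerBl scaler_eq0 (negPf e0) orbF subr_eq0 => /eqP.
by have [c ->] := eP v; exists c.
Qed.

Lemma is_line_dim_ge V : is_line V -> dim_ge V 1.
Proof.
move=> [e [/eqP e0 _]]; exists (fun=> e) => k; rewrite big_ord1 => /eqP.
rewrite scaler_eq0 (negPf e0) orbF => /eqP k0 i.
by rewrite (ord1 i).
Qed.

(** * Spaces of countably infinite dimension *)

Definition countdim V := exists s : nat -> V,
  forall v, exists n (k : nat -> K), v = \sum_(i < n) k i *: s i.

(** The families for different n are unrelated; a single infinite basis appears only in
    [basis_sequence]. *)
Definition infdim V := forall n, dim_ge V n.

Lemma countdim_inj U V (f : {linear U -> V}) : injective f -> countdim V -> countdim U.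
Proof.
move=> /retraction[r rK] [s sP]; exists (fun i => r (s i)) => u.
have [n [k e]] := sP (f u); exists n, k; rewrite -(rK u) e linear_sum.
by apply: eq_bigr => i _; rewrite linearZ.
Qed.

Lemma countdim_surj U V (f : {linear U -> V}) :
  (forall y, exists x, f x = y) -> countdim U -> countdim V.
Proof.
move=> fsurj [s sP]; exists (fun i => f (s i)) => v; have [u <-] := fsurj v.
have [n [k ->]] := sP u; exists n, k; rewrite linear_sum.
by apply: eq_bigr => i _; rewrite linearZ.
Qed.

(** The coefficient matrix has n + 1 rows and n columns, hence a nonzero vector in its left
    kernel. *)
Lemma dependent_in_span V n (s : 'I_n -> V) (e : 'I_n.+1 -> V) :
  (forall i, exists k : 'I_n -> K, e i = \sum_j k j *: s j) -> ~ lin_indep e.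
Proof.
move=> /choice[A eA] ind.
pose M := \matrix_(i, j) A i j.
have : kermx M != 0.
  rewrite -mxrank_eq0 mxrank_ker subn_eq0 -ltnNge ltnS; exact: rank_leq_col.
move=> /rowV0Pn[u /sub_kermxP uM]; apply/negP; rewrite negbK; apply/eqP/rowP => i.
rewrite mxE; apply: (ind (fun i => u 0 i)).
under eq_bigr do rewrite eA scaler_sumr.
rewrite exchange_big big1 //= => j _.
have /rowP/(_ j) := uM; rewrite !mxE => uMj.
under eq_bigr do rewrite scalerA.
rewrite -scaler_suml (_ : \sum_i0 _ = 0) ?scale0r // -[RHS]uMj.
by apply: eq_bigr => i' _; rewrite mxE.
Qed.

Section CountableBasis.
Variables (V : lmodType K) (s : nat -> V).

Definition initial (f : nat -> V) (n : nat) : subspace V := span (fun v => exists2 i, (i < n)%N & v = f i).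

Lemma initialW f m n v : (m <= n)%N -> initial f m v -> initial f n v.
Proof.
move=> mn; apply: span_min => _ [i im ->]; apply: mem_span; exists i => //.
exact: leq_trans mn.
Qed.

Lemma initial_mem f n i : (i < n)%N -> initial f n (f i).
Proof. by move=> i_n; apply: mem_span; exists i. Qed.

Definition combinations (f : nat -> V) (n : nat) : subspace V.
Proof.
exists (fun v => exists k : 'I_n -> K, v = \sum_(i < n) k i *: f i).
  by exists (fun=> 0); rewrite big1 // => i _; rewrite scale0r.
move=> c _ _ [k ->] [k' ->]; exists (fun i => c * k i + k' i).
by rewrite scaler_sumr -big_split; apply: eq_bigr => i _; rewrite scalerDl scalerA.
Defined.

Lemma initialP f n v : initial f n v -> exists k : 'I_n -> K, v = \sum_(i < n) k i *: f i.
Proof.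
apply: (span_min (S := combinations f n)) => _ [i i_n ->] /=.
exists (fun j => (j == i :> nat)%:R); rewrite (bigD1 (Ordinal i_n)) //=.
rewrite eqxx scale1r big1 ?addr0 // => j.
by rewrite -val_eqE /= => /negPf ->; rewrite scale0r.
Qed.

Hypothesis spans : forall v, exists n (k : nat -> K), v = \sum_(i < n) k i *: s i.
Hypothesis inf : infdim V.

(** If no such i existed, every s i would lie in the span of the first N, against [inf]. The last
    clause makes the skipped vectors redundant, so that the selected subsequence still spans. *)
Lemma fresh_index N : exists i, [/\ (N <= i)%N, ~ initial s i (s i) &
  forall j, (N <= j < i)%N -> initial s j (s j)].
Proof.
pose sel i := (N <= i)%N && ~~ `[< initial s i (s i) >].
have exsel : exists i, sel i.
  apply: contrapT => no.
  have low i : (N <= i)%N -> initial s i (s i).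
    move=> Ni; apply: contrapT => si; apply: no; exists i.
    by rewrite /sel Ni; apply/asboolP.
  have all i : initial s N (s i).
    have [n le_in] := ubnP i; elim: n => // n IHn in i le_in *.
    have [/initial_mem//|Ni] := ltnP i N.
    apply: (span_min (S := initial s N) _ (low i Ni)) => _ [j ji ->]; apply: IHn.
    exact: leq_trans ji le_in.
  have [e] := inf N.+1; apply: (@dependent_in_span _ N (fun i => s i)) => i.
  apply: initialP; have [n [k ->]] := spans (e i).
  by apply: sp_sum => j _; exact: spZ.
have [i' /andP[Ni' /asboolPn si'] imin] := ex_minnP exsel.
exists i'; split=> // j /andP[Nj ji']; apply: contrapT => sj.
have /imin : sel j by rewrite /sel Nj; apply/asboolPn.
by rewrite leqNgt ji'.
Qed.

Lemma basis_sequence : exists b : nat -> V,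
  (forall n (k : 'I_n -> K), \sum_i k i *: b i = 0 -> forall i, k i = 0) /\
  forall v, exists n, initial b n v.
Proof.
have [nx nxP] := choice fresh_index.
(* Greedy selection: phi enumerates in increasing order the indices i for which s i is not in the
   span of its predecessors. *)
pose phi n := iter n (fun m => nx m.+1) (nx 0).
pose b n := s (phi n).
have fr n : ~ initial s (phi n) (s (phi n)).
  by case: n => [|n]; [case: (nxP 0)|case: (nxP (phi n).+1)].
have phiS n : (phi n < phi n.+1)%N by case: (nxP (phi n).+1).
have phi_mono m n : (m < n)%N -> (phi m < phi n)%N.
  elim: n => // n IHn; rewrite ltnS leq_eqVlt => /orP[/eqP ->//|/IHn mn].
  exact: ltn_trans mn (phiS n).
have bs n v : initial b n v -> initial s (phi n) v.
  by apply: span_min => _ [i i_n ->]; apply: initial_mem; exact: phi_mono.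
have step N n : (forall i, (i < N)%N -> initial b n (s i)) ->
    forall j, (j < nx N)%N -> initial b n (s j).
  move=> hN j; have [m le_jm] := ubnP j; elim: m => // m IHm in j le_jm *.
  move=> jN; have [/hN//|Nj] := ltnP j N.
  have [_ _ /(_ j)] := nxP N; rewrite Nj jN => /(_ isT).
  apply: span_min => _ [i ij ->]; apply: IHm; last exact: ltn_trans jN.
  exact: leq_trans ij le_jm.
have below n j : (j < phi n)%N -> initial b n (s j).
  elim: n j => [|n IHn]; first exact: step.
  apply: step => i; rewrite ltnS leq_eqVlt => /orP[/eqP ->|/IHn].
    exact: initial_mem.
  exact: initialW.
have phi_ge n : (n <= phi n)%N.
  by elim: n => // n IHn; exact: leq_ltn_trans (phiS n).
exists b; split.
  elim=> [|n IHn] k; first by move=> _ [].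
  rewrite big_ord_recr /= => e.
  have kn : k ord_max = 0.
    apply: contrapT => /eqP kn; apply: (fr n).
    have -> : s (phi n) = - (k ord_max)^-1 *: \sum_(i < n) k (widen_ord (leqnSn n) i) *: b i.
      move/eqP: e; rewrite addr_eq0 => /eqP ->.
      by rewrite scalerN scaleNr opprK scalerA mulVf // scale1r.
    apply: spZ; apply: bs; apply: sp_sum => i _; apply: spZ; exact: initial_mem.
  move: e; rewrite kn scale0r addr0 => /IHn kz i.
  have [j ->|->] := unliftP ord_max i; last exact: kn.
  by rewrite -(kz j); congr (k _); apply: val_inj; rewrite /= /bump leqNgt ltn_ord.
move=> v; have [n [k ->]] := spans v; exists n; apply: sp_sum => i _; apply: spZ.
by apply: below; apply: leq_trans (phi_ge n).
Qed.

End CountableBasis.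

(** [{poly K}] serves as the standard space with a basis indexed by [nat]. The same map, applied to
    the family [mon n m], later substitutes z = b c into a polynomial. *)
Definition poly_comb V (b : nat -> V) (p : {poly K}) : V := \sum_(i < size p) p`_i *: b i.

Lemma sum_widen V (f : nat -> V) m n : (m <= n)%N ->
  (forall i, (m <= i)%N -> f i = 0) -> \sum_(i < m) f i = \sum_(i < n) f i.
Proof.
move=> le_mn f0; rewrite -!(big_mkord xpredT f) [RHS](big_cat_nat (n := m)) //=.
rewrite [X in _ = _ + X]big1_seq ?addr0 // => i.
by rewrite mem_index_iota => /andP[_ /andP[/f0]].
Qed.

Lemma poly_combE V (b : nat -> V) n (p : {poly K}) :
  (size p <= n)%N -> poly_comb b p = \sum_(i < n) p`_i *: b i.
Proof.
move=> le_pn; apply: (sum_widen (f := fun i => p`_i *: b i)) => // i le_pi.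
by rewrite nth_default ?scale0r.
Qed.

Lemma poly_comb_linear V (b : nat -> V) : linear (poly_comb b).
Proof.
move=> k p q; pose n := maxn (size (k *: p + q)) (maxn (size p) (size q)).
rewrite (@poly_combE _ b n (k *: p + q)) ?(@poly_combE _ b n p) ?(@poly_combE _ b n q)
  ?leq_max ?leqnn ?orbT //.
rewrite scaler_sumr -big_split; apply: eq_bigr => i _.
by rewrite coefD coefZ scalerDl scalerA.
Qed.

Lemma poly_combXn V (b : nat -> V) i : poly_comb b 'X^i = b i.
Proof.
rewrite /poly_comb size_polyXn big_ord_recr /= coefXn eqxx scale1r big1 ?add0r // => j _.
by rewrite coefXn (ltn_eqF (ltn_ord j)) scale0r.
Qed.

Lemma countdim_iso V : countdim V -> infdim V -> lmod_iso {poly K} V.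
Proof.
move=> [s sP] inf; have [b [bi bs]] := basis_sequence sP inf.
exists (mk_linear (poly_comb_linear b)); apply: bijective_linear => [|v].
  apply: raddf_inj => p /= /bi p0; apply/polyP => i; rewrite coef0.
  have [le_pi|lt_ip] := leqP (size p) i; first by rewrite nth_default.
  exact: (p0 (Ordinal lt_ip)).
have [n /initialP[k ->]] := bs v.
exists (\poly_(i < n) (if insub i is Some j then k j else 0)) => /=.
rewrite (@poly_combE _ b n) ?size_poly //; apply: eq_bigr => i _.
by rewrite coef_poly ltn_ord valK.
Qed.

Lemma infdim_iso U V : countdim U -> countdim V -> infdim U -> infdim V -> lmod_iso U V.
Proof.
by move=> cU cV iU iV; apply: lmod_iso_trans (lmod_iso_sym _) (countdim_iso cV iV);
  exact: countdim_iso.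
Qed.

(** * Subquotients: vanishing, lines and dimension *)

Section SubQuotient.
Variables (V : lmodType K) (Z B : subspace V).

Definition sqclass (z : V) (hz : Z z) : subquot Z B :=
  qclass _ (exist _ z (introT (asboolP _) hz) : sp_type Z).

Lemma sqclassP (x : subquot Z B) : exists z (hz : Z z), x = sqclass hz.
Proof.
rewrite -[x]qclass_repr; case: (repr x) => z zZ.
exists z, (elimT (asboolP _) zZ); rewrite /sqclass; congr (qclass _ _).
exact: val_inj.
Qed.

Lemma sqclass_eq z z' (hz : Z z) (hz' : Z z') :
  sqclass hz = sqclass hz' <-> B (z - z').
Proof. by rewrite /sqclass qclassE. Qed.

Lemma sqclass_eq0 z (hz : Z z) : sqclass hz = 0 <-> B z.
Proof.
have -> : 0 = sqclass (sp_set0 Z).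
  by rewrite -(linear0 (qclass _)); congr (qclass _ _); exact: val_inj.
by rewrite sqclass_eq subr0.
Qed.

Lemma sqclassZ k z (hz : Z z) : k *: sqclass hz = sqclass (spZ k hz).
Proof. by rewrite -linearZ; congr (qclass _ _); exact: val_inj. Qed.

Lemma sqclass_sum n (k : 'I_n -> K) (e : 'I_n -> V) (he : forall i, Z (e i)) :
  exists hz, \sum_i k i *: sqclass (he i) = @sqclass (\sum_i k i *: e i) hz.
Proof.
have hz : Z (\sum_i k i *: e i) by apply: sp_sum => i _; exact: spZ.
exists hz; rewrite /sqclass; under eq_bigr do rewrite -linearZ.
rewrite -linear_sum; congr (qclass _ _); apply: val_inj.
by rewrite raddf_sum.
Qed.

Lemma subquot_zero : (forall z, Z z -> B z) -> forall x : subquot Z B, x = 0.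
Proof. by move=> ZB x; have [z [hz ->]] := sqclassP x; apply/sqclass_eq0/ZB. Qed.

Lemma subquot_line e : Z e -> ~ B e -> (forall z, Z z -> exists c, B (z - c *: e)) ->
  is_line (subquot Z B).
Proof.
move=> Ze Be h; exists (sqclass Ze); split=> [/sqclass_eq0//|x].
have [z [hz ->]] := sqclassP x; have [c Bc] := h z hz; exists c.
by rewrite sqclassZ; apply/sqclass_eq.
Qed.

Lemma subquot_infdim (e : nat -> V) : (forall i, Z (e i)) ->
  (forall n (k : 'I_n -> K), B (\sum_i k i *: e i) -> forall i, k i = 0) ->
  infdim (subquot Z B).
Proof.
move=> Ze ind n; exists (fun i : 'I_n => sqclass (Ze i)) => k.
have [hz ->] := sqclass_sum k (fun i : 'I_n => Ze i).
by move=> /sqclass_eq0; exact: ind.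
Qed.

(** Injectivity is asked on Z only, because a coefficient map is defined on all forms but injective
    just on one component. *)
Lemma subquot_countdim W (g : {linear V -> W}) :
  (forall z, Z z -> g z = 0 -> z = 0) -> countdim W -> countdim (subquot Z B).
Proof.
move=> ginj cW; apply: (@countdim_surj (sp_type Z) _ (qclass _)) => [x|].
  by exists (repr x); exact: qclass_repr.
apply: (@countdim_inj _ W (g \o val : {linear sp_type Z -> W})) => //.
apply: raddf_inj => -[z zZ] /= gz; apply: val_inj => /=; apply: ginj gz.
exact/asboolP.
Qed.

End SubQuotient.
End LinearAlgebra.

(** Linear functionals separate vectors, so a vector identity becomes a scalar one in which the
    values of f on the remaining vectors are free variables. The tactic [lmod] then leaves it to
    [field]. *)
Lemma lmod_eq (K : fieldType) (V : lmodType K) (x y : V) :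
  (forall f : V -> K, (forall u v, f (u + v) = f u + f v) ->
     (forall k u, f (k *: u) = k * f u) -> (forall u, f (- u) = - f u) ->
     f 0 = 0 -> f x = f y) -> x = y.
Proof.
by move=> h; apply: functional_ext => f; apply: h => *;
  rewrite ?(linearD, linearZ, linearN, linear0).
Qed.

Ltac lmod :=
  let f := fresh "f" in let fD := fresh in let fZ := fresh in
  let fN := fresh in let f0 := fresh in
  apply: lmod_eq => f fD fZ fN f0; rewrite !(fD, fZ, fN, f0); field; try done.

(** * Maps on tensor products and slices *)

Section TensorMaps.
Variables (K : fieldType).
Implicit Types V W U : lmodType K.

Lemma tpureDl V W (x y : V) (z : W) : (x + y) \tensor z = x \tensor z + y \tensor z.
Proof. exact: bilinDl (tpure_bilin V W) _ _ _. Qed.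
Lemma tpureDr V W (x : V) (y z : W) : x \tensor (y + z) = x \tensor y + x \tensor z.
Proof. exact: bilinDr (tpure_bilin V W) _ _ _. Qed.
Lemma tpureZl V W k (x : V) (z : W) : (k *: x) \tensor z = k *: (x \tensor z).
Proof. exact: bilinZl (tpure_bilin V W) _ _ _. Qed.
Lemma tpureZr V W k (x : V) (z : W) : x \tensor (k *: z) = k *: (x \tensor z).
Proof. exact: bilinZr (tpure_bilin V W) _ _ _. Qed.
Lemma tpure0l V W (z : W) : (0 : V) \tensor z = 0.
Proof. exact: bilin0l (tpure_bilin V W) _. Qed.
Lemma tmap_bilin V W V' W' (f : {linear V -> V'}) (g : {linear W -> W'}) :
  bilin (fun v w => f v \tensor g w).
Proof.
by split=> u k x y /=; rewrite linearP ?(tpureDl, tpureDr) ?(tpureZl, tpureZr).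
Qed.

Lemma tmap_linear V W V' W' (f : {linear V -> V'}) (g : {linear W -> W'}) :
  linear (tmap f g).
Proof. exact: teval_linear (tmap_bilin f g). Qed.

Lemma tmapE V W V' W' (f : {linear V -> V'}) (g : {linear W -> W'}) v w :
  tmap f g (v \tensor w) = f v \tensor g w.
Proof. exact: teval_pure (tmap_bilin f g) _ _. Qed.

(** [id (x) L] for a functional [L]. *)
Definition slice V W (L : W -> K) : tensor V W -> V := teval (fun v w => L w *: v).

Section Slice.
Variables (V W : lmodType K) (L : W -> K).
Hypothesis hL : linear (L : W -> K^o).

Lemma slice_bilin : bilin (fun (v : V) w => L w *: v).
Proof.
split=> u k x y /=; first by rewrite scalerDr !scalerA mulrC.
by rewrite hL scalerDl -scalerA.
Qed.

Lemma slice_linear : linear (slice L : tensor V W -> V).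
Proof. exact: teval_linear slice_bilin. Qed.

Lemma sliceE (v : V) (w : W) : slice L (v \tensor w) = L w *: v.
Proof. exact: teval_pure slice_bilin _ _. Qed.

Lemma sliceD (s t : tensor V W) : slice L (s + t) = slice L s + slice L t.
Proof. by have := slice_linear 1 s t; rewrite !scale1r. Qed.

End Slice.

Lemma slice_zero V W (s : tensor V W) : slice (fun=> 0) s = 0.
Proof. by rewrite /slice /teval /fsum big1 // => p _; exact: scale0r. Qed.

End TensorMaps.

(** * The twisted derivations [E] and [F] *)

Section Algebra.
Variables (C : numClosedFieldType) (q : C).
Hypothesis hq : q != 0.

Notation SU := (SU2 q).
Notation a := (SU2_gen q Ga).
Notation b := (SU2_gen q Gb).
Notation c := (SU2_gen q Gc).
Notation d := (SU2_gen q Gd).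
Notation word := (@SU2_word C q).

Lemma word_nil : word [::] = 1.
Proof. by []. Qed.

Lemma word_cons i w : word (i :: w) = SU2_gen q i * word w.
Proof. by rewrite SU2_wordM. Qed.

Lemma SU2_sum (u : SU) : u = \sum_(p <- repr u) p.1 *: word p.2.
Proof.
rewrite -{1}[u]reprK; apply: SU2_ext => B x hx; rewrite SU2_lift_pi //.
rewrite -[SU2_lift x]/(SU2_lift_morph hx : _ -> _) linear_sum.
apply: eq_bigr => p _; rewrite linearZ /= SU2_lift_pi // /nceval big_seq1.
by rewrite scale1r.
Qed.

Lemma SU2_ind (S : subspace SU) : (forall w, S (word w)) -> forall u, S u.
Proof. by move=> Sw u; rewrite [u]SU2_sum; apply: sp_sum => p _; exact: spZ. Qed.

Lemma SU2_lin_ext (V : lmodType C) (f g : {linear SU -> V}) :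
  (forall w, f (word w) = g (word w)) -> forall u, f u = g u.
Proof.
move=> fg u; rewrite [u]SU2_sum !linear_sum; apply: eq_bigr => p _.
by rewrite !linearZ /= fg.
Qed.

Section Rules.
Variables (B : algType C) (x : gen -> B).
Hypothesis hx : SU2_rel q x.

Lemma relations :
  [/\ x Ga * x Gb = q *: (x Gb * x Ga), x Ga * x Gc = q *: (x Gc * x Ga),
      x Gd * x Gb = q^-1 *: (x Gb * x Gd), x Gd * x Gc = q^-1 *: (x Gc * x Gd)
    & [/\ x Gc * x Gb = x Gb * x Gc, x Ga * x Gd = 1 + q *: (x Gb * x Gc)
        & x Gd * x Ga = 1 + q^-1 *: (x Gb * x Gc)]].
Proof.
case: hx => [[h1 [h2 [h3 [h4 h5]]]] [h6 h7]].
have ad : x Ga * x Gd = 1 + q *: (x Gb * x Gc) by rewrite -h7 subrK.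
do !split => //; first by rewrite h3 scalerA mulVf ?scale1r.
  by rewrite h4 scalerA mulVf ?scale1r.
have -> : x Gd * x Ga = x Ga * x Gd - (x Ga * x Gd - x Gd * x Ga).
  by rewrite opprB addrC subrK.
by rewrite h6 ad; lmod.
Qed.
End Rules.

Lemma SU2_rules :
  [/\ a * b = q *: (b * a), a * c = q *: (c * a),
      d * b = q^-1 *: (b * d), d * c = q^-1 *: (c * d)
    & [/\ c * b = b * c, a * d = 1 + q *: (b * c) & d * a = 1 + q^-1 *: (b * c)]].
Proof. exact: (relations (SU2_genP q)). Qed.

Let ab : a * b = q *: (b * a). Proof. by case: SU2_rules. Qed.
Let ac : a * c = q *: (c * a). Proof. by case: SU2_rules. Qed.
Let db : d * b = q^-1 *: (b * d). Proof. by case: SU2_rules. Qed.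
Let dc : d * c = q^-1 *: (c * d). Proof. by case: SU2_rules. Qed.
Let cb : c * b = b * c. Proof. by case: SU2_rules => _ _ _ _ []. Qed.
Let ad : a * d = 1 + q *: (b * c). Proof. by case: SU2_rules => _ _ _ _ []. Qed.
Let da : d * a = 1 + q^-1 *: (b * c). Proof. by case: SU2_rules => _ _ _ _ []. Qed.
Let ab' u : a * (b * u) = q *: (b * (a * u)). Proof. by rewrite mulrA ab -scalerAl mulrA. Qed.
Let ac' u : a * (c * u) = q *: (c * (a * u)). Proof. by rewrite mulrA ac -scalerAl mulrA. Qed.
Let db' u : d * (b * u) = q^-1 *: (b * (d * u)). Proof. by rewrite mulrA db -scalerAl mulrA. Qed.
Let dc' u : d * (c * u) = q^-1 *: (c * (d * u)). Proof. by rewrite mulrA dc -scalerAl mulrA. Qed.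
Let cb' u : c * (b * u) = b * (c * u). Proof. by rewrite mulrA cb mulrA. Qed.
Let ad' u : a * (d * u) = u + q *: (b * (c * u)).
Proof. by rewrite mulrA ad mulrDl mul1r -scalerAl mulrA. Qed.
Let da' u : d * (a * u) = u + q^-1 *: (b * (c * u)).
Proof. by rewrite mulrA da mulrDl mul1r -scalerAl mulrA. Qed.

(** The normal forms are [b^i c^j a^k] and [b^i c^j d^k]. *)
Definition normal_order := (ab', ac', db', dc', cb', ad', da', ab, ac, db, dc, cb, ad, da,
  mulr1, mul1r).

Definition expand := (mulrDl, mulrDr, mulrN, mulNr).

Lemma coprod_rel : SU2_rel q (coprod_gen q).
Proof.
rewrite /SU2_rel /coprod_gen /=.
have E (x y z t : SU) : (x \tensor y) * (z \tensor t) = (x * z) \tensor (y * t).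
  exact: tmulE.
have one : (1 : tensor SU SU) = 1 \tensor 1 by [].
by split; [do !split|split];
  rewrite !expand !E ?one ?(ab, ac, db, dc, cb, ad, da)
    ?(tpureDl, tpureDr, tpureZl, tpureZr, scalerDr); lmod.
Qed.

Definition Delta : {lrmorphism SU -> tensor SU SU} := SU2_lift_morph coprod_rel.

Arguments Delta : simpl never.

Lemma DeltaM u v : Delta (u * v) = Delta u * Delta v.
Proof. exact: rmorphM. Qed.

Lemma Delta_gen i : Delta (SU2_gen q i) = coprod_gen q i.
Proof. exact: (SU2_lift_gen coprod_rel). Qed.

Definition eps : SU -> C := @counit C q.

Lemma eps_linear : linear (eps : SU -> C^o).
Proof. exact: (SU2_lift_linear (counit_rel q)). Qed.

Lemma eps1 : eps 1 = 1.
Proof. exact: (SU2_lift1 (counit_rel q)). Qed.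

Lemma epsM u v : eps (u * v) = eps u * eps v.
Proof. exact: (SU2_liftM (counit_rel q)). Qed.

Lemma eps_gen i : eps (SU2_gen q i) = counit_gen C i.
Proof. exact: (SU2_lift_gen (counit_rel q)). Qed.

Arguments eps : simpl never.

Lemma epsD u v : eps (u + v) = eps u + eps v.
Proof. by have := eps_linear 1 u v; rewrite !scale1r. Qed.

Lemma eps0 : eps 0 = 0.
Proof. by have := eps_linear (-1) 0 0; rewrite !scaleN1r !addNr. Qed.

Lemma epsZ k u : eps (k *: u) = k * eps u.
Proof. by have := eps_linear k u 0; rewrite eps0 !addr0. Qed.

(** The product rule of a functional passes to its slice. Two terms are what a twisted derivation
    requires; a multiplicative functional is the case where the second term is zero. *)
Lemma sliceM (B : algType C) (L L1 L2 L3 L4 : B -> C) :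
  linear (L : B -> C^o) -> linear (L1 : B -> C^o) -> linear (L2 : B -> C^o) ->
  linear (L3 : B -> C^o) -> linear (L4 : B -> C^o) ->
  (forall y y', L (y * y') = L1 y * L2 y' + L3 y * L4 y') ->
  forall s t : tensor SU B,
    slice L (s * t) = slice L1 s * slice L2 t + slice L3 s * slice L4 t.
Proof.
move=> lL l1 l2 l3 l4 LM s t; move: s; apply: tensor_lin_ext.
- by move=> k x y; rewrite mulrDl -scalerAl slice_linear.
- move=> k x y; rewrite !slice_linear // !mulrDl -!scalerAl.
  by rewrite scalerDr addrACA.
move=> x y; move: t; apply: tensor_lin_ext.
- by move=> k z t; rewrite mulrDr -scalerAr slice_linear.
- move=> k z t; rewrite !slice_linear // !mulrDr -!scalerAr.
  by rewrite scalerDr addrACA.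
move=> x' y'; rewrite (tmulE x y x' y' : _ * _ = _) !sliceE // LM.
by rewrite -!scalerAl -!scalerAr !scalerA -scalerDl.
Qed.

(** The operator u |-> u_(1) L(u_(2)). It commutes with left translation, which is why covariant
    differentials take this shape. *)
Definition conv (L : SU -> C) (u : SU) : SU := slice L (Delta u).

Lemma conv_linear (L : SU -> C) : linear (L : SU -> C^o) -> linear (conv L).
Proof. by move=> lL k x y; rewrite /conv linearP slice_linear. Qed.

Lemma zero_linear : linear ((fun=> 0) : SU -> C^o).
Proof. by move=> k x y; rewrite scaler0 addr0. Qed.

Lemma conv_mult (L : SU -> C) : linear (L : SU -> C^o) ->
  (forall x y, L (x * y) = L x * L y) -> {morph conv L : x y / x * y}.
Proof.
move=> lL LM x y; rewrite /conv rmorphM.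
rewrite (@sliceM _ L L L (fun=> 0) (fun=> 0)) //; try exact: zero_linear.
- by rewrite slice_zero mul0r addr0.
- by move=> z t; rewrite LM mul0r addr0.
Qed.

Lemma conv_eps u : conv eps u = u.
Proof.
have H w : conv eps (word w) = word w.
  elim: w => [|i w IHw].
    by rewrite word_nil /conv rmorph1 [X in slice _ X](_ : _ = 1 \tensor 1) // sliceE ?eps1
      ?scale1r //; exact: eps_linear.
  rewrite word_cons conv_mult //; [|exact: eps_linear|exact: epsM].
  rewrite IHw; congr (_ * _); rewrite /conv Delta_gen.
  have lE := eps_linear.
  by case: i; rewrite sliceD // !sliceE // !eps_gen ?scale1r ?scale0r ?addr0 ?add0r.
exact: (SU2_lin_ext (f := mk_linear (conv_linear eps_linear)) (g := idfun) H).
Qed.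

Definition upper (x y z : C) : 'M[C]_2 :=
  \matrix_(i, j) if i == 0 then if j == 0 then x else y else if j == 0 then 0 else z.

Lemma upperM x y z x' y' z' :
  upper x y z * upper x' y' z' = upper (x * x') (x * y' + y * z') (z * z').
Proof.
apply/matrixP => i j; rewrite !mxE !big_ord_recl big_ord0 !mxE addr0 /=.
by case: (i == 0); case: (j == 0); rewrite ?(mul0r, mulr0, addr0, add0r).
Qed.

Lemma upperZ k x y z : k *: upper x y z = upper (k * x) (k * y) (k * z).
Proof. by apply/matrixP => i j; rewrite !mxE; do 2 case: ifP; rewrite ?mulr0. Qed.

Lemma upperB x y z x' y' z' :
  upper x y z - upper x' y' z' = upper (x - x') (y - y') (z - z').
Proof. by apply/matrixP => i j; rewrite !mxE; do 2 case: ifP; rewrite ?subr0. Qed.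

Lemma upper1 : 1 = upper 1 0 1.
Proof.
by apply/matrixP => i j; rewrite !mxE; case: i => [[|[|[]]] ?] //; case: j => [[|[|[]]] ?].
Qed.

Variables be ga : C.

(** The off-diagonal entry of the induced representation is a functional [L]
    with [L (u v) = eps u L v + L u K v]; the operator [id (x) L] on [SU2]
    is a twisted derivation. *)
Definition skew_gen (i : gen) : 'M[C]_2 :=
  match i with
  | Ga => upper 1 0 q^-1 | Gb => upper 0 be 0
  | Gc => upper 0 ga 0 | Gd => upper 1 0 q end.

Lemma skew_rel : SU2_rel q skew_gen.
Proof.
rewrite /SU2_rel /= upper1 !upperM !upperZ !upperB.
by split; [do !split|split]; congr upper; field.
Qed.

Definition skew : {lrmorphism SU -> 'M[C]_2} := SU2_lift_morph skew_rel.

Arguments skew : simpl never.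

Lemma skew_gen_val i : skew (SU2_gen q i) = skew_gen i.
Proof. exact: (SU2_lift_gen skew_rel). Qed.

Lemma skewM u v i j : skew (u * v) i j = skew u i 0 * skew v 0 j + skew u i 1 * skew v 1 j.
Proof.
rewrite rmorphM mxE !big_ord_recl big_ord0 addr0.
by have -> : lift ord0 ord0 = 1 :> 'I_2 by exact: val_inj.
Qed.

Lemma skew_linear i j : linear (fun u => skew u i j : C^o).
Proof. by move=> k x y; rewrite linearP !mxE. Qed.

Lemma skew10 u : skew u 1 0 = 0.
Proof.
apply: (SU2_ind (S := sp_ker (mk_linear (skew_linear 1 0)))) => w.
have H : skew (word w) 1 0 = 0; last exact: H.
elim: w => [|i w IHw]; first by rewrite word_nil rmorph1 mxE.
rewrite word_cons skewM IHw mulr0 addr0 skew_gen_val.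
by case: i; rewrite mxE; exact: mul0r.
Qed.

Lemma skew00 u : skew u 0 0 = eps u.
Proof.
apply: (SU2_lin_ext (f := mk_linear (skew_linear 0 0)) (g := mk_linear eps_linear)) => w.
have H : skew (word w) 0 0 = eps (word w); last exact: H.
elim: w => [|i w IHw]; first by rewrite word_nil rmorph1 eps1 mxE.
rewrite word_cons skewM epsM IHw skew10 mulr0 addr0; congr (_ * _).
by rewrite skew_gen_val eps_gen; case: i; rewrite mxE.
Qed.

(** With (be, ga) = (0, 1) this is E and with (1, 0) it is F: the actions of the two nilpotent
    generators of U_q(sl_2). *)
Definition der : {linear SU -> SU} := mk_linear (conv_linear (skew_linear 0 1)).

Lemma derE u : der u = conv (fun u => skew u 0 1) u.
Proof. by []. Qed.

(** The action of the group-like generator of U_q(sl_2): it multiplies degree t by q^t and is the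
    twist in the Leibniz rule of [der]. *)
Definition tor : SU -> SU := conv (fun u => skew u 1 1).

Lemma torM : {morph tor : x y / x * y}.
Proof.
apply: conv_mult; first exact: skew_linear.
by move=> x y; rewrite skewM skew10 mul0r add0r.
Qed.

Lemma tor_word w : tor (word w) = q ^ deg w *: word w.
Proof.
elim: w => [|i w IHw].
  rewrite /tor word_nil /conv rmorph1 [X in slice _ X](_ : _ = 1 \tensor 1) // sliceE; last exact: skew_linear.
  by rewrite rmorph1 mxE /deg big_nil expr0z.
rewrite word_cons torM IHw -scalerAr /deg big_cons expfzDr // -scalerA.
rewrite scalerAl scalerA mulrC -scalerA -scalerAl -/(deg w); congr (_ *: _).
rewrite scalerAl; congr (_ * _); rewrite /tor /conv Delta_gen.
have lS : linear (fun u => skew u 1 1 : C^o) := @skew_linear 1 1.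
by case: i; rewrite sliceD // !sliceE // !skew_gen_val /= !mxE /=
  ?scale0r ?addr0 ?add0r ?expr1z ?exprN1.
Qed.

Lemma tor_part t u : SU2_part q t u -> tor u = q ^ t *: u.
Proof.
have ml : linear (fun u => tor u - q ^ t *: u).
  move=> k x y; rewrite /tor conv_linear; last exact: skew_linear.
  by rewrite -/tor; lmod.
move=> tu; apply/eqP; rewrite -subr_eq0; apply/eqP.
apply: (span_min (S := sp_ker (mk_linear ml)) _ tu) => _ [w dw ->] /=.
by rewrite tor_word dw subrr.
Qed.

Lemma derM t u v : SU2_part q t v -> der (u * v) = u * der v + q ^ t *: (der u * v).
Proof.
move=> tv; rewrite scalerAr -tor_part //.
rewrite !derE -[X in X * conv _ v]conv_eps /tor /conv rmorphM.
apply: sliceM; try exact: skew_linear; first exact: eps_linear.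
by move=> y y'; rewrite skewM skew00.
Qed.

Lemma der_gen i : der (SU2_gen q i) =
  match i with Ga => ga *: b | Gb => be *: a | Gc => ga *: d | Gd => be *: c end.
Proof.
have lS : linear (fun u => skew u 0 1 : C^o) := @skew_linear 0 1.
rewrite derE /conv Delta_gen; case: i; rewrite sliceD // !sliceE // !skew_gen_val;
  by rewrite !mxE /= ?scale0r ?addr0 ?add0r.
Qed.

End Algebra.

(** * The endomorphism algebra that carries the representation *)

Section EndoRing.
Variable C : numClosedFieldType.

Notation V := (int -> int -> {poly C}).

(** The universal property of [SU2] speaks of [algType], so linear operators are packed as such an
    algebra. V consists of all functions of two exponents, which avoids carrying a finiteness
    condition on supports. *)
Record endo := Endo { endo_fun :> V -> V; endo_linear : linear endo_fun }.
HB.instance Definition _ := gen_eqMixin endo.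
HB.instance Definition _ := gen_choiceMixin endo.

Lemma endoP (f g : endo) : (forall v n m, f v n m = g v n m) -> f = g.
Proof.
move=> h.
have e : f = g :> (V -> V) by apply/funext => v; do 2 apply/funext => ?; exact: h.
case: f g e {h} => f lf [g lg] /= e.
by case: _ / e lg => lg; congr Endo; exact: Prop_irrelevance.
Qed.

Lemma endo0_subproof : linear (fun _ : V => 0 : V).
Proof. by move=> k x y; rewrite scaler0 addr0. Qed.
Lemma endo1_subproof : linear (fun v : V => v).
Proof. by []. Qed.
Lemma endoD_subproof (f g : endo) : linear (fun v => f v + g v).
Proof. by move=> k x y; rewrite !endo_linear scalerDr addrACA. Qed.
Lemma endoN_subproof (f : endo) : linear (fun v => - f v).
Proof. by move=> k x y; rewrite !endo_linear opprD scalerN. Qed.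
Lemma endoM_subproof (f g : endo) : linear (fun v => f (g v)).
Proof. by move=> k x y; rewrite !endo_linear. Qed.
Lemma endoZ_subproof c (f : endo) : linear (fun v => c *: f v).
Proof. by move=> k x y; rewrite !endo_linear scalerDr !scalerA mulrC. Qed.

Definition endo0 := Endo endo0_subproof.
Definition endo1 := Endo endo1_subproof.
Definition endoD f g := Endo (endoD_subproof f g).
Definition endoN f := Endo (endoN_subproof f).
Definition endoM f g := Endo (endoM_subproof f g).
Definition endoZ c f := Endo (endoZ_subproof c f).

Lemma endoDA : associative endoD.
Proof. by move=> f g h; apply: endoP => v n m /=; rewrite addrA. Qed.
Lemma endoDC : commutative endoD.
Proof. by move=> f g; apply: endoP => v n m /=; rewrite addrC. Qed.
Lemma endoD0 : left_id endo0 endoD.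
Proof. by move=> f; apply: endoP => v n m /=; rewrite add0r. Qed.
Lemma endoDN : left_inverse endo0 endoN endoD.
Proof. by move=> f; apply: endoP => v n m /=; rewrite addNr. Qed.
HB.instance Definition _ := GRing.isZmodule.Build endo endoDA endoDC endoD0 endoDN.

Lemma endo_add (f : endo) x y : f (x + y) = f x + f y.
Proof. by have := endo_linear f 1 x y; rewrite !scale1r. Qed.
Lemma endo_zero (f : endo) : f 0 = 0.
Proof. by have := endo_linear f (-1) 0 0; rewrite !scaleN1r !addNr. Qed.
Lemma endo_scale (f : endo) k x : f (k *: x) = k *: f x.
Proof. by have := endo_linear f k x 0; rewrite endo_zero !addr0. Qed.

Lemma endoMA : associative endoM.
Proof. by move=> f g h; apply: endoP. Qed.
Lemma endoM1 : left_id endo1 endoM.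
Proof. by move=> f; apply: endoP. Qed.
Lemma endo1M : right_id endo1 endoM.
Proof. by move=> f; apply: endoP. Qed.
Lemma endoMDl : left_distributive endoM endoD.
Proof. by move=> f g h; apply: endoP. Qed.
Lemma endoMDr : right_distributive endoM endoD.
Proof. by move=> f g h; apply: endoP => v n m /=; rewrite endo_add. Qed.
Lemma endo10 : endo1 != 0.
Proof.
apply/eqP => /(congr1 (fun f : endo => f (fun _ _ => 1) 0 0)) /eqP.
by rewrite /= oner_eq0.
Qed.
HB.instance Definition _ := GRing.Zmodule_isNzRing.Build endo
  endoMA endoM1 endo1M endoMDl endoMDr endo10.

Lemma endoZA k l f : endoZ k (endoZ l f) = endoZ (k * l) f.
Proof. by apply: endoP => v n m /=; rewrite scalerA. Qed.
Lemma endoZ1 : left_id 1 endoZ.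
Proof. by move=> f; apply: endoP => v n m /=; rewrite scale1r. Qed.
Lemma endoZDr : right_distributive endoZ +%R.
Proof. by move=> k f g; apply: endoP => v n m /=; rewrite scalerDr. Qed.
Lemma endoZDl f : {morph endoZ^~ f : k l / k + l}.
Proof. by move=> k l; apply: endoP => v n m /=; rewrite scalerDl. Qed.
HB.instance Definition _ := GRing.Zmodule_isLmodule.Build C endo
  endoZA endoZ1 endoZDr endoZDl.

Lemma endoZAl (k : C) (f g : endo) : k *: (f * g) = (k *: f) * g.
Proof. exact: endoP. Qed.
Lemma endoZAr (k : C) (f g : endo) : k *: (f * g) = f * (k *: g).
Proof. by apply: endoP => v n m /=; rewrite endo_scale. Qed.
HB.instance Definition _ := GRing.Lmodule_isLalgebra.Build C endo endoZAl.
HB.instance Definition _ := GRing.Lalgebra_isAlgebra.Build C endo endoZAr.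

End EndoRing.

(** * A faithful representation *)

Section Representation.
Variables (C : numClosedFieldType) (q : C).
Hypothesis hq : q != 0.

Notation SU := (SU2 q).
Notation a := (SU2_gen q Ga).
Notation b := (SU2_gen q Gb).
Notation c := (SU2_gen q Gc).
Notation d := (SU2_gen q Gd).
Notation word := (@SU2_word C q).
Notation V := (int -> int -> {poly C}).

(** Left multiplication after [a] and [b] have been made invertible: [f] stands
    for the sum of the [a^n b^m (f n m)(z)], with [z = b c]. *)
Definition rep_coef (i : gen) (n : int) : {poly C} :=
  match i with
  | Ga => 1 | Gb => (q ^ n)^-1%:P | Gc => (q ^ n)^-1 *: 'X
  | Gd => 1 + ((q ^ n)^-2 * q^-1) *: 'X end.
Definition rep_shift1 (i : gen) (n : int) : int :=
  match i with Ga => n - 1 | Gd => n + 1 | _ => n end.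
Definition rep_shift2 (i : gen) (m : int) : int :=
  match i with Gb => m - 1 | Gc => m + 1 | _ => m end.
Definition rep_fun i (f : V) : V :=
  fun n m => rep_coef i n * f (rep_shift1 i n) (rep_shift2 i m).

Lemma rep_fun_linear i : linear (rep_fun i).
Proof.
by move=> k f g; do 2 apply/funext => ?; rewrite /rep_fun /= mulrDr -scalerAr.
Qed.

Definition rep_gen i : endo C := Endo (rep_fun_linear i).

Lemma expqS n : q ^ (n + 1) = q ^ n * q.
Proof. by rewrite expfzDr. Qed.
Lemma expqB n : q ^ (n - 1) = q ^ n * q^-1.
Proof. by rewrite expfzDr // exprN1. Qed.

Lemma rep_rel : SU2_rel q rep_gen.
Proof.
have E (f g : endo C) v n m : (f * g) v n m = f (g v) n m by [].
have B (f g : endo C) v n m : (f - g) v n m = f v n m - g v n m by [].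
have Z k (f : endo C) v n m : (k *: f) v n m = k *: f v n m by [].
have y0 n := expfz_neq0 n hq.
rewrite /SU2_rel; split; [do !split|split]; apply: endoP => v n m;
  rewrite ?(E, B, Z) /= /rep_fun /= ?(addrK, subrK) ?expqS ?expqB;
  rewrite ?(mulrDl, mulrDr, mul1r, mul_polyC) -?(scalerAl, scalerAr); move: (y0 n) => ?; lmod;
  by rewrite ?hq ?y0.
Qed.

Definition rho : {lrmorphism SU -> endo C} := SU2_lift_morph rep_rel.

Lemma rho_gen i : rho (SU2_gen q i) = rep_gen i.
Proof. exact: (SU2_lift_gen rep_rel). Qed.

Definition act (u : SU) (f : V) : V := rho u f.

Lemma actM u v f : act (u * v) f = act u (act v f).
Proof. by rewrite /act rmorphM. Qed.
Lemma act1 f : act 1 f = f.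
Proof. by rewrite /act rmorph1. Qed.
Lemma act_lin k u v f : act (k *: u + v) f = k *: act u f + act v f.
Proof. by rewrite /act linearP. Qed.
Lemma act_gen i f : act (SU2_gen q i) f = rep_fun i f.
Proof. by rewrite /act rho_gen. Qed.
Lemma actD u v f : act (u + v) f = act u f + act v f.
Proof. by have := act_lin 1 u v f; rewrite !scale1r. Qed.
Lemma act0 f : act 0 f = 0.
Proof. by have := act_lin (-1) 0 0 f; rewrite !scaleN1r !addNr. Qed.
Lemma actZ k u f : act (k *: u) f = k *: act u f.
Proof. by have := act_lin k u 0 f; rewrite act0 !addr0. Qed.

(** The unit a^0 b^0 of the localised algebra; [hat u], the result of acting with u on it, is
    therefore the table of coefficients of u. *)
Definition vacuum : V := fun n m => ((n == 0) && (m == 0))%:R.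
Definition hat u : V := act u vacuum.

Lemma hat_linear : linear hat.
Proof. by move=> k u v; exact: act_lin. Qed.

Lemma hatM u v : hat (u * v) = act u (hat v).
Proof. exact: actM. Qed.

(** [br] extends [nb i = (p^i - 1) / (p - 1)], for [p = q^-2], to negative [i]. *)
Definition nb (i : nat) : C := \sum_(j < i) q ^- 2 ^+ j.

Definition br (n : int) : C :=
  match n with Posz i => nb i | Negz i => - (q ^+ 2 ^+ i.+1 * nb i.+1) end.

Lemma nbS i : nb i.+1 = nb i + (q ^+ i) ^- 2.
Proof. by rewrite /nb big_ord_recr /= -!exprVn -!exprM mulnC. Qed.

Lemma nb0 : nb 0 = 0. Proof. by rewrite /nb big_ord0. Qed.

Lemma nbSl i : nb i.+1 = 1 + q ^- 2 * nb i.
Proof.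
rewrite /nb big_ord_recl expr0 mulr_sumr; congr (_ + _).
by apply: eq_bigr => j _; exact: exprS.
Qed.

Lemma brS n : br (n + 1) = 1 + q ^- 2 * br n.
Proof.
case: n => [i|[|i]].
- by rewrite (_ : Posz i + 1 = i.+1) /= ?nbSl //; lia.
- by rewrite /= nbSl nb0 expr1 mulr0 addr0 mulr1; field.
have -> : Negz i.+1 + 1 = Negz i by lia.
rewrite /= (nbS i.+1) (exprS _ i.+1) [q ^+ 2 ^+ i.+1]exprAC; set x := q ^+ i.+1.
by field; rewrite hq expf_neq0.
Qed.

(** By [brS] the defect of this identity is multiplied by q^-2 when n grows by 1, and it vanishes at
    0; the induction runs in both directions. *)
Lemma br_pow n : br (n + 1) = br n + (q ^ n) ^- 2.
Proof.
have step m : br (m + 1 + 1) - br (m + 1) - (q ^ (m + 1)) ^- 2 =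
    q ^- 2 * (br (m + 1) - br m - (q ^ m) ^- 2).
  by rewrite brS [in X in _ - X - _]brS expqS; field; rewrite hq expfz_neq0.
suff H : br (n + 1) - br n - (q ^ n) ^- 2 = 0.
  by apply/eqP; rewrite -subr_eq0 opprD addrA H.
elim/int_rect: n => [|n IHn|n IHn].
- by rewrite brS /= nb0 expr0z; field.
- have -> : n.+1%:Z = n%:Z + 1 by rewrite -PoszD addn1.
  by rewrite step IHn mulr0.
- have e : - n%:Z = - n.+1%:Z + 1 by lia.
  move: IHn; rewrite e step => /eqP; rewrite mulf_eq0 invr_eq0 expf_eq0 (negPf hq) /=.
  by move/eqP.
Qed.

(** From E(a^n b^m z^i) = a^n b^m E(z^i) + q^m [n] a^(n-1) b^(m+1) z^i and E(z^i) = [i] b z^(i-1) d,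
    where d = a^-1 (1 + q z) yields both z^(i-1) and z^i. So E never raises the degree in z. *)
Definition eop (n m : int) (f : {poly C}) : {poly C} :=
  \poly_(i < size f) (q ^ m * ((q ^+ i ^+ 2 * nb i + br n) * f`_i
     + q ^+ i ^+ 2 * q * nb i.+1 * f`_i.+1)).

(** F kills a and c, so it is diagonal in the powers of z; the scalar is q^(m-1) [m + i], in the
    form that the recursion produces. *)
Definition fop (m : int) (f : {poly C}) : {poly C} :=
  \poly_(i < size f) (q ^ (m - 1) * (br m + (q ^ m) ^- 2 * nb i) * f`_i).

Lemma br_rel n : br n + (q ^ n) ^- 2 - 1 - q ^- 2 * br n = 0.
Proof. by rewrite -br_pow brS; ring. Qed.

(** [field] treats [br n] and [q ^ n] as independent variables. The relation between them, [br_rel],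
    is fed in with an explicit multiplier k. *)
Lemma eq_mod_rel (x y k r : C) : r = 0 -> x + k * r = y -> x = y.
Proof. by move=> ->; rewrite mulr0 addr0. Qed.

Lemma coef_eop n m f i :
  (eop n m f)`_i = q ^ m * ((q ^+ i ^+ 2 * nb i + br n) * f`_i
     + q ^+ i ^+ 2 * q * nb i.+1 * f`_i.+1).
Proof.
rewrite coef_poly; case: ltnP => // le_fi.
by rewrite !nth_default ?(leqW le_fi) // !mulr0 addr0 mulr0.
Qed.

Lemma coef_fop m f i : (fop m f)`_i = q ^ (m - 1) * (br m + (q ^ m) ^- 2 * nb i) * f`_i.
Proof.
by rewrite coef_poly; case: ltnP => // le_fi; rewrite nth_default // mulr0.
Qed.

Definition Eop (f : V) : V := fun n m => eop (n + 1) (m - 1) (f (n + 1) (m - 1)).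
Definition Fop (f : V) : V := fun n m => fop (m + 1) (f (n - 1) (m + 1)).
Definition Kop (f : V) : V := fun n m => q ^ (m - n) *: f n m.

Lemma EopP k f g : Eop (k *: f + g) = k *: Eop f + Eop g.
Proof.
do 2 apply/funext => ?; apply/polyP => i.
by rewrite /Eop coef_eop [in RHS]coefD coefZ !coef_eop !coefD !coefZ; ring.
Qed.

Lemma FopP k f g : Fop (k *: f + g) = k *: Fop f + Fop g.
Proof.
do 2 apply/funext => ?; apply/polyP => i.
by rewrite /Fop coef_fop [in RHS]coefD coefZ !coef_fop !coefD !coefZ; ring.
Qed.

Lemma expq2B n m : q ^ (n - m) = q ^ n / q ^ m.
Proof. by rewrite expfzDr // invr_expz. Qed.

Lemma bigD (f g : V) n m : (f + g) n m = f n m + g n m.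
Proof. by []. Qed.

Let q0 n : q ^ n != 0. Proof. exact: expfz_neq0. Qed.

Definition expq := (expqS, expqB, expq2B).

(** This and the seven lemmas after it are the twisted Leibniz rule for left multiplication by a
    generator, checked coefficientwise in z; [hat_der] needs nothing else about [Eop] and [Fop] than
    these, linearity and the value on 1. *)
Lemma Eop_a f : Eop (rep_fun Ga f) = rep_fun Ga (Eop f) + rep_fun Gb (Kop f).
Proof.
apply/funext => n; apply/funext => m; apply/polyP => i.
rewrite bigD /rep_fun /Eop /Kop /= !mul1r coefD coefCM coefZ !coef_eop ?(addrK, subrK).
rewrite br_pow !expq; set h := f n (m - 1); field.
by rewrite hq !q0.
Qed.

Lemma Eop_b f : Eop (rep_fun Gb f) = rep_fun Gb (Eop f).
Proof.
apply/funext => n; apply/funext => m; apply/polyP => i.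
rewrite /rep_fun /Eop /= !(coef_eop, coefCM) !expq; field.
by rewrite hq q0.
Qed.

Lemma Eop_c f : Eop (rep_fun Gc f) = rep_fun Gc (Eop f) + rep_fun Gd (Kop f).
Proof.
apply/funext => n; apply/funext => m; apply/polyP => i.
rewrite bigD /rep_fun /Eop /Kop /= ?(addrK, subrK) coef_eop coefD !mulrDl mul1r -!scalerAl.
rewrite !(coefD, coefZ, coefXM) !expq; case: i => [|i] /=.
  by rewrite !nbS nb0 !mulr0; field; rewrite hq q0.
rewrite !coef_eop ?expq [nb i.+2]nbS !nbS (exprS q i).
have x0 := expf_neq0 i hq; set x := q ^+ i.
set h := f _ _; apply: (eq_mod_rel (k := q ^ m / q ^ n * h`_i) (br_rel (n + 1))); rewrite expqS.
by field; rewrite hq x0 q0.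
Qed.

Lemma Eop_d f : Eop (rep_fun Gd f) = rep_fun Gd (Eop f).
Proof.
apply/funext => n; apply/funext => m; apply/polyP => i.
rewrite /rep_fun /Eop /Kop /= ?(addrK, subrK) coef_eop !mulrDl !mul1r -!scalerAl.
rewrite !(coefD, coefZ, coefXM) !expq; case: i => [|i] /=.
  by rewrite ?coef_eop !nbS nb0 ?expq !mulr0 (br_pow (n + 1)) expqS; field; rewrite hq q0.
rewrite !coef_eop ?expq !nbS (exprS q i).
have x0 := expf_neq0 i hq; set x := q ^+ i.
set h := f _ _; rewrite (br_pow (n + 1)).
apply: (eq_mod_rel (k := q ^ m / q * (q ^ n) ^- 2 / q * h`_i) (br_rel (n + 1))).
rewrite expqS.
by field; rewrite hq x0 q0.
Qed.

Lemma Fop_a f : Fop (rep_fun Ga f) = rep_fun Ga (Fop f).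
Proof.
apply/funext => n; apply/funext => m; apply/polyP => i.
by rewrite /rep_fun /Fop /= !mul1r.
Qed.

Lemma Fop_b f : Fop (rep_fun Gb f) = rep_fun Gb (Fop f) + rep_fun Ga (Kop f).
Proof.
apply/funext => n; apply/funext => m; apply/polyP => i.
rewrite bigD /rep_fun /Fop /Kop /= coefD mul1r !(coef_fop, coefCM, coefZ) ?(addrK, subrK).
rewrite brS !expq; field.
by rewrite hq !q0.
Qed.

Lemma Fop_c f : Fop (rep_fun Gc f) = rep_fun Gc (Fop f).
Proof.
apply/funext => n; apply/funext => m; apply/polyP => i.
rewrite /rep_fun /Fop /= !coef_fop -!scalerAl !coefZ !coefXM ?(addrK, subrK).
case: i => [|i] /=; first by rewrite !mulr0.
rewrite coef_fop (br_pow (m + 1)) !nbSl !expq; field.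
by rewrite hq !q0.
Qed.

Lemma Fop_d f : Fop (rep_fun Gd f) = rep_fun Gd (Fop f) + rep_fun Gc (Kop f).
Proof.
apply/funext => n; apply/funext => m; apply/polyP => i.
rewrite bigD /rep_fun /Fop /Kop /= ?(addrK, subrK) coef_fop coefD !mulrDl !mul1r -!scalerAl.
rewrite !(coefD, coefZ, coefXM) !coef_fop; case: i => [|i] /=.
  by rewrite !nb0 !mulr0 !expq; field; rewrite ?hq ?q0.
rewrite ?coef_fop nbSl; set h := f _ _.
apply: (eq_mod_rel (k := - (q ^ m * (q ^ n) ^- 2 * q * h`_i)) (br_rel (m + 1))).
by rewrite !expq; field; rewrite hq !q0.
Qed.
End Representation.

(** * The monomial basis and its coordinates *)

Section Basis.
Variables (C : numClosedFieldType) (q : C).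
Hypothesis hq : q != 0.

Notation SU := (SU2 q).
Notation a := (SU2_gen q Ga).
Notation b := (SU2_gen q Gb).
Notation c := (SU2_gen q Gc).
Notation d := (SU2_gen q Gd).
Notation word := (@SU2_word C q).
Notation V := (int -> int -> {poly C}).
Notation part := (SU2_part q).
Notation E := (der hq 0 1).
Notation F := (der hq 1 0).
Notation hat := (hat hq).
Notation act := (act hq).
Notation br := (br q).
Notation nb := (nb q).

Lemma part_word w : part (deg w) (word w).
Proof. by apply: mem_span; exists w. Qed.

Lemma part_gen i : part (deg_gen i) (SU2_gen q i).
Proof. by have := part_word [:: i]; rewrite /deg big_seq1. Qed.

Lemma part1 : part 0 1.
Proof. by have := part_word [::]; rewrite /deg big_nil. Qed.

Lemma mull_linear (u : SU) : linear ( *%R u).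
Proof. by move=> k x y; rewrite mulrDr -scalerAr. Qed.
Lemma mulr_linear (u : SU) : linear (fun v => v * u).
Proof. by move=> k x y; rewrite mulrDl -scalerAl. Qed.

Lemma partM s t u v : part s u -> part t v -> part (s + t) (u * v).
Proof.
move=> su tv.
apply: (span_min (S := sp_preim (mk_linear (mulr_linear v)) (part (s + t))) _ su).
move=> _ [w dw ->] /=.
apply: (span_min (S := sp_preim (mk_linear (mull_linear (word w))) (part (s + t))) _ tv).
move=> _ [w' dw' ->] /=.
rewrite SU2_wordM -dw -dw'; have := part_word (w ++ w').
by rewrite /deg big_cat.
Qed.

Lemma partX t u n : part t u -> part (t *+ n) (u ^+ n).
Proof.
move=> tu; elim: n => [|n IHn]; first exact: part1.
by rewrite exprS mulrS; exact: partM.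
Qed.

Lemma part_mon i j k l : part (j%:Z - k%:Z + l%:Z - i%:Z) (a ^+ i * b ^+ j * c ^+ k * d ^+ l).
Proof.
have -> : j%:Z - k%:Z + l%:Z - i%:Z = (-1) *+ i + 1 *+ j + (-1) *+ k + 1 *+ l.
  by rewrite !mulNrn -!natz; ring.
do 3?apply: partM; apply: partX;
  [exact: (part_gen Ga)|exact: (part_gen Gb)|exact: (part_gen Gc)|exact: (part_gen Gd)].
Qed.

(** Writing the twist as [tor] makes the rule linear in v, so it extends from words to all v. *)
Lemma derM' be ga u v :
  der hq be ga (u * v) = u * der hq be ga v + der hq be ga u * tor hq be ga v.
Proof.
pose g v := der hq be ga (u * v) - (u * der hq be ga v + der hq be ga u * tor hq be ga v).
have gl : linear g.
  move=> k x y; rewrite /g /tor conv_linear; last exact: skew_linear.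
  by rewrite mulrDr -scalerAr !linearP /= !(mulrDr, =^~scalerAr); lmod.
apply/eqP; rewrite -subr_eq0; apply/eqP.
apply: (SU2_lin_ext (f := mk_linear gl) (g := \0)) => w.
have -> : (\0 : {linear SU -> SU}) (word w) = 0 by [].
by rewrite /= /g (derM _ _ _ _ (part_word w)) tor_word scalerAr subrr.
Qed.

Lemma hat0_part t u n m : part t u -> m - n != t -> hat u n m = 0.
Proof.
have hl : linear (fun u => hat u n m) by move=> k x y; rewrite hat_linear.
move=> tu mn.
apply: (span_min (S := sp_ker (mk_linear hl)) _ tu) => _ [w dw ->] /=.
rewrite -{}dw in mn; elim: w n m mn {hl tu} => [|i w IHw] n m.
  rewrite /deg big_nil word_nil /hat act1 /vacuum => mn.
  by case: eqP => // n0; case: eqP => // m0; case/eqP: mn; rewrite n0 m0.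
rewrite /deg big_cons -/(deg w) word_cons hatM act_gen /rep_fun => mn.
by rewrite IHw ?mulr0 //; case: i mn => /=; apply: contraNneq => <-; lia.
Qed.

Lemma Kop_part t u : part t u -> Kop q (hat u) = q ^ t *: hat u.
Proof.
move=> tu; apply/funext => n; apply/funext => m; rewrite /Kop.
have [<-//|mn] := eqVneq (m - n) t.
by rewrite (hat0_part tu mn) scaler0 [RHS](_ : _ = q ^ t *: hat u n m) // (hat0_part tu mn) scaler0.
Qed.

Lemma der1 be ga : der hq be ga 1 = 0.
Proof.
have := derM hq be ga 1 part1; rewrite !mulr1 mul1r expr0z scale1r => /eqP.
by rewrite -subr_eq0 opprD addrA subrr sub0r oppr_eq0 => /eqP.
Qed.

(** Both sides vanish on 1 and obey the same rule under left multiplication by a generator, so they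
    agree on words. The twist becomes [Kop] because words are homogeneous. *)
Lemma hat_der be ga (G : V -> V) :
  (forall k f g, G (k *: f + g) = k *: G f + G g) -> G (vacuum C) = 0 ->
  (forall i f, G (rep_fun q i f) =
     rep_fun q i (G f) + act (der hq be ga (SU2_gen q i)) (Kop q f)) ->
  forall u, hat (der hq be ga u) = G (hat u).
Proof.
move=> Glin G1 Ggen u.
have H w : hat (der hq be ga (word w)) = G (hat (word w)).
  elim: w => [|i w IHw]; first by rewrite word_nil der1 /hat act0 act1 G1.
  rewrite word_cons (derM _ _ _ _ (part_word w)) hatM act_gen Ggen.
  rewrite (Kop_part (part_word w)) -(act_gen hq i) -IHw.
  rewrite {1}/hat actD actM actZ actM; congr (_ + _).
  by rewrite /act [RHS]endo_scale.
have hl : linear (fun u => hat (der hq be ga u)) by move=> k x y; rewrite linearP hat_linear.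
have gl : linear (fun u => G (hat u)) by move=> k x y; rewrite hat_linear Glin.
exact: (SU2_lin_ext (f := mk_linear hl) (g := mk_linear gl) H).
Qed.

Lemma hatE u : hat (E u) = Eop q (hat u).
Proof.
apply: hat_der => [k f g||i f]; first exact: EopP.
  (* E(1) = 0 in coordinates: the only nonzero coefficient of 1 is multiplied by [0] = 0. *)
  do 2 apply/funext => ?; apply/polyP => i; rewrite /Eop coef_eop coef0 /vacuum.
  have [->|_] := eqVneq (_ + 1) (0 : int); last by rewrite !coef0 !mulr0 ?addr0 ?mulr0.
  rewrite /= ; case: eqP => _ /=; last by rewrite !coef0 !mulr0 addr0 mulr0.
  by rewrite !coef1; case: i => [|i] /=; rewrite ?nb0 ?(mulr0, mul0r, addr0, add0r).
rewrite der_gen; case: i; rewrite ?scale0r ?act0 ?addr0 ?scale1r ?act_gen.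
- exact: Eop_a. - exact: Eop_b. - exact: Eop_c. - exact: Eop_d.
Qed.

Lemma hatF u : hat (F u) = Fop q (hat u).
Proof.
apply: hat_der => [k f g||i f]; first exact: FopP.
  do 2 apply/funext => ?; apply/polyP => i; rewrite /Fop coef_fop coef0 /vacuum.
  case: eqP => _ /=; last by rewrite coef0 !mulr0.
  have [->|_] := eqVneq (_ + 1) (0 : int); last by rewrite coef0 !mulr0.
  by rewrite !coef1; case: i => [|i] /=; rewrite ?nb0 ?(mulr0, mul0r, addr0, add0r).
rewrite der_gen; case: i; rewrite ?scale0r ?act0 ?addr0 ?scale1r ?act_gen.
- exact: Fop_a. - exact: Fop_b. - exact: Fop_c. - exact: Fop_d.
Qed.

(** The formal sum [f(z) a^n b^m]. *)
Definition single (n m : int) (f : {poly C}) : V :=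
  fun n' m' => if (n' == n) && (m' == m) then f else 0.

Lemma single_at n m f : single n m f n m = f.
Proof. by rewrite /single !eqxx. Qed.

Lemma single_off n m f n' m' : (n', m') != (n, m) -> single n m f n' m' = 0.
Proof. by rewrite /single xpair_eqE => /negPf ->. Qed.

Lemma vacuum_single : vacuum C = single 0 0 1.
Proof. by do 2 apply/funext => ?; rewrite /vacuum /single; case: ifP. Qed.

Lemma act_a n m f : act a (single n m f) = single (n + 1) m f.
Proof.
apply/funext => n'; apply/funext => m'; rewrite act_gen /rep_fun /single /= mul1r.
by rewrite (_ : (n' - 1 == n) = (n' == n + 1)) //; apply/eqP/eqP; lia.
Qed.

Lemma act_b n m f : act b (single n m f) = single n (m + 1) ((q ^ n)^-1 *: f).
Proof.
apply/funext => n'; apply/funext => m'; rewrite act_gen /rep_fun /single /= mul_polyC.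
rewrite (_ : (m' - 1 == m) = (m' == m + 1)); last by apply/eqP/eqP; lia.
by have [->|_] := eqVneq n' _; rewrite /=; do ?case: ifP; rewrite ?scaler0.
Qed.

Lemma act_c n m f : act c (single n m f) = single n (m - 1) ((q ^ n)^-1 *: ('X * f)).
Proof.
apply/funext => n'; apply/funext => m'; rewrite act_gen /rep_fun /single /= -scalerAl.
rewrite (_ : (m' + 1 == m) = (m' == m - 1)); last by apply/eqP/eqP; lia.
by have [->|_] := eqVneq n' _; rewrite /=; do ?case: ifP; rewrite ?mulr0 ?scaler0.
Qed.

(** The factor 1 + q z of d = a^-1 (1 + q z), moved to the right of a^(n+1): there z becomes
    q^(-2(n+1)) z, and q q^(-2(n+1)) = q^(-2n) q^-1. The index n is the exponent of a after the
    multiplication. *)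
Definition dfac (n : int) : {poly C} := 1 + ((q ^ n)^-2 * q^-1) *: 'X.

Lemma act_d n m f : act d (single n m f) = single (n - 1) m (dfac (n - 1) * f).
Proof.
apply/funext => n'; apply/funext => m'; rewrite act_gen /rep_fun /single /=.
rewrite (_ : (n' + 1 == n) = (n' == n - 1)); last by apply/eqP/eqP; lia.
by have [->|_] := eqVneq n' _; rewrite /=; do ?case: ifP; rewrite ?mulr0.
Qed.

Lemma act_aX i n m f : act (a ^+ i) (single n m f) = single (n + i%:Z) m f.
Proof.
elim: i => [|i IHi]; first by rewrite act1 addr0.
by rewrite exprS actM IHi act_a; congr single; lia.
Qed.

Lemma act_bX i m f : act (b ^+ i) (single 0 m f) = single 0 (m + i%:Z) f.
Proof.
elim: i => [|i IHi]; first by rewrite act1 addr0.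
by rewrite exprS actM IHi act_b expr0z invr1 scale1r; congr single; lia.
Qed.

Lemma act_cX i m f : act (c ^+ i) (single 0 m f) = single 0 (m - i%:Z) ('X^i * f).
Proof.
elim: i => [|i IHi]; first by rewrite act1 subr0 mul1r.
rewrite exprS actM IHi act_c expr0z invr1 scale1r mulrA -exprS; congr single; lia.
Qed.

Definition dprod (i : nat) : {poly C} := \prod_(j < i) dfac (- j.+1%:Z).

Lemma act_dX i m f : act (d ^+ i) (single 0 m f) = single (- i%:Z) m (dprod i * f).
Proof.
elim: i => [|i IHi]; first by rewrite act1 oppr0 /dprod big_ord0 mul1r.
rewrite exprS actM IHi act_d mulrA.
have -> : - i%:Z - 1 = - i.+1%:Z by lia.
by rewrite /dprod big_ord_recr /= [dfac _ * _]mulrC.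
Qed.

Lemma size_dprod i : size (dprod i) = i.+1.
Proof.
elim: i => [|i IHi]; first by rewrite /dprod big_ord0 size_poly1.
have s2 : size (dfac (- i.+1%:Z)) = 2%N.
  have k0 : (q ^ (- i.+1%:Z)) ^- 2 * q^-1 != 0.
    by rewrite mulf_neq0 ?invr_eq0 ?expf_neq0 ?expfz_neq0.
  by rewrite /dfac addrC size_polyDl size_scale // ?size_polyX ?size_poly1.
have -> : dprod i.+1 = dprod i * dfac (- i.+1%:Z) by rewrite /dprod big_ord_recr.
by rewrite size_mul -?size_poly_eq0 ?IHi ?s2 // addn2.
Qed.

(** [a^n] or [d^-n], [b^m] or [c^-m], and the basis [mon n m i] of the algebra. *)
Definition apow (n : int) : SU := match n with Posz i => a ^+ i | Negz i => d ^+ i.+1 end.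
Definition bpow (m : int) : SU := match m with Posz i => b ^+ i | Negz i => c ^+ i.+1 end.
Definition mon (n m : int) (i : nat) : SU := apow n * (bpow m * (b * c) ^+ i).

(** In the localisation d^k is a^-k times a polynomial of degree k in z, and c^k is b^-k z^k. These
    polynomials divide every coefficient of an element of the algebra at negative exponents. *)
Definition lead_factor (n m : int) : {poly C} :=
  (if n is Negz i then dprod i.+1 else 1) * (if m is Negz i then 'X^(i.+1) else 1).

Definition neg_part (n : int) : nat := match n with Posz _ => 0 | Negz i => i.+1 end.

Lemma size_lead_factor n m : size (lead_factor n m) = (neg_part n + neg_part m).+1.
Proof.
have d0 i : dprod i != 0 by rewrite -size_poly_eq0 size_dprod.
rewrite /lead_factor; case: n m => [n|n] [m|m] /=;
 rewrite ?mulr1 ?mul1r ?size_poly1 ?size_dprod ?size_polyXn ?addn0 //.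
by rewrite size_mulXn // size_dprod; lia.
Qed.

Lemma hat_mon n m i : hat (mon n m i) = single n m (lead_factor n m * 'X^i).
Proof.
have hz f : act (b * c) (single 0 0 f) = single 0 0 ('X * f).
  by rewrite actM act_c act_b expr0z invr1 !scale1r subrK.
have hzX : act ((b * c) ^+ i) (vacuum C) = single 0 0 'X^i.
  rewrite vacuum_single; elim: i => [|i IHi]; first by rewrite act1.
  by rewrite exprS actM IHi hz -exprS.
rewrite /mon /hat !actM hzX.
have -> : act (bpow m) (single 0 0 'X^i) =
    single 0 m ((if m is Negz j then 'X^(j.+1) else 1) * 'X^i).
  by case: m => m /=; rewrite ?(act_bX, act_cX) ?mul1r; congr single; lia.
rewrite /lead_factor -mulrA; case: n => n /=; rewrite ?(act_aX, act_dX) ?mul1r.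
  by congr single; lia.
by rewrite -NegzE.
Qed.

(** For spanning and surjectivity only the nonvanishing of the scalar matters, so powers of q are
    not recorded. The relation [sim] below serves the same purpose. *)
Definition qcomm (x y : SU) := exists2 k : C, k != 0 & x * y = k *: (y * x).

Lemma qcomm_refl x : qcomm x x.
Proof. by exists 1; rewrite ?oner_neq0 // scale1r. Qed.

Lemma qcomm_sym x y : qcomm x y -> qcomm y x.
Proof.
by move=> [k k0 e]; exists k^-1; rewrite ?invr_eq0 // e scalerA mulVf // scale1r.
Qed.

Lemma qcommM x y z : qcomm x y -> qcomm x z -> qcomm x (y * z).
Proof.
move=> [k k0 e] [l l0 e']; exists (k * l); first exact: mulf_neq0.
by rewrite mulrA e -scalerAl -(mulrA y x) e' -scalerAr scalerA mulrA.
Qed.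

Lemma qcomm1 x : qcomm x 1.
Proof. by exists 1; rewrite ?oner_neq0 // scale1r mul1r mulr1. Qed.

Lemma qcommX x y n : qcomm x y -> qcomm x (y ^+ n).
Proof.
by move=> xy; elim: n => [|n IHn]; [exact: qcomm1|rewrite exprS; exact: qcommM].
Qed.

Lemma qcommXl x y n : qcomm x y -> qcomm (x ^+ n) y.
Proof. by move=> xy; apply/qcomm_sym/qcommX/qcomm_sym. Qed.

Lemma qcomm_ab : qcomm a b.
Proof. by exists q => //; case: (SU2_rules hq). Qed.
Lemma qcomm_ac : qcomm a c.
Proof. by exists q => //; case: (SU2_rules hq). Qed.
Lemma qcomm_db : qcomm d b.
Proof. by exists q^-1; rewrite ?invr_eq0 //; case: (SU2_rules hq). Qed.
Lemma qcomm_dc : qcomm d c.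
Proof. by exists q^-1; rewrite ?invr_eq0 //; case: (SU2_rules hq). Qed.
Lemma qcomm_bc : qcomm b c.
Proof. by exists 1; rewrite ?oner_neq0 // scale1r; case: (SU2_rules hq) => _ _ _ _ []. Qed.

Lemma qcomm_az : qcomm a (b * c).
Proof. exact: qcommM qcomm_ab qcomm_ac. Qed.
Lemma qcomm_dz : qcomm d (b * c).
Proof. exact: qcommM qcomm_db qcomm_dc. Qed.

Lemma qcomm_apow x n : qcomm a x -> qcomm d x -> qcomm (apow n) x.
Proof. by case: n => n /= ax dx; exact: qcommXl. Qed.

Lemma commr_bc : GRing.comm b c.
Proof. by rewrite /GRing.comm; case: (SU2_rules hq) => _ _ _ _ []. Qed.

Lemma bpow_z m i : (b * c) * (bpow m * (b * c) ^+ i) = bpow m * (b * c) ^+ i.+1.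
Proof.
have cz x : GRing.comm b x -> GRing.comm c x -> GRing.comm (b * c) x.
  by move=> bx cx; apply: commr_sym; apply: commrM; exact: commr_sym.
have zm : GRing.comm (b * c) (bpow m).
  by case: m => m /=; apply: commrX; apply: cz => //; exact: commr_bc || exact: (commr_sym commr_bc).
by rewrite mulrA zm -mulrA exprS.
Qed.

Lemma b_bpow m i : exists j, b * (bpow m * (b * c) ^+ i) = bpow (m + 1) * (b * c) ^+ j.
Proof.
case: m => [m|[|m]].
- by exists i; rewrite mulrA (_ : Posz m + 1 = m.+1) /= ?exprS //; lia.
- by exists i.+1; rewrite /= expr0 mul1r expr1 mulrA -exprS.
exists i.+1; rewrite (_ : Negz m.+1 + 1 = Negz m); last by lia.
by rewrite -bpow_z /= exprS !mulrA.
Qed.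

Lemma c_bpow m i : exists j, c * (bpow m * (b * c) ^+ i) = bpow (m - 1) * (b * c) ^+ j.
Proof.
case: m => [[|m]|m].
- by exists i; rewrite /= mul1r expr1.
- exists i.+1; rewrite (_ : Posz m.+1 - 1 = m); last by lia.
  by rewrite -bpow_z /= exprS !mulrA commr_bc.
by exists i; rewrite mulrA (_ : Negz m - 1 = Negz m.+1) /= ?(exprS _ m.+1) //; lia.
Qed.

Definition pbw (t : int) : subspace SU := span (fun v => exists n i, v = mon n (n + t) i).

Arguments pbw : simpl never.

Lemma pbw_mon n m t i : m - n = t -> pbw t (mon n m i).
Proof. by move=> <-; apply: mem_span; exists n, i; congr mon; lia. Qed.

Lemma pbwZ t k u : pbw t u -> pbw t (k *: u).
Proof. exact: spZ. Qed.

Lemma apowN l : apow (- l%:Z) = d ^+ l.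
Proof. by case: l => [|l]; rewrite -?NegzE. Qed.

Lemma pbw_gen i t u : pbw t u -> pbw (deg_gen i + t) (SU2_gen q i * u).
Proof.
move=> tu.
suff H n m j : m - n = t -> pbw (deg_gen i + t) (SU2_gen q i * mon n m j).
  apply: (span_min (S := sp_preim (mk_linear (mull_linear (SU2_gen q i))) (pbw (deg_gen i + t))) _ tu).
  by move=> _ [n [j ->]]; apply: H; lia.
move=> mn; rewrite /mon.
have [_ _ _ _ [_ ad da]] := SU2_rules hq; have zd := qcomm_dz; have za := qcomm_az.
case: i; rewrite [deg_gen _]/=.
- case: n mn => [n|n] mn.
    by rewrite [apow _]/= mulrA -exprS; apply: (@pbw_mon n.+1); lia.
  (* a d^(n+1) = (1 + q z) d^n; once z has passed d^n, the second summand is a basis monomial with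
     one more power of z. *)
  rewrite [apow _]/= mulrA exprS (mulrA a d) ad !(mulrDl, mul1r) -!scalerAl.
  have [k k0 ->] := qcomm_sym (qcommXl n zd).
  rewrite -scalerAl -[_ * _ * (bpow m * _)]mulrA bpow_z.
  apply: spD; last do 2 apply: pbwZ; rewrite -apowN; apply: pbw_mon; lia.
- have [k k0 e] := qcomm_sym (qcomm_apow n qcomm_ab qcomm_db).
  rewrite mulrA e -scalerAl -mulrA; have [j' ->] := b_bpow m j.
  apply: pbwZ; apply: pbw_mon; lia.
- have [k k0 e] := qcomm_sym (qcomm_apow n qcomm_ac qcomm_dc).
  rewrite mulrA e -scalerAl -mulrA; have [j' ->] := c_bpow m j.
  apply: pbwZ; apply: pbw_mon; lia.
- have neg n' : apow (- n'.+1%:Z) = d * d ^+ n' by rewrite apowN exprS.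
  case: n mn => [[|n]|n] mn.
  + rewrite [apow _]/= mul1r -[d](apowN 1); apply: pbw_mon; lia.
  + rewrite [apow _]/= mulrA exprS (mulrA d a) da !(mulrDl, mul1r) -!scalerAl.
    have [k k0 ->] := qcomm_sym (qcommXl n za).
    rewrite -scalerAl -[_ * _ * (bpow m * _)]mulrA bpow_z.
    apply: spD; last do 2 apply: pbwZ; apply: (@pbw_mon n%:Z); lia.
  + rewrite [apow _]/= mulrA -exprS -apowN; apply: pbw_mon; lia.
Qed.

(** The spanning half of the basis theorem; independence is obtained through [hat_inj]. *)
Lemma pbw_span t u : SU2_part q t u -> pbw t u.
Proof.
apply: span_min => _ [w <- ->]; elim: w => [|i w IHw].
  rewrite word_nil /deg big_nil (_ : 1 = mon 0 0 0); first exact: pbw_mon.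
  by rewrite /mon /= !mulr1.
by rewrite word_cons /deg big_cons; exact: pbw_gen.
Qed.

Lemma part_mon_t n m i : SU2_part q (m - n) (mon n m i).
Proof.
have pz : SU2_part q 0 ((b * c) ^+ i).
  rewrite -[0 : int](mul0rn _ i); apply: partX; exact: (partM (part_gen Gb) (part_gen Gc)).
have pa : SU2_part q (- n) (apow n).
  case: n => n /=; [have := partX n (part_gen Ga)|have := partX n.+1 (part_gen Gd)];
  by rewrite ?mulNrn /= -?natz //; congr (SU2_part q _ _); lia.
have pb : SU2_part q m (bpow m).
  case: m => m /=; [have := partX m (part_gen Gb)|have := partX m.+1 (part_gen Gc)];
  by rewrite ?mulNrn /= -?natz //; congr (SU2_part q _ _); lia.
have := partM pa (partM pb pz); congr (SU2_part q _ _); lia.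
Qed.

Definition zcomb n m (f : {poly C}) : SU := poly_comb (mon n m) f.

Lemma single_linear n m : linear (single n m).
Proof.
move=> k f g; apply/funext => n'; apply/funext => m'.
rewrite [RHS](_ : _ = k *: single n m f n' m' + single n m g n' m') // /single.
by case: ifP => // _; rewrite scaler0 addr0.
Qed.

Lemma hat_zcomb n m f : hat (zcomb n m f) = single n m (lead_factor n m * f).
Proof.
rewrite /zcomb /poly_comb (linear_comb (hat_linear hq)).
have e : lead_factor n m * f = \sum_(i < size f) f`_i *: (lead_factor n m * 'X^i).
  rewrite -[in LHS](coefK f) poly_def mulr_sumr.
  by apply: eq_bigr => i _; rewrite scalerAr.
by rewrite e (linear_comb (single_linear n m)); apply: eq_bigr => i _; rewrite hat_mon.
Qed.

(** As [Negz i] is -(i+1), the exponent of a runs over -N, ..., N-1; the degree t then determines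
    that of b. *)
Definition normal_form t (N : nat) (f : int -> {poly C}) : SU :=
  \sum_(i < N) (zcomb i (i%:Z + t) (f i) + zcomb (Negz i) (Negz i + t) (f (Negz i))).

Lemma zcomb_linear n m : linear (zcomb n m).
Proof. exact: poly_comb_linear. Qed.

Lemma zcombXn n m i : zcomb n m 'X^i = mon n m i.
Proof. exact: poly_combXn. Qed.

Lemma zcomb0 n m : zcomb n m 0 = 0.
Proof. by rewrite /zcomb /poly_comb size_poly0 big_ord0. Qed.

Lemma normal_formW t (N M : nat) (f : int -> {poly C}) : (N <= M)%N ->
  (forall i : nat, (N <= i)%N -> f i = 0 /\ f (Negz i) = 0) ->
  normal_form t N f = normal_form t M f.
Proof.
move=> le_NM f0; apply: (sum_widen (f := fun i : nat => zcomb i (i%:Z + t) (f i) +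
  zcomb (Negz i) (Negz i + t) (f (Negz i)))) => // i /f0[-> ->].
by rewrite !zcomb0 addr0.
Qed.

Definition normal_forms (t : int) : subspace SU.
Proof.
exists (fun u => exists (N : nat) (f : int -> {poly C}),
    (forall i : nat, (N <= i)%N -> f i = 0 /\ f (Negz i) = 0) /\
  u = normal_form t N f).
  by exists 0%N, (fun=> 0); rewrite /normal_form big_ord0.
move=> k _ _ [N [f [f0 ->]]] [M [g [g0 ->]]].
exists (maxn N M), (fun n => k *: f n + g n); split.
  move=> i; rewrite geq_max => /andP[/f0[-> ->] /g0[-> ->]].
  by rewrite scaler0 addr0.
rewrite (normal_formW t (leq_maxl N M) f0) (normal_formW t (leq_maxr N M) g0).
rewrite /normal_form scaler_sumr -big_split; apply: eq_bigr => i _ /=.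
by rewrite !zcomb_linear scalerDr addrACA.
Defined.

Lemma normal_formP t u : part t u -> exists (N : nat) (f : int -> {poly C}),
  (forall i : nat, (N <= i)%N -> f i = 0 /\ f (Negz i) = 0) /\ u = normal_form t N f.
Proof.
move=> /pbw_span; apply: (span_min (S := normal_forms t)) => _ [n [j ->]].
pose k := match n with Posz k | Negz k => k end.
exists k.+1, (fun n' => if n' == n then 'X^j else 0); split.
  by rewrite /k; case: (n) => n' i; split; case: eqP => //; lia.
rewrite {}/k; case: n => n;
  rewrite /normal_form big_ord_recr /= eqxx zcombXn zcomb0 big1 ?add0r ?addr0 //;
  move=> i _; last rewrite (_ : (Negz i == Negz n) = false).
- by rewrite eqz_nat (ltn_eqF (ltn_ord i)) !zcomb0 addr0.
- by rewrite !zcomb0 addr0.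
- by apply/eqP; have := ltn_ord i; lia.
Qed.

Lemma hat_normal_form t N f n m : hat (normal_form t N f) n m =
  \sum_(i < N) (single i (i%:Z + t) (lead_factor i (i%:Z + t) * f i) n m +
    single (Negz i) (Negz i + t) (lead_factor (Negz i) (Negz i + t) * f (Negz i)) n m).
Proof.
have hl : linear (fun u => hat u n m) by move=> k x y; rewrite hat_linear.
rewrite -[hat _ n m]/(mk_linear hl (normal_form t N f)) linear_sum.
by apply: eq_bigr => i _; rewrite linearD /= !hat_zcomb.
Qed.

(** At (n, n + t) only the summand of exponent n contributes, and it is multiplied by the nonzero
    polynomial [lead_factor n (n + t)]. *)
Lemma hat_inj t u : part t u -> hat u = 0 -> u = 0.
Proof.
move=> /normal_formP[N [f [f0 ->]]] h0.
have lf0 n m : lead_factor n m != 0 by rewrite -size_poly_eq0 size_lead_factor.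
have fz n : f n = 0.
  apply/eqP; rewrite -(mulrI_eq0 _ (mulfI (lf0 n (n + t)))); apply/eqP.
  rewrite -[RHS](congr1 (fun g => g n (n + t)) h0) hat_normal_form.
  case: n => n; have [lt_nN|le_Nn] := ltnP n N.
  - rewrite (bigD1 (Ordinal lt_nN)) //= single_at single_off // addr0 big1 ?addr0 // => i.
    rewrite -val_eqE /= => ne; rewrite !single_off ?addr0 //.
    by rewrite xpair_eqE eqz_nat eq_sym (negPf ne).
  - have [-> _] := f0 _ le_Nn; rewrite mulr0 big1 // => i _; rewrite !single_off ?addr0 //.
    by rewrite xpair_eqE eqz_nat gtn_eqF // (leq_trans (ltn_ord i)).
  - rewrite (bigD1 (Ordinal lt_nN)) //= single_at single_off // add0r big1 ?addr0 // => i.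
    rewrite -val_eqE /= => ne; rewrite !single_off ?addr0 // xpair_eqE negb_and.
    by apply/orP; left; apply: contraNneq ne => -[->].
  - have [_ ->] := f0 _ le_Nn; rewrite mulr0 big1 // => i _; rewrite !single_off ?addr0 //.
    by rewrite xpair_eqE negb_and; apply/orP; left; apply/eqP => -[e]; move: le_Nn; rewrite e leqNgt ltn_ord.
by rewrite /normal_form big1 // => i _; rewrite !fz !zcomb0 addr0.
Qed.

(** The coefficient is a multiple of [lead_factor n (n + t)]. This is the degree bound that
    separates the algebra from its localisation. *)
Lemma size_hat t u n : part t u -> hat u n (n + t) != 0 ->
  (neg_part n + neg_part (n + t) < size (hat u n (n + t)))%N.
Proof.
move=> /normal_formP[N [f [f0 ->]]]; set h := hat _ _ _.
suff [g ->] : exists g, h = lead_factor n (n + t) * g.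
  rewrite mulf_eq0 negb_or => /andP[l0 g0].
  rewrite size_mul // size_lead_factor addSn /= -[X in (X < _)%N]addn0 ltn_add2l.
  by rewrite size_poly_gt0.
have lin : forall x y, (exists g, x = lead_factor n (n + t) * g) ->
    (exists g, y = lead_factor n (n + t) * g) -> exists g, x + y = lead_factor n (n + t) * g.
  by move=> x y [g ->] [g' ->]; exists (g + g'); rewrite mulrDr.
rewrite /h hat_normal_form; elim/big_ind: _ => //; first by exists 0; rewrite mulr0.
have one k g : exists g', single k (k + t) (lead_factor k (k + t) * g) n (n + t) =
    lead_factor n (n + t) * g'.
  rewrite /single; case: (eqVneq n k) => [->|_] /=; last by exists 0; rewrite mulr0.
  by rewrite eqxx; exists g.
by move=> i _; apply: lin; exact: one.
Qed.

End Basis.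

(** * Kernels and images of [E] and [F] *)

Section SpectralAnalysis.
Variables (C : numClosedFieldType) (q : C).
Hypothesis hq : q != 0.

Notation SU := (SU2 q).
Notation a := (SU2_gen q Ga).
Notation b := (SU2_gen q Gb).
Notation c := (SU2_gen q Gc).
Notation d := (SU2_gen q Gd).
Notation word := (@SU2_word C q).
Notation V := (int -> int -> {poly C}).
Notation part := (SU2_part q).
Notation E := (der hq 0 1).
Notation F := (der hq 1 0).
Notation hat := (hat hq).
Notation act := (act hq).
Notation br := (br q).
Notation nb := (nb q).

Notation mon := (@mon C q).

(** Equivalently, q^2 is not a root of unity other than 1; for q^2 = 1 one has [k] = k, which is
    nonzero for k > 0. *)
Definition generic := forall k, nb k.+1 != 0.

(** The diagonal coefficient of [eop] is thereby a nonzero scalar times one q-integer, [n + k];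
    [br_add'] does the same for [fop]. *)
Lemma br_add n k : q ^+ k ^+ 2 * nb k + br n = q ^+ k ^+ 2 * br (n + k%:Z).
Proof.
elim: k => [|k IHk]; first by rewrite nb0 expr0 addr0 mulr0 add0r expr1n mul1r.
rewrite (_ : n + k.+1%:Z = n + k%:Z + 1); last by lia.
have qk := expf_neq0 k hq; rewrite brS // nbSl (exprS q k).
have -> : br (n + k%:Z) = (q ^+ k ^+ 2 * nb k + br n) / (q ^+ k ^+ 2).
  by rewrite IHk; field.
by field; rewrite hq qk.
Qed.

Lemma br_add' m k : br m + (q ^ m) ^- 2 * nb k = br (m + k%:Z).
Proof.
elim: k => [|k IHk]; first by rewrite nb0 mulr0 !addr0.
rewrite (_ : m + k.+1%:Z = m + k%:Z + 1); last by lia.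
rewrite br_pow // -IHk nbS expfzDr // mulrDr addrA; congr (_ + _).
rewrite (_ : q ^ k = q ^+ k) //; field; by rewrite ?expf_neq0 ?expfz_neq0.
Qed.

Lemma generic_br n : generic -> br n = 0 -> n <= 0.
Proof.
move=> gen; case: n => [[|n]|n] //= /eqP; by rewrite (negPf (gen n)).
Qed.

Lemma neg_part_ge n : - n <= (neg_part n)%:Z.
Proof. case: n => n /=; lia. Qed.

(** In the top degree k of the coefficient the neighbour of index k + 1 is absent, so the leading
    term is just multiplied by a nonzero scalar times [n + k]. *)
Lemma lead_E t u n : part t u -> hat (E u) = 0 -> hat u n (n + t) != 0 ->
  exists k : nat, [/\ size (hat u n (n + t)) = k.+1, br (n + k%:Z) = 0
    & (neg_part n + neg_part (n + t) <= k)%N].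
Proof.
move=> tu Eu f0; have := size_hat tu f0; set f := hat _ _ _ in f0 *.
case sf: (size f) => [|k] // le; exists k; split=> //.
have := congr1 (fun g : V => (g (n - 1) (n + t + 1))`_k) Eu.
rewrite hatE /Eop coef_eop // coef0 subrK addrK -/f [f`_k.+1]nth_default ?sf //.
rewrite mulr0 addr0 br_add => /eqP; rewrite !mulf_eq0 !expf_eq0 expfz_eq0 (negPf hq) !andbF /=.
have /negPf -> : f`_k != 0 by have := lead_coef_eq0 f; rewrite lead_coefE sf => ->.
by rewrite orbF => /eqP.
Qed.

Lemma lead_F t u n : part t u -> hat (F u) = 0 -> hat u n (n + t) != 0 ->
  exists k : nat, br (n + t + k%:Z) = 0 /\ (neg_part n + neg_part (n + t) <= k)%N.
Proof.
move=> tu Fu f0; have := size_hat tu f0; set f := hat _ _ _ in f0 *.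
case sf: (size f) => [|k] // le; exists k; split=> //.
have := congr1 (fun g : V => (g (n + 1) (n + t - 1))`_k) Fu.
rewrite hatF /Fop coef_fop // coef0 subrK addrK -/f br_add'.
move/eqP; rewrite !mulf_eq0 expfz_eq0 (negPf hq) !andbF /=.
have /negPf -> : f`_k != 0 by have := lead_coef_eq0 f; rewrite lead_coefE sf => ->.
by rewrite orbF => /eqP.
Qed.

Lemma hat_inj_pointwise t u : part t u -> (forall n, hat u n (n + t) = 0) -> u = 0.
Proof.
move=> tu h; apply: (hat_inj tu); apply/funext => n; apply/funext => m.
have [mn|mn] := eqVneq (m - n) t; last exact: hat0_part mn.
by rewrite -[RHS](h n); congr (hat u _ _); lia.
Qed.

(** A nonzero coefficient, of degree k in z, would need n + k <= 0, whereas the exponents n and n -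
    2 force k >= max(-n, 0) + max(2 - n, 0) > -n. *)
Lemma generic_E_inj u : generic -> part (-2) u -> E u = 0 -> u = 0.
Proof.
move=> gen tu Eu; apply: (hat_inj_pointwise tu) => n; apply/eqP; apply: contraT => f0.
have [|k [_ /(generic_br gen) nk le]] := lead_E tu _ f0; first by rewrite Eu /hat act0.
have := neg_part_ge n; have := neg_part_ge (n - 2); lia.
Qed.

Lemma generic_F_inj u : generic -> part 2 u -> F u = 0 -> u = 0.
Proof.
move=> gen tu Fu; apply: (hat_inj_pointwise tu) => n; apply/eqP; apply: contraT => f0.
have [|k [/(generic_br gen) nk le]] := lead_F tu _ f0; first by rewrite Fu /hat act0.
have := neg_part_ge n; have := neg_part_ge (n + 2); lia.
Qed.

Lemma hat1 : hat 1 = single 0 0 1.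
Proof. by rewrite /hat act1 vacuum_single. Qed.

(** With equal exponents the bounds are n + k <= 0 and k >= 2 max(-n, 0), which leave only n = k =
    0. *)
Lemma generic_ker_E u : generic -> part 0 u -> E u = 0 -> exists k : C, u = k *: 1.
Proof.
move=> gen tu Eu.
have hu0 : hat (E u) = 0 by rewrite Eu /hat act0.
have low n : hat u n (n + 0) != 0 -> n = 0 /\ size (hat u n (n + 0)) = 1.
  move=> f0; have [k [sf /(generic_br gen) nk le]] := lead_E tu hu0 f0.
  by rewrite sf; have := neg_part_ge n; have := neg_part_ge (n + 0); lia.
exists (hat u 0 0)`_0; apply/eqP; rewrite -subr_eq0; apply/eqP.
have tv : part 0 (u - (hat u 0 0)`_0 *: 1).
  by apply: spB => //; apply: spZ; exact: part1.
apply: (hat_inj_pointwise tv) => n.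
have -> : hat (u - (hat u 0 0)`_0 *: 1) n (n + 0) =
    hat u n (n + 0) - (hat u 0 0)`_0 *: hat 1 n (n + 0).
  by rewrite addrC -!scaleNr hat_linear [RHS]addrC.
rewrite hat1 /single addr0; case: eqP => [->|n0] /=; last first.
  have [e|/low[]//] := eqVneq (hat u n (n + 0)) 0.
  by rewrite scaler0 subr0 -[RHS]e addr0.
have [->|f0] := eqVneq (hat u 0 0) 0; first by rewrite coef0 scale0r subr0.
have [|_ sf] := low 0; first by rewrite addr0.
rewrite addr0 in sf; rewrite [X in X - _]size1_polyC ?sf //.
by rewrite -mul_polyC mulr1 subrr.
Qed.

(** The a^0 b^0 coefficient of E u comes from the coefficient of a b^-1 in u, which has positive
    degree in z because b^-1 occurs only through c = b^-1 z. E multiplies its leading term by a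
    nonzero scalar, so a positive power of z survives. *)
Lemma generic_one_notin u : generic -> part (-2) u -> E u <> 1.
Proof.
move=> gen tu Eu; have e1 : hat (E u) = single 0 0 1 by rewrite Eu hat1.
have := congr1 (fun g : V => g 0 0) e1; rewrite hatE single_at /Eop !add0r.
set f := hat u 1 (-1) => ef.
have f0 : f != 0.
  apply/eqP => fz; move: ef; rewrite fz => /(congr1 (fun g : {poly C} => g`_0)) /eqP.
  by rewrite coef_eop // !coef0 coef1 !mulr0 addr0 mulr0 eq_sym oner_eq0.
have := size_hat tu (n := 1); rewrite (_ : 1 - 2 = -1 :> int) // => /(_ hq f0).
rewrite -/f; case sf: (size f) => [|[|k]] // _.
have := congr1 (fun g : {poly C} => g`_k.+1) ef.
rewrite coef_eop // coef1 [f`_k.+2]nth_default ?sf // mulr0 addr0 br_add => /eqP.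
rewrite !mulf_eq0 !expf_eq0 expfz_eq0 (negPf hq) !andbF /=.
have /negPf -> : f`_k.+1 != 0 by have := lead_coef_eq0 f; rewrite lead_coefE sf => ->.
by rewrite orbF; apply/negP; exact: gen.
Qed.

Definition sim (x y : SU) := exists2 k : C, k != 0 & x = k *: y.

Lemma sim_sp (S : subspace SU) x y : sim x y -> S x -> S y.
Proof.
move=> [k k0 ->] Sx; rewrite -[y]scale1r -(mulVf k0) -scalerA; exact: spZ.
Qed.

Lemma sim_sym x y : sim x y -> sim y x.
Proof.
by move=> [k k0 ->]; exists k^-1; rewrite ?invr_eq0 // scalerA mulVf // scale1r.
Qed.

Lemma sim_trans y x z : sim x y -> sim y z -> sim x z.
Proof.
move=> [k k0 ->] [l l0 ->]; exists (k * l); first exact: mulf_neq0.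
by rewrite scalerA.
Qed.

Lemma simMl z x y : sim x y -> sim (z * x) (z * y).
Proof. by move=> [k k0 ->]; exists k => //; rewrite scalerAr. Qed.

Lemma simMr z x y : sim x y -> sim (x * z) (y * z).
Proof. by move=> [k k0 ->]; exists k => //; rewrite scalerAl. Qed.

Lemma E_fix x v : x = b \/ x = d -> E (x * v) = x * E v.
Proof.
by move=> e; rewrite derM'; case: e => ->; rewrite der_gen scale0r mul0r addr0.
Qed.

Lemma F_fix x v : x = a \/ x = c -> F (x * v) = x * F v.
Proof.
by move=> e; rewrite derM'; case: e => ->; rewrite der_gen scale0r mul0r addr0.
Qed.

Lemma E_fixX x n v : x = b \/ x = d -> E (x ^+ n * v) = x ^+ n * E v.
Proof.
move=> e; elim: n => [|n IHn]; first by rewrite !mul1r.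
by rewrite exprS -!mulrA E_fix // IHn.
Qed.

Lemma F_fixX x n v : x = a \/ x = c -> F (x ^+ n * v) = x ^+ n * F v.
Proof.
move=> e; elim: n => [|n IHn]; first by rewrite !mul1r.
by rewrite exprS -!mulrA F_fix // IHn.
Qed.

Lemma qcommX_eq (x y : SU) (k : C) n : x * y = k *: (y * x) -> x * y ^+ n = k ^+ n *: (y ^+ n * x).
Proof.
move=> e; elim: n => [|n IHn]; first by rewrite mulr1 mul1r scale1r.
by rewrite !exprS mulrA e -scalerAl -(mulrA y x) IHn -scalerAr scalerA mulrA.
Qed.

Lemma b_past_a : b * a = q^-1 *: (a * b).
Proof. by have [-> _ _ _ _] := SU2_rules hq; rewrite scalerA mulVf // scale1r. Qed.

Lemma nb1 : nb 1 = 1.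
Proof. by rewrite nbS nb0 add0r expr1n invr1. Qed.

Lemma q_negpow n : q ^ ((-1) *+ n : int) = q ^- n.
Proof. by rewrite mulNrn natz -invr_expz. Qed.

Lemma EX_a n : E (a ^+ n.+1) = nb n.+1 *: (a ^+ n * b).
Proof.
elim: n => [|n IHn]; first by rewrite expr1 der_gen nb1 expr0 mul1r.
rewrite exprS (derM _ _ _ _ (partX n.+1 (part_gen q Ga))) IHn der_gen scale1r.
rewrite (qcommX_eq n.+1 b_past_a) -scalerAr mulrA -exprS scalerA -scalerDl.
congr (_ *: _); rewrite [in RHS]nbS q_negpow exprVn; field.
by rewrite expf_neq0.
Qed.

Lemma EX_c n : E (c ^+ n.+1) = nb n.+1 *: (c ^+ n * d).
Proof.
elim: n => [|n IHn]; first by rewrite expr1 der_gen nb1 expr0 mul1r !scale1r.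
rewrite exprS (derM _ _ _ _ (partX n.+1 (part_gen q Gc))) IHn der_gen scale1r.
have [_ _ _ dc _] := SU2_rules hq.
rewrite (qcommX_eq n.+1 dc) -scalerAr mulrA -exprS scalerA -scalerDl.
congr (_ *: _); rewrite [in RHS]nbS q_negpow exprVn; field.
by rewrite expf_neq0.
Qed.

Lemma FX_b n : F (b ^+ n.+1) = (q ^+ n * nb n.+1) *: (a * b ^+ n).
Proof.
elim: n => [|n IHn]; first by rewrite expr1 der_gen nb1 expr0 mulr1 !scale1r mulr1.
rewrite exprS (derM _ _ _ _ (partX n.+1 (part_gen q Gb))) IHn der_gen scale1r.
rewrite -scalerAr mulrA b_past_a -!scalerAl -mulrA -exprS scalerA -scalerDl.
congr (_ *: _); rewrite [in RHS]nbSl (_ : q ^ (1 *+ n.+1 : int) = q ^+ n.+1).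
  by rewrite (exprS q n); field.
by rewrite natz.
Qed.

Lemma FX_d n : F (d ^+ n.+1) = (q ^+ n * nb n.+1) *: (c * d ^+ n).
Proof.
elim: n => [|n IHn]; first by rewrite expr1 der_gen nb1 expr0 mulr1 !scale1r mulr1.
rewrite exprS (derM _ _ _ _ (partX n.+1 (part_gen q Gd))) IHn der_gen scale1r.
have [_ _ _ dc _] := SU2_rules hq.
rewrite -scalerAr mulrA dc -!scalerAl -mulrA -exprS scalerA -scalerDl.
congr (_ *: _); rewrite [in RHS]nbSl (_ : q ^ (1 *+ n.+1 : int) = q ^+ n.+1).
  by rewrite (exprS q n); field.
by rewrite natz.
Qed.

Lemma qcomm_sim x y : qcomm x y -> sim (x * y) (y * x).
Proof. by []. Qed.

Lemma sim_tor be ga t u : part t u -> sim (tor hq be ga u) u.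
Proof. by move=> tu; exists (q ^ t); rewrite ?expfz_neq0 // (tor_part _ _ _ tu). Qed.

Lemma simZ k x : k != 0 -> sim (k *: x) x.
Proof. by exists k. Qed.

Lemma part_eq s t u : part s u -> s = t -> part t u.
Proof. by move=> su <-. Qed.

(** E kills b and d, so in a monomial without c only the power of a is differentiated, which yields
    the factor [i + 1]. The three lemmas that follow rest on the same remark, F killing a and c. *)
Lemma sim_E_abd i j l : generic ->
  sim (E (a ^+ i.+1 * (b ^+ j * d ^+ l))) (a ^+ i * (b ^+ j.+1 * d ^+ l)).
Proof.
move=> gen; have tv := partM (partX j (part_gen q Gb)) (partX l (part_gen q Gd)).
have e0 : E (b ^+ j * d ^+ l) = 0.
  rewrite E_fixX; last by left.
  by rewrite -[d ^+ l]mulr1 E_fixX ?der1 ?mulr0 //; right.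
rewrite derM' e0 mulr0 add0r EX_a.
apply: (sim_trans (simMl _ (sim_tor 0 1 tv))).
rewrite -scalerAl; apply: sim_trans (simZ _ (gen i)) _.
by exists 1; rewrite ?oner_neq0 // scale1r exprS !mulrA.
Qed.

Lemma sim_E_dbc l j k : generic ->
  sim (E (d ^+ l * (b ^+ j * c ^+ k.+1))) (d ^+ l.+1 * (b ^+ j * c ^+ k)).
Proof.
move=> gen; rewrite E_fixX; last by right.
rewrite E_fixX; last by left.
rewrite EX_c -scalerAr -scalerAr; apply: sim_trans (simZ _ (gen k)) _.
rewrite exprSr -mulrA; apply: simMl; rewrite [X in sim X]mulrA; apply: qcomm_sim.
by apply: qcomm_sym; apply: qcommM; apply: qcommX; [exact: qcomm_db|exact: qcomm_dc].
Qed.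

Lemma sim_F_acd i j l : generic ->
  sim (F (a ^+ i * (c ^+ j * d ^+ l.+1))) (a ^+ i * (c ^+ j.+1 * d ^+ l)).
Proof.
move=> gen; rewrite F_fixX; last by left.
rewrite F_fixX; last by right.
rewrite FX_d -scalerAr -scalerAr; apply: sim_trans (simZ _ _) _.
  by rewrite mulf_neq0 ?expf_neq0 ?gen.
by exists 1; rewrite ?oner_neq0 // scale1r exprSr !mulrA.
Qed.

Lemma sim_F_acb i j k : generic ->
  sim (F (a ^+ i * (c ^+ j * b ^+ k.+1))) (a ^+ i.+1 * (c ^+ j * b ^+ k)).
Proof.
move=> gen; rewrite F_fixX; last by left.
rewrite F_fixX; last by right.
rewrite FX_b -scalerAr -scalerAr; apply: sim_trans (simZ _ _) _.
  by rewrite mulf_neq0 ?expf_neq0 ?gen.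
rewrite exprSr -mulrA; apply: simMl; rewrite !mulrA; apply: simMr; apply: qcomm_sim.
by apply: qcomm_sym; apply: qcommX; exact: qcomm_ac.
Qed.

(** [q z = a d - 1] trades powers of [z = b c] for powers of [a] and [d]. *)
Lemma z_to_ad (W : subspace SU) x i n l : qcomm a x ->
  (forall n' l', (n' + l = n + l')%N -> W (a ^+ n' * (x * d ^+ l'))) ->
  W (a ^+ n * (x * ((b * c) ^+ i * d ^+ l))).
Proof.
move=> ax; elim: i n l => [|i IHi] n l h; first by rewrite expr0 mul1r; exact: h.
have -> : (b * c) ^+ i.+1 * d ^+ l =
    q^-1 *: ((b * c) ^+ i * a * d ^+ l.+1 - (b * c) ^+ i * d ^+ l).
  have [_ _ _ _ [_ ad _]] := SU2_rules hq.
  rewrite exprSr exprS [_ * a * _]mulrA -[_ * a * d]mulrA ad mulrDr mulr1 mulrDl.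
  by rewrite [_ + _ - _]addrAC subrr add0r -scalerAr -scalerAl scalerA mulVf // scale1r.
rewrite -!scalerAr; apply: spZ; rewrite !mulrBr; apply: spB; last exact: IHi.
apply: (sim_sp (x := a ^+ n.+1 * (x * ((b * c) ^+ i * d ^+ l.+1)))).
  rewrite exprSr -!mulrA; apply: simMl; rewrite !mulrA; apply: simMr.
  by rewrite -[X in sim X]mulrA; apply: qcomm_sim; apply: qcommM ax _; apply: qcommX; exact: qcomm_az.
by apply: IHi => n' l' e; apply: h; lia.
Qed.

Lemma bpow_zE m i : exists j k, j%:Z - k%:Z = m /\ bpow q m * (b * c) ^+ i = b ^+ j * c ^+ k.
Proof.
have zX : (b * c) ^+ i = b ^+ i * c ^+ i by rewrite exprMn_comm //; exact: commr_bc.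
case: m => m /=.
  exists (m + i)%N, i; split; first lia.
  by rewrite zX mulrA -exprD.
exists i, (m.+1 + i)%N; split; first lia.
have cb : GRing.comm (c ^+ m.+1) (b ^+ i).
  by apply: commrX; apply: commr_sym; apply: commrX; exact: commr_bc.
by rewrite zX mulrA cb -mulrA exprD.
Qed.

(** Basis monomials with a nonnegative power of a are rewritten without c, those with a power of d
    contain no a; in either case only one generator is differentiated. *)
Lemma generic_E_onto u : generic -> part 2 u -> exists2 v, part 0 v & E v = u.
Proof.
move=> gen /(pbw_span hq).
apply: (span_min (S := sp_img (der hq 0 1) (part 0))) => _ [n [i ->]].
rewrite /mon; case: n => n.
  rewrite (_ : Posz n + 2 = n.+2); last by lia.
  rewrite -[_ * _ ^+ i]/(b ^+ n.+2 * _) -[(b * c) ^+ i]mulr1 -(expr0 d).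
  apply: z_to_ad => [|n' l' e]; first by apply: qcommX; exact: qcomm_ab.
  apply: (sim_sp (sim_E_abd n' n.+1 l' gen)); exists (a ^+ n'.+1 * (b ^+ n.+1 * d ^+ l')) => //.
  by rewrite !mulrA -[_ * b ^+ _]mulr1 -(expr0 c); apply: part_eq (part_mon _ _ _ _ _) _; lia.
have [j [k [jk ->]]] := bpow_zE (Negz n + 2) i.
apply: (sim_sp (sim_E_dbc n j k gen)); exists (d ^+ n * (b ^+ j * c ^+ k.+1)) => //.
have := partM (partX n (part_gen q Gd)) (partM (partX j (part_gen q Gb)) (partX k.+1 (part_gen q Gc))).
by move/part_eq; apply; rewrite /= mulNrn !natz; lia.
Qed.

(** Monomials are brought to the letters a, c, d or to a, c, b, so that F differentiates d or b
    alone. Exponent 0 of a goes with the negative ones, because the second factor is then a power of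
    c. *)
Lemma generic_F_onto u : generic -> part (-2) u -> exists2 v, part 0 v & F v = u.
Proof.
move=> gen /(pbw_span hq).
apply: (span_min (S := sp_img (der hq 1 0) (part 0))) => _ [n [i ->]].
have neg l : sp_img (der hq 1 0) (part 0) (d ^+ l * (bpow q (- l%:Z - 2) * (b * c) ^+ i)).
  rewrite (_ : - l%:Z - 2 = Negz l.+1); last by lia.
  apply: (sim_sp (x := a ^+ 0 * (c ^+ l.+2 * ((b * c) ^+ i * d ^+ l)))).
    rewrite mul1r mulrA; apply: sim_sym; apply: qcomm_sim; apply: qcommXl.
    by apply: qcommM; apply: qcommX; [exact: qcomm_dc|exact: qcomm_dz].
  apply: z_to_ad => [|n' l' e]; first by apply: qcommX; exact: qcomm_ac.
  apply: (sim_sp (sim_F_acd n' l.+1 l' gen)); exists (a ^+ n' * (c ^+ l.+1 * d ^+ l'.+1)) => //.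
  have := partM (partX n' (part_gen q Ga)) (partM (partX l.+1 (part_gen q Gc)) (partX l'.+1 (part_gen q Gd))).
  by move/part_eq; apply; rewrite /= !mulNrn !natz; lia.
rewrite /mon; case: n => [[|n]|n]; [exact: (neg 0%N)| |exact: (neg n.+1)].
have [j [k [jk ->]]] := bpow_zE (Posz n.+1 - 2) i.
apply: (sim_sp (x := a ^+ n.+1 * (c ^+ k * b ^+ j))).
  by apply: simMl; apply: qcomm_sim; apply: qcommXl; apply: qcommX; apply: qcomm_sym; exact: qcomm_bc.
apply: (sim_sp (sim_F_acb n k j gen)); exists (a ^+ n * (c ^+ k * b ^+ j.+1)) => //.
have := partM (partX n (part_gen q Ga)) (partM (partX k (part_gen q Gc)) (partX j.+1 (part_gen q Gb))).
by move/part_eq; apply; rewrite /= !mulNrn !natz; lia.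
Qed.

Definition E_plus_line : subspace SU.
Proof.
exists (fun u => exists k v, part (-2) v /\ u = E v + k *: 1).
  by exists 0, 0; rewrite linear0 scale0r addr0; split=> //; exact: sp_set0.
move=> k _ _ [l [v [pv ->]]] [l' [v' [pv' ->]]].
exists (k * l + l'), (k *: v + v'); split; first exact: sp_setP.
by rewrite linearP scalerDr scalerDl -scalerA addrACA.
Defined.

Lemma E_line_img v : part (-2) v -> E_plus_line (E v).
Proof. by move=> pv; exists 0, v; rewrite scale0r addr0. Qed.

(** If [i + 2] is nonzero, z^(i+1) is thus a multiple of z^i modulo the image of E, and by induction
    a multiple of 1. *)
Lemma E_acz i : E (a * (b ^+ i * c ^+ i.+1)) =
  (q ^+ i ^+ 2 * nb i.+1) *: (b * c) ^+ i + (q * q ^+ i ^+ 2 * nb i.+2) *: (b * c) ^+ i.+1.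
Proof.
have zX j : (b * c) ^+ j = b ^+ j * c ^+ j by rewrite exprMn_comm //; exact: commr_bc.
have pt := partM (partX i (part_gen q Gb)) (partX i.+1 (part_gen q Gc)).
rewrite (derM _ _ _ _ pt) der_gen scale1r E_fixX; last by left.
have [ab ac _ _ [_ ad _]] := SU2_rules hq.
have az : a * (b * c) = q ^+ 2 *: (b * c * a).
  by rewrite mulrA ab -scalerAl -(mulrA b a) ac -scalerAr scalerA mulrA expr2.
rewrite EX_c -!scalerAr (mulrA (b ^+ i)) -zX (mulrA a) (qcommX_eq i az) -scalerAl -(mulrA _ a) ad.
rewrite (mulrA b) -exprS -zX (_ : q ^ _ = q^-1); last first.
  by rewrite /= mulNrn !natz (_ : _ + _ = -1) ?exprN1 //; lia.
rewrite mulrDr mulr1 -scalerAr -exprSr (nbS q i.+1) (exprS q i) exprAC.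
have x0 := expf_neq0 i hq; set x := q ^+ i; lmod.
by rewrite hq x0.
Qed.

Lemma generic_part0 u : generic -> part 0 u -> exists k v, part (-2) v /\ u = E v + k *: 1.
Proof.
move=> gen /(pbw_span hq); apply: (span_min (S := E_plus_line)) => _ [n [i ->]].
rewrite /mon addr0; case: n => [[|n]|n].
- rewrite !mul1r; elim: i => [|i IHi].
    by exists 1, 0; rewrite linear0 add0r scale1r; split=> //; exact: sp_set0.
  have pv : part (-2) (a * (b ^+ i * c ^+ i.+1)).
    have := partM (part_gen q Ga) (partM (partX i (part_gen q Gb)) (partX i.+1 (part_gen q Gc))).
    by move/part_eq; apply; rewrite /= !mulNrn !natz; lia.
  have k0 : q * q ^+ i ^+ 2 * nb i.+2 != 0 by rewrite !mulf_neq0 ?expf_neq0 ?gen.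
  apply: (sim_sp (simZ _ k0)).
  rewrite -[_ *: _](addKr ((q ^+ i ^+ 2 * nb i.+1) *: (b * c) ^+ i)) -E_acz addrC.
  by apply: spB; [exact: E_line_img|exact: spZ].
- rewrite -[(b * c) ^+ i]mulr1 -(expr0 d).
  apply: z_to_ad => [|n' l' e]; first by apply: qcommX; exact: qcomm_ab.
  apply: (sim_sp (sim_E_abd n' n l' gen)); apply: E_line_img.
  have := partM (partX n'.+1 (part_gen q Ga)) (partM (partX n (part_gen q Gb)) (partX l' (part_gen q Gd))).
  by move/part_eq; apply; rewrite /= !mulNrn !natz; lia.
have [j [k [jk ->]]] := bpow_zE (Negz n) i.
apply: (sim_sp (sim_E_dbc n j k gen)); apply: E_line_img.
have := partM (partX n (part_gen q Gd)) (partM (partX j (part_gen q Gb)) (partX k.+1 (part_gen q Gc))).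
by move/part_eq; apply; rewrite /= mulNrn !natz; lia.
Qed.

(** * Vanishing coefficients when some [k] is zero *)

Section RootOfUnity.
Variable l : nat.
Hypotheses (l0 : nb l.+1 = 0).

Lemma nb_mul j : nb (j * l.+1) = 0.
Proof.
elim: j => [|j IHj]; first exact: nb0.
have := br_add' (l.+1%:Z) (j * l.+1); by rewrite /= l0 IHj mulr0 addr0 mulSn => <-.
Qed.

Lemma root_gt1 : (0 < l)%N.
Proof. by case: l l0 => // /eqP; rewrite nb1 oner_eq0. Qed.

(** Reading the coefficient of z^s at (N i, M i) gives functionals that are dual to the monomials
    and vanish on B. For exponents in [nat] the [lead_factor] is 1. *)
Lemma dual_family (N M : nat -> nat) s (B : subspace SU) : injective N ->
  (forall j u, B u -> (hat u (N j) (M j))`_s = 0) ->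
  forall n (k : 'I_n -> C), B (\sum_i k i *: mon (N i) (M i) s) -> forall i, k i = 0.
Proof.
move=> Ninj Bz n k Bs i; have := Bz i _ Bs.
have hl : linear (fun u => (hat u (N i) (M i))`_s : C^o).
  by move=> x u v; rewrite hat_linear coefD coefZ.
rewrite (linear_comb hl) (bigD1 i) //= hat_mon single_at /lead_factor !mul1r coefXn eqxx.
rewrite big1 => [|j ji]; first by rewrite addr0 [LHS]mulr1.
rewrite hat_mon single_off ?coef0 ?scaler0 // xpair_eqE eqz_nat.
by rewrite (inj_eq Ninj) val_eqE eq_sym (negPf ji).
Qed.

(** Both scalars of [eop] that contribute to z^l vanish: the diagonal one contains [j(l+1) + 1 + l]
    = [(j+1)(l+1)], the other one [l+1]. *)
Lemma root_E_vanish j u n :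
  (hat (E u) (j * l.+1)%N n)`_l = 0.
Proof.
rewrite hatE /Eop coef_eop // l0 !mulr0 mul0r addr0 br_add.
by rewrite (_ : _ + 1 + l%:Z = (j.+1 * l.+1)%N) /= ?nb_mul ?mulr0 ?mul0r ?mulr0 //; lia.
Qed.

Lemma root_F_vanish j u n :
  (hat (F u) n (j * l.+1)%N)`_l = 0.
Proof.
rewrite hatF /Fop coef_fop // br_add'.
by rewrite (_ : _ + 1 + l%:Z = (j.+1 * l.+1)%N) /= ?nb_mul ?mulr0 ?mul0r //; lia.
Qed.

Lemma root_F_vanish0 j u n : (hat (F u) n (j.+1 * l.+1).-1)`_0 = 0.
Proof.
rewrite hatF /Fop coef_fop // br_add'.
by rewrite (_ : _ + 1 + 0%:Z = (j.+1 * l.+1)%N) /= ?nb_mul ?mulr0 ?mul0r //; lia.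
Qed.

Lemma root_E_ker j m : E (a ^+ (j.+1 * l.+1) * b ^+ m) = 0.
Proof.
have eb : E (b ^+ m) = 0 by rewrite -[b ^+ m]mulr1 E_fixX ?der1 ?mulr0 //; left.
rewrite derM' eb mulr0 add0r mulSn addSn EX_a -addSn -mulSn nb_mul.
by rewrite scale0r mul0r.
Qed.

Lemma root_F_ker j n : F (a ^+ n * b ^+ (j.+1 * l.+1)) = 0.
Proof.
rewrite F_fixX; last by left.
by rewrite mulSn addSn FX_b -addSn -mulSn nb_mul mulr0 scale0r mulr0.
Qed.

Lemma mon_ab (n m : nat) : mon n m 0 = a ^+ n * b ^+ m.
Proof. by rewrite /mon /= mulr1. Qed.

End RootOfUnity.

End SpectralAnalysis.

(** * Generators of the sphere and of the parts of degree 2 and -2 *)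

Section Generation.
Variables (C : numClosedFieldType) (q : C).
Hypothesis hq : q != 0.

Notation SU := (SU2 q).
Notation a := (SU2_gen q Ga).
Notation b := (SU2_gen q Gb).
Notation c := (SU2_gen q Gc).
Notation d := (SU2_gen q Gd).
Notation word := (@SU2_word C q).
Notation part := (SU2_part q).
Notation E := (der hq 0 1).
Notation F := (der hq 1 0).
Notation hat := (hat hq).

(** The summands have degrees -2, 0, 0, 2. The value of L at b_- sits in degree -2, those at b_0 and
    1 in degree 0, that at b_+ in degree 2; all degree counts below use this separation. *)
Lemma conv_bc (L : SU -> C) : linear (L : SU -> C^o) ->
  conv hq L (b * c) = (q^-1 * L (a * b)) *: (a * c) + L (b * c) *: (a * d + q^-1 *: (b * c))
    + L 1 *: (b * c) + (q^-1 * L (c * d)) *: (b * d).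
Proof.
move=> lL; rewrite /conv DeltaM !Delta_gen /coprod_gen !(mulrDl, mulrDr).
rewrite ![(_ \tensor _) * (_ \tensor _)]tmulE !sliceD // !sliceE //.
have LZ k u : L (k *: u) = k * L u by rewrite -[L]/(mk_linear lL : SU -> _) linearZ.
have LD u v : L (u + v) = L u + L v by rewrite -[L]/(mk_linear lL : SU -> _) linearD.
have [ab _ _ dc [_ _ da]] := SU2_rules hq.
by rewrite ab da dc !(LZ, LD); lmod.
Qed.

Lemma conv_ab (L : SU -> C) : linear (L : SU -> C^o) ->
  conv hq L (a * b) = L (a * b) *: (a * a) + L 1 *: (a * b)
    + ((q + q^-1) * L (b * c)) *: (a * b) + L (c * d) *: (b * b).
Proof.
move=> lL; rewrite /conv DeltaM !Delta_gen /coprod_gen !(mulrDl, mulrDr).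
rewrite ![(_ \tensor _) * (_ \tensor _)]tmulE !sliceD // !sliceE //.
have LZ k u : L (k *: u) = k * L u by rewrite -[L]/(mk_linear lL : SU -> _) linearZ.
have LD u v : L (u + v) = L u + L v by rewrite -[L]/(mk_linear lL : SU -> _) linearD.
have [ab _ _ dc [cb ad _]] := SU2_rules hq.
by rewrite ad cb !(LZ, LD) ab; lmod.
Qed.

Lemma conv_cd (L : SU -> C) : linear (L : SU -> C^o) ->
  conv hq L (c * d) = L (a * b) *: (c * c) + L 1 *: (c * d)
    + ((q + q^-1) * L (b * c)) *: (c * d) + L (c * d) *: (d * d).
Proof.
move=> lL; rewrite /conv DeltaM !Delta_gen /coprod_gen !(mulrDl, mulrDr).
rewrite ![(_ \tensor _) * (_ \tensor _)]tmulE !sliceD // !sliceE //.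
have LZ k u : L (k *: u) = k * L u by rewrite -[L]/(mk_linear lL : SU -> _) linearZ.
have LD u v : L (u + v) = L u + L v by rewrite -[L]/(mk_linear lL : SU -> _) linearD.
have [ab _ _ dc [cb ad _]] := SU2_rules hq.
by rewrite ad cb !(LZ, LD) dc; lmod.
Qed.

Lemma part_disjoint s t x y : part s x -> part t (x + y) -> s != t ->
  (forall n, hat y n (n + s) = 0) -> x = 0.
Proof.
move=> sx txy st hy; apply: (hat_inj_pointwise sx) => n.
have <- : hat (x + y) n (n + s) = hat x n (n + s).
  have -> : hat (x + y) n (n + s) = hat x n (n + s) + hat y n (n + s) by rewrite /hat actD.
  by rewrite hy addr0.
apply: hat0_part txy _; apply: contraNneq st => <-; apply/eqP; lia.
Qed.

Lemma homogeneous_sum s t x y z : part (s - 2) x -> part s y -> part (s + 2) z ->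
  part t (x + y + z) ->
  [/\ t != s - 2 -> x = 0, t != s -> y = 0 & t != s + 2 -> z = 0].
Proof.
move=> px py pz pt.
have hD u v n m : hat (u + v) n m = hat u n m + hat v n m by rewrite /hat actD.
have ox n m : m - n != s - 2 -> hat x n m = 0 by exact: hat0_part.
have oy n m : m - n != s -> hat y n m = 0 by exact: hat0_part.
have oz n m : m - n != s + 2 -> hat z n m = 0 by exact: hat0_part.
split; rewrite eq_sym => st.
- apply: (part_disjoint (y := y + z) px _ st); first by rewrite addrA.
  by move=> n; rewrite hD oy ?oz ?addr0 //; lia.
- apply: (part_disjoint (y := x + z) py _ st); first by rewrite addrCA addrA.
  by move=> n; rewrite hD ox ?oz ?addr0 //; lia.
- apply: (part_disjoint (y := x + y) pz _ st); first by rewrite addrC.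
  by move=> n; rewrite hD ox ?oy ?addr0 //; lia.
Qed.

(** In the representation a generator acts by a bijective shift of exponents and by nonzero
    polynomials, and C[z] has no zero divisors. *)
Lemma gen_regular i t v : part t v -> v != 0 -> SU2_gen q i * v != 0.
Proof.
move=> tv; apply: contra => /eqP iv; apply/eqP; apply: (hat_inj_pointwise tv) => n.
have rc n' : rep_coef q i n' != 0.
  case: i {iv} => /=; rewrite ?oner_neq0 ?polyC_eq0 ?invr_eq0 ?expfz_neq0 //.
    by rewrite scaler_eq0 polyX_eq0 orbF invr_eq0 expfz_neq0.
  rewrite -size_poly_eq0.
  rewrite addrC size_polyDl; rewrite size_scale ?size_polyX ?size_poly1 //.
    by rewrite mulf_neq0 ?invr_eq0 ?expf_neq0 ?expfz_neq0.
  by rewrite mulf_neq0 ?invr_eq0 ?expf_neq0 ?expfz_neq0.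
have h n' m' : hat v (rep_shift1 i n') (rep_shift2 i m') = 0.
  have := congr1 (fun u => hat u n' m') iv; rewrite hatM act_gen /rep_fun.
  have -> : hat 0 n' m' = 0 by rewrite /hat act0.
  move/eqP; rewrite mulf_eq0 (negPf (rc n')) /=.
  by move/eqP.
have s1 n' : exists k, rep_shift1 i k = n'.
  case: (i) => /=; [exists (n' + 1)|exists n'|exists n'|exists (n' - 1)]; lia.
have s2 n' : exists k, rep_shift2 i k = n'.
  case: (i) => /=; [exists n'|exists (n' + 1)|exists (n' - 1)|exists n']; lia.
by have [k1 <-] := s1 n; have [k2 <-] := s2 (rep_shift1 i k1 + t).
Qed.

Lemma word_neq0 w : word w != 0.
Proof.
elim: w => [|i w IHw]; first by rewrite word_nil oner_neq0.
by rewrite word_cons; apply: gen_regular (part_word q w) IHw.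
Qed.

(** Up to nonzero scalars, each basis monomial of degree 0 arises from a power of z by repeated left
    multiplication with a b or with c d. *)
Lemma part0_gen (W : subspace SU) : W 1 ->
  (forall u, part 0 u -> W u -> [/\ W (a * b * u), W (b * c * u) & W (c * d * u)]) ->
  forall u, part 0 u -> W u.
Proof.
move=> W1 Wgen u /(pbw_span hq); apply: span_min => _ [n [i ->]]; rewrite addr0.
have Wz : W ((b * c) ^+ i).
  elim: i => [|i IHi] //; rewrite exprS.
  have pz : part 0 ((b * c) ^+ i).
    by have := partX i (partM (part_gen q Gb) (part_gen q Gc)); rewrite mul0rn.
  by case: (Wgen _ pz IHi).
case: n => n.
  elim: n => [|n IHn]; first by rewrite /mon !mul1r.
  have pm : part 0 (mon q n n i) by have := part_mon_t hq n n i; rewrite subrr.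
  have [Wm _ _] := Wgen _ pm IHn; apply: sim_sp Wm.
  rewrite /mon /= !exprS -!mulrA; apply: simMl; rewrite !mulrA; do 2 apply: simMr.
  by apply: qcomm_sim; apply: qcommX; apply: qcomm_sym; exact: qcomm_ab.
elim: n => [|n IHn].
  have pz : part 0 ((b * c) ^+ i).
    by have := partX i (partM (part_gen q Gb) (part_gen q Gc)); rewrite mul0rn.
  have [_ _ Wm] := Wgen _ pz Wz; apply: sim_sp Wm; rewrite /mon /= !expr1 !mulrA.
  by apply: simMr; apply: qcomm_sim; apply: qcomm_sym; exact: qcomm_dc.
have pm : part 0 (mon q (Negz n) (Negz n) i).
  by have := part_mon_t hq (Negz n) (Negz n) i; rewrite subrr.
have [_ _ Wm] := Wgen _ pm IHn; apply: sim_sp Wm.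
rewrite /mon /= !(exprS _ n.+1) !mulrA; do 2 apply: simMr.
by rewrite -[X in sim X]mulrA; apply: qcomm_sim; apply: qcommM; [|apply: qcommX]; apply: qcomm_sym; exact: qcomm_dc.
Qed.

(** The factor b b, b d or d d is used according to whether the exponent of a is at least 0, equal
    to -1, or at most -2. *)
Lemma part2_gen (W : subspace SU) :
  (forall u, part 0 u -> [/\ W (u * (b * b)), W (u * (b * d)) & W (u * (d * d))]) ->
  forall u, part 2 u -> W u.
Proof.
move=> Wgen u /(pbw_span hq); apply: span_min => _ [n [i ->]].
have pz : part 0 ((b * c) ^+ i).
  by have := partX i (partM (part_gen q Gb) (part_gen q Gc)); rewrite mul0rn.
have qbz : qcomm b ((b * c) ^+ i).
  by apply: qcommX; apply: qcommM; [exact: qcomm_refl|exact: qcomm_bc].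
case: n => [n|[|n]].
- have pm : part 0 (mon q n n i) by have := part_mon_t hq n n i; rewrite subrr.
  have [Wm _ _] := Wgen _ pm; apply: sim_sp Wm.
  rewrite (_ : Posz n + 2 = n.+2) /mon /= ?exprSr; last by lia.
  rewrite -!mulrA; do 2 apply: simMl; rewrite [X in sim _ X]mulrA.
  by apply: qcomm_sim; apply: qcommM; apply: qcomm_sym.
- have [_ Wm _] := Wgen _ pz; apply: sim_sp Wm; rewrite /mon /= !expr1.
  have qdz : qcomm d ((b * c) ^+ i) by apply: qcommX; exact: qcomm_dz.
  apply: (sim_trans (y := (b * d) * (b * c) ^+ i)).
    by apply: qcomm_sim; apply: qcommM; apply: qcomm_sym.
  by rewrite mulrA; apply: simMr; apply: qcomm_sim; apply: qcomm_sym; exact: qcomm_db.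
have neg l : exists2 m, part 0 m & sim (m * (d * d)) (d ^+ l.+2 * (bpow q (- l%:Z) * (b * c) ^+ i)).
  have pm : part 0 (mon q (- l%:Z) (- l%:Z) i).
    by have := part_mon_t hq (- l%:Z) (- l%:Z) i; rewrite subrr.
  exists (mon q (- l%:Z) (- l%:Z) i) => //.
  have qd : qcomm d (bpow q (- l%:Z) * (b * c) ^+ i).
    apply: qcommM; last by apply: qcommX; exact: qcomm_dz.
    case: l {pm} => [|l]; first exact: qcomm1.
    by rewrite -NegzE; apply: qcommX; exact: qcomm_dc.
  rewrite /mon apowN !exprSr -!mulrA; apply: simMl; rewrite [X in sim _ X]mulrA.
  rewrite [X in sim X]mulrA.
  by apply: qcomm_sim; apply: qcommM; apply: qcomm_sym.
have [m pm sm] := neg n; have [_ _ Wm] := Wgen _ pm.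
move: (sim_sp sm Wm); rewrite /mon (_ : Negz n.+1 + 2 = - n%:Z) //; lia.
Qed.

Lemma partN2_gen (W : subspace SU) :
  (forall u, part 0 u -> [/\ W (u * (a * a)), W (u * (a * c)) & W (u * (c * c))]) ->
  forall u, part (-2) u -> W u.
Proof.
move=> Wgen u /(pbw_span hq); apply: span_min => _ [n [i ->]].
have pz : part 0 ((b * c) ^+ i).
  by have := partX i (partM (part_gen q Gb) (part_gen q Gc)); rewrite mul0rn.
have qaz : qcomm a ((b * c) ^+ i) by apply: qcommX; exact: qcomm_az.
have qcz : qcomm c ((b * c) ^+ i).
  by apply: qcommX; apply: qcommM; [apply: qcomm_sym; exact: qcomm_bc|exact: qcomm_refl].
have neg l : exists2 m, part 0 m & sim (m * (c * c)) (d ^+ l * (c ^+ l.+2 * (b * c) ^+ i)).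
  have pm : part 0 (mon q (- l%:Z) (- l%:Z) i).
    by have := part_mon_t hq (- l%:Z) (- l%:Z) i; rewrite subrr.
  exists (mon q (- l%:Z) (- l%:Z) i) => //; rewrite /mon apowN (exprSr c l.+1) (exprSr c l) -!mulrA; apply: simMl.
  have -> : bpow q (- l%:Z) = c ^+ l by case: (l) => [|k]; rewrite -?NegzE.
  apply: simMl; rewrite [X in sim _ X]mulrA.
  by apply: qcomm_sim; apply: qcommM; apply: qcomm_sym.
case: n => [[|[|n]]|n].
- have [m pm sm] := neg 0%N; have [_ _ Wm] := Wgen _ pm; exact: (sim_sp sm Wm).
- have [_ Wm _] := Wgen _ pz; apply: sim_sp Wm; rewrite /mon /= !expr1 mulrA.
  by apply: qcomm_sim; apply: qcommM; apply: qcomm_sym.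
- have pm : part 0 (mon q n n i) by have := part_mon_t hq n n i; rewrite subrr.
  have [Wm _ _] := Wgen _ pm; apply: sim_sp Wm.
  rewrite (_ : Posz n.+2 + -2 = n) /mon /= ?exprSr; last by lia.
  rewrite -!mulrA; apply: simMl; rewrite [X in sim X]mulrA [X in sim _ X]mulrA.
  apply: qcomm_sim; apply: qcomm_sym.
  have qb : qcomm a (b ^+ n * (b * c) ^+ i).
    by apply: qcommM => //; apply: qcommX; exact: qcomm_ab.
  by apply: qcomm_sym; apply: qcommM; apply: qcomm_sym.
have [m pm sm] := neg n.+1; have [_ _ Wm] := Wgen _ pm.
move: (sim_sp sm Wm); rewrite /mon (_ : Negz n + -2 = Negz n.+2) //; lia.
Qed.
End Generation.

(** * Slices of tensors whose second leg lies in a subspace *)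

Section Slices.
Variables (C : numClosedFieldType) (q : C).

Lemma tmapr_linear (V W W' : lmodType C) (g : W -> W') : linear g ->
  linear (tmap id g : tensor V W -> tensor V W').
Proof. by move=> lg; exact: (tmap_linear (idfun : {linear V -> V}) (mk_linear lg)). Qed.

Lemma tmaprE (V W W' : lmodType C) (g : W -> W') (v : V) w : linear g ->
  tmap id g (v \tensor w) = v \tensor g w.
Proof. by move=> lg; exact: (tmapE (idfun : {linear V -> V}) (mk_linear lg)). Qed.

Lemma slice_tmap (V W W' : lmodType C) (g : W -> W') (L : W' -> C) (t : tensor V W) :
  linear g -> linear (L : W' -> C^o) -> slice L (tmap id g t) = slice (fun w => L (g w)) t.
Proof.
move=> lg lL; have lLg : linear (fun w => L (g w) : C^o) by move=> k x y; rewrite lg lL.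
move: t; apply: tensor_lin_ext.
- by move=> k x y; rewrite tmapr_linear // slice_linear.
- exact: slice_linear.
by move=> v w; rewrite tmaprE // !sliceE.
Qed.

Definition tensors_in (V W : lmodType C) (P : W -> Prop) : subspace (tensor V W) :=
  span (fun t => exists u v, P v /\ t = u \tensor v).

Arguments tensors_in {V W} P.

(** Covariance confines the second leg of D w to one component of the forms, and there two
    functionals may agree without agreeing everywhere. *)
Lemma slice_eq_in (V W : lmodType C) (P : W -> Prop) (L L' : W -> C) (t : tensor V W) :
  linear (L : W -> C^o) -> linear (L' : W -> C^o) -> (forall v, P v -> L v = L' v) ->
  tensors_in P t -> slice L t = slice L' t.
Proof.
move=> lL lL' LL' tP; apply/eqP; rewrite -subr_eq0; apply/eqP.
have dl : linear (fun t : tensor V W => slice L t - slice L' t).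
  by move=> k x y; rewrite !slice_linear //; lmod.
apply: (span_min (S := sp_ker (mk_linear dl)) _ tP) => _ [u [v [Pv ->]]] /=.
by rewrite !sliceE // LL' // subrr.
Qed.

Lemma tensors_inT (V W : lmodType C) (t : tensor V W) : tensors_in (fun=> True) t.
Proof.
rewrite [t]tensorE; apply: sp_sum => p _; apply: mem_span.
by exists p.1, p.2.
Qed.

Lemma sliceM_in (B : algType C) (P Q : B -> Prop) (L L1 L2 : B -> C) (s t : tensor (SU2 q) B) :
  linear (L : B -> C^o) -> linear (L1 : B -> C^o) -> linear (L2 : B -> C^o) ->
  (forall v v', P v -> Q v' -> L (v * v') = L1 v * L2 v') ->
  tensors_in P s -> tensors_in Q t -> slice L (s * t) = slice L1 s * slice L2 t.
Proof.
move=> lL l1 l2 LM sP tQ; apply/eqP; rewrite -subr_eq0; apply/eqP.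
have d1 : linear (fun s : tensor (SU2 q) B => slice L (s * t) - slice L1 s * slice L2 t).
  move=> k x y; rewrite mulrDl -scalerAl !slice_linear // mulrDl -scalerAl; lmod.
apply: (span_min (S := sp_ker (mk_linear d1)) _ sP) => _ [u [v [Pv ->]]] /=.
have d2 : linear (fun t : tensor (SU2 q) B =>
    slice L ((u \tensor v) * t) - slice L1 (u \tensor v) * slice L2 t).
  by move=> k x y; rewrite mulrDr -scalerAr !slice_linear // mulrDr -scalerAr; lmod.
apply: (span_min (S := sp_ker (mk_linear d2)) _ tQ) => _ [u' [v' [Qv' ->]]] /=.
rewrite (tmulE u v u' v' : _ * _ = _) !sliceE // LM //.
by rewrite -scalerAl -scalerAr scalerA subrr.
Qed.

End Slices.

Arguments tensors_in {C V W} P.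

(** * Coefficients of forms *)

Section Calculus.
Variables (C : numClosedFieldType) (q : C).
Hypothesis hq : q != 0.
Variable X : dolbeault q.

Notation SU := (SU2 q).
Notation a := (SU2_gen q Ga).
Notation b := (SU2_gen q Gb).
Notation c := (SU2_gen q Gc).
Notation d := (SU2_gen q Gd).
Notation word := (@SU2_word C q).
Notation part := (SU2_part q).
Notation M := (podles q).
Notation pval := (@podles_val C q).
Notation Om := (calc X).
Notation inc := (inc X).
Notation dif := (dif X).
Notation D := (coact X).
Notation cls := (@cls C q X).

Lemma pval_linear : linear pval.
Proof. by move=> k x y; rewrite /podles_val linearP. Qed.

Lemma pvalM m m' : pval (m * m') = pval m * pval m'.
Proof. by rewrite /podles_val rmorphM. Qed.

Lemma pval1 : pval 1 = 1.
Proof. by rewrite /podles_val rmorph1. Qed.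

Lemma pval_part m : part 0 (pval m).
Proof. by apply/asboolP; exact: (valP m). Qed.

Lemma pval_onto u : part 0 u -> exists m, pval m = u.
Proof. by move=> /asboolP pu; exists (exist _ u pu : M). Qed.

Lemma pval_inj : injective pval.
Proof. exact: val_inj. Qed.

(** The functionals to come live on M, whereas [conv] takes functionals on the whole algebra;
    composition with r extends them. The coproduct of M has its second leg in M, so [conv] of the
    extension on M does not depend on r. *)
Lemma podles_retraction : exists r : {linear SU -> M}, forall m, r (pval m) = m.
Proof. exact: (@retraction C M SU (mk_linear pval_linear) val_inj). Qed.

Lemma cls_linear : linear cls.
Proof. exact: qclass_linear. Qed.

Lemma clsD x y : cls (x + y) = cls x + cls y.
Proof. by have := cls_linear 1 x y; rewrite !scale1r. Qed.

Lemma cls0 : cls 0 = 0.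
Proof. by have := cls_linear (-1) 0 0; rewrite !scaleN1r !addNr. Qed.

Lemma DD x y : D (x + y) = D x + D y.
Proof. exact: linearD. Qed.

Lemma DM x y : D (x * y) = D x * D y.
Proof. exact: rmorphM. Qed.

Lemma clsZ k x : cls (k *: x) = k *: cls x.
Proof. by have := cls_linear k x 0; rewrite cls0 !addr0. Qed.

Lemma incP k m m' : inc (k *: m + m') = k *: inc m + inc m'.
Proof. exact: linearP. Qed.

Lemma incM m m' : inc (m * m') = inc m * inc m'.
Proof. exact: rmorphM. Qed.

Lemma inc1 : inc 1 = 1.
Proof. exact: rmorph1. Qed.

Lemma cls_inc m w : cls (inc m * w) = eps (pval m) *: cls w.
Proof.
rewrite -clsZ; apply/qclassE; apply: mem_span; exists (m - eps (pval m) *: 1), w; split.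
  have /= := eps_linear (- eps (pval m)) (pval 1) (pval m).
  have -> : - eps (pval m) *: pval 1 + pval m = pval (m - eps (pval m) *: 1).
    by rewrite -pval_linear addrC scaleNr.
  by move=> h; apply: (etrans h); rewrite pval1 eps1 [_ *: _]mulr1 addNr.
have -> : m - eps (pval m) *: 1 = - eps (pval m) *: 1 + m by rewrite scaleNr addrC.
by rewrite incP inc1 mulrDl -scalerAl mul1r scaleNr addrC.
Qed.

(** M^+ Om is a right ideal, so right multiplication descends to the fibre. *)
Lemma cls_mulr x y w : cls x = cls y -> cls (x * w) = cls (y * w).
Proof.
move=> /qclassE xy; apply/qclassE; rewrite -mulrBl.
have ml : linear (fun x : Om => x * w) by move=> k u v; rewrite mulrDl scalerAl.
apply: (span_min (S := sp_preim (mk_linear ml) (Mplus_Om X)) _ xy) => _ [m [v [em ->]]].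
have H : Mplus_Om X (inc m * v * w) by apply: mem_span; exists m, (v * w); rewrite mulrA.
exact: H.
Qed.

(** [id (x) f] after the identification of [w] with [w_(-1) (x) [w_(0)]]. *)
Definition coef (f : {linear fibre X -> C^o}) (w : Om) : SU :=
  slice (fun v => f (cls v)) (D w).

Lemma fcls_linear (f : {linear fibre X -> C^o}) : linear (fun v => f (cls v) : C^o).
Proof. by move=> k x y; rewrite cls_linear linearP. Qed.

Lemma coef_linear f : linear (coef f).
Proof.
move=> k x y; rewrite /coef linearP; apply: slice_linear; exact: fcls_linear.
Qed.

Lemma coef_zero f : coef f 0 = 0.
Proof. exact: (linear0 (mk_linear (coef_linear f))). Qed.

Lemma coef_scale f k w : coef f (k *: w) = k *: coef f w.
Proof. by have := coef_linear f k w 0; rewrite coef_zero !addr0. Qed.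

Lemma coefE f w : coef f w = slice f (tmap id cls (D w)).
Proof. by rewrite slice_tmap //; [exact: cls_linear|exact: linearP]. Qed.

Lemma slice_dif (L : Om -> C) w : linear (L : Om -> C^o) ->
  slice L (D (dif w)) = slice (fun v => L (dif v)) (D w).
Proof.
move=> lL; have [_ _ _ ->] := coactP X.
by rewrite slice_tmap // => k x y; exact: linearP.
Qed.

Lemma D_inc_in m : tensors_in (fun v => exists m', v = inc m') (D (inc m)).
Proof.
have [_ _ /(_ m)[t _ ->] _] := coactP X.
have il : linear inc by move=> k x y; exact: linearP.
rewrite [t]tensorE; pose T := mk_linear (tmapr_linear (V := SU) il).
rewrite -[tmap _ _ _]/(T _) linear_sum; apply: sp_sum => p _; apply: mem_span.
exists p.1, (inc p.2); split; first by exists p.2.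
exact: tmaprE.
Qed.

Lemma cls_counit w : cls w = teval (fun (u : SU) v => eps u *: v) (tmap id cls (D w)).
Proof.
have bl (W : lmodType C) : bilin (fun (u : SU) (v : W) => eps u *: v).
  split=> u k x y /=; last by rewrite scalerDr !scalerA mulrC.
  by rewrite eps_linear scalerDl scalerA.
have [_ cu _ _] := coactP X; rewrite -{1}(cu w); move: (D w); apply: tensor_lin_ext.
- by move=> k x y; rewrite (teval_linear (bl _)) cls_linear.
- move=> k x y; rewrite (tmapr_linear cls_linear).
  exact: (teval_linear (bl _)).
move=> u v; rewrite (tmaprE _ _ cls_linear).
by rewrite !(teval_pure (bl _)) clsZ.
Qed.

Lemma eps_teval_pure (u : SU) (e : fibre X) : teval (fun (u : SU) v => eps u *: v) (u \tensor e) = eps u *: e.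
Proof.
apply: teval_pure; split=> v k x y /=; last by rewrite scalerDr !scalerA mulrC.
by rewrite eps_linear scalerDl scalerA.
Qed.

Lemma identified_coef (S : subspace Om) k e (f : {linear fibre X -> C^o}) :
  identified D S k e -> f e = 1 ->
  [/\ forall w, S w -> part k (coef f w), forall w, S w -> coef f w = 0 -> w = 0,
      forall u, part k u -> exists2 w, S w & coef f w = u
    & forall w, S w -> cls w = eps (coef f w) *: e].
Proof.
move=> [e0 Sk kS] fe.
have lf : linear (f : fibre X -> C^o) by move=> x y z; exact: linearP.
have Phi w : S w -> part k (coef f w) /\ tmap id cls (D w) = coef f w \tensor e.
  move=> Sw; have [u ku e1] := Sk w Sw.
  by rewrite coefE e1 sliceE // fe scale1r.
split=> [w /Phi[]//|w Sw w0|u ku|w Sw].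
- have [w' [_ uniq]] := kS 0 (sp_set0 (part k)).
  have [_ e1] := Phi w Sw.
  rewrite -(uniq w); last by rewrite e1 w0.
  apply: uniq; split; first exact: sp_set0.
  rewrite tpure0l linear0.
  exact: (linear0 (mk_linear (tmapr_linear (V := SU) cls_linear))).
- have [w [[Sw e1] _]] := kS u ku; exists w => //.
  by rewrite coefE e1 sliceE // fe scale1r.
by have [_ e1] := Phi w Sw; rewrite {1}cls_counit e1 eps_teval_pure.
Qed.

Variable r : {linear SU -> M}.
Hypothesis rK : forall m, r (pval m) = m.

Lemma slice_D_inc (L : Om -> C) m : linear (L : Om -> C^o) ->
  slice L (D (inc m)) = conv hq (fun u => L (inc (r u))) (pval m).
Proof.
move=> lL; have [_ _ /(_ m)[t et ->] _] := coactP X.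
have il : linear inc by move=> k x y; exact: linearP.
have lr : linear (fun u => L (inc (r u)) : C^o) by move=> k x y; rewrite linearP il lL.
rewrite slice_tmap // /conv -[Delta hq (pval m)]/(coprod _) -et slice_tmap //.
by congr slice; apply/funext => v; rewrite rK.
Qed.

Lemma conv_eps_r m : conv hq (fun u => eps (pval (r u))) (pval m) = pval m.
Proof.
have [_ _ /(_ m)[t et _] _] := coactP X.
have le := @eps_linear C q; have lp := pval_linear.
have lr : linear (fun u => eps (pval (r u)) : C^o).
  by move=> k x y; rewrite linearP lp le.
rewrite -[RHS](conv_eps hq) /conv -[Delta hq (pval m)]/(coprod _) -et !slice_tmap //.
by congr slice; apply/funext => v; rewrite rK.
Qed.

(** In the fibre a left factor from M acts through the counit, and (id (x) eps) Delta = id. *)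
Lemma coef_mull f m w : coef f (inc m * w) = pval m * coef f w.
Proof.
have [ri riK] := @retraction C M Om inc (@inc_inj _ _ X).
have le := @eps_linear C q; have lp := pval_linear.
have l1 : linear (fun v => eps (pval (ri v)) : C^o) by move=> k x y; rewrite linearP lp le.
have [_ _ _ _] := coactP X; have := D_inc_in m => Dm.
rewrite /coef rmorphM (sliceM_in (L1 := fun v => eps (pval (ri v)))
  (L2 := fun v => f (cls v)) _ l1 _ _ Dm (tensors_inT _)).
- rewrite slice_D_inc //; congr (_ * _); rewrite -[RHS]conv_eps_r; congr (conv hq _ _).
  by apply/funext => u; rewrite riK.
- exact: fcls_linear.
- exact: fcls_linear.
- by move=> _ v' [m' ->] _; rewrite cls_inc riK linearZ.
Qed.

Lemma b_zero_subproof : deg [:: Gb; Gc] = 0. Proof. by rewrite /deg unlock. Qed.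
Definition b_zero : M := exist _ (word [:: Gb; Gc]) (podles_word_subproof q b_zero_subproof).

Lemma pval_minus : pval (b_minus q) = a * b.
Proof. exact: word_cons. Qed.
Lemma pval_zero : pval b_zero = b * c.
Proof. exact: word_cons. Qed.
Lemma pval_plus : pval (b_plus q) = c * d.
Proof. exact: word_cons. Qed.

Lemma eps_b : [/\ eps (pval (b_minus q)) = 0, eps (pval b_zero) = 0 & eps (pval (b_plus q)) = 0].
Proof.
by rewrite pval_minus pval_zero pval_plus !epsM !eps_gen /= !(mulr0, mul0r).
Qed.

(** The axioms make only [dif] commute with the coaction. On functions dA is [dif] followed by the
    projection p that kills B, and since D preserves A and B, the covariance passes to dA. *)
Lemma slice_component (A B : subspace Om) (dA dB : {linear Om -> Om}) :
  (forall w, A w -> B w -> w = 0) -> (forall w, dif w = dA w + dB w) ->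
  (forall w, A w -> tensors_in A (D w)) -> (forall w, B w -> tensors_in B (D w)) ->
  (forall m, A (dA (inc m))) -> (forall m, B (dB (inc m))) ->
  forall (L : Om -> C) m, linear (L : Om -> C^o) ->
  slice L (D (dA (inc m))) = conv hq (fun u => L (dA (inc (r u)))) (pval m).
Proof.
move=> AB0 dif_dAB A_cov B_cov dA_A dB_B L m lL.
have [p [pA pB _]] := complement_projection AB0.
have lLp : linear (fun v => L (p v) : C^o) by move=> k x y; rewrite linearP lL.
have lLA : linear (fun v => L (dA v) : C^o) by move=> k x y; rewrite linearP lL.
have lLpd : linear (fun v => L (p (dif v)) : C^o) by move=> k x y; rewrite !linearP lL.
rewrite -(slice_D_inc m lLA).
have -> : slice (fun v => L (dA v)) (D (inc m)) = slice (fun v => L (p (dif v))) (D (inc m)).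
  apply: (slice_eq_in lLA lLpd _ (D_inc_in m)) => _ [m' ->].
  by rewrite dif_dAB linearD /= pA ?pB ?addr0.
rewrite -(slice_dif _ lLp) dif_dAB DD sliceD //.
rewrite -(slice_eq_in lL lLp _ (A_cov _ (dA_A m))); last by move=> v /pA ->.
rewrite [X in _ = _ + X](slice_eq_in (L' := fun=> 0) lLp _ _ (B_cov _ (dB_B m))).
- by rewrite slice_zero addr0.
- by move=> k x y; rewrite scaler0 addr0.
by move=> v /pB ->; exact: (linear0 (mk_linear lL)).
Qed.

(** The statements below hold for each of the two summands of the one-forms:
    [A] is one of them and [B] the other one. *)
Section Side.
Variables (A B : subspace Om) (dA dB : {linear Om -> Om}) (bA bB : M).
Variables (eA eB : fibre X) (tA : int) (fA : {linear fibre X -> C^o}).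
Variables (wA wB w0 : seq gen).
Hypothesis A_mull : forall m w, A w -> A (inc m * w).
Hypothesis A_mulr : forall m w, A w -> A (w * inc m).
Hypothesis dA_A : forall m, A (dA (inc m)).
Hypothesis dB_B : forall m, B (dB (inc m)).
Hypothesis AB0 : forall w, A w -> B w -> w = 0.
Hypothesis dif_dAB : forall w, dif w = dA w + dB w.
Hypothesis dA_leibniz : forall m m', dA (inc (m * m')) = dA (inc m) * inc m' + inc m * dA (inc m').
Hypothesis A_cov : forall w, A w -> tensors_in A (D w).
Hypothesis B_cov : forall w, B w -> tensors_in B (D w).
Hypothesis A_id : identified D A tA eA.
Hypothesis B_line : forall w, B w -> exists k, cls w = k *: eB.
Hypotheses (fA_A : fA eA = 1) (fA_B : fA eB = 0).
Hypotheses (eA_def : eA = cls (dif (inc bA))) (eB_def : eB = cls (dif (inc bB))).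
Hypothesis bAB : (bA = b_plus q /\ bB = b_minus q) \/ (bA = b_minus q /\ bB = b_plus q).
Hypothesis tA0 : tA != 0.
Hypothesis wA_deg : deg wA = tA.
Hypothesis conv_values : forall L : SU -> C, linear (L : SU -> C^o) ->
  L 1 = 0 -> L (b * c) = 0 -> L (pval bA) = 1 -> L (pval bB) = 0 ->
  [/\ conv hq L (pval bA) = word wA, conv hq L (pval bB) = word wB
    & conv hq L (b * c) = q^-1 *: word w0].
Hypothesis bA_b0 : exists k : C, pval bA * pval b_zero = k *: (pval b_zero * pval bA).

Let gA := coef fA.
Let XA m : C := fA (cls (dA (inc m))).
Let eta := dA (inc bA).

Let linc : linear inc. Proof. by move=> k x y; exact: linearP. Qed.

Lemma XA_linear : linear (fun u => XA (r u) : C^o).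
Proof. by move=> k x y; rewrite /XA linearP linc linearP fcls_linear. Qed.

Lemma A_props : [/\ forall w, A w -> part tA (gA w), forall w, A w -> gA w = 0 -> w = 0,
      forall u, part tA u -> exists2 w, A w & gA w = u
    & forall w, A w -> cls w = eps (gA w) *: eA].
Proof. exact: identified_coef A_id fA_A. Qed.

Lemma cls_A w : A w -> cls w = fA (cls w) *: eA.
Proof.
have [_ _ _ h] := A_props; move=> /h ->; rewrite linearZ fA_A; congr (_ *: _).
by rewrite /= [RHS]mulr1.
Qed.

Lemma fA_cls_B w : B w -> fA (cls w) = 0.
Proof. by move=> /B_line[k ->]; rewrite linearZ fA_B /= [LHS]mulr0. Qed.

Lemma slice_dA L m : linear (L : Om -> C^o) ->
  slice L (D (dA (inc m))) = conv hq (fun u => L (dA (inc (r u)))) (pval m).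
Proof. by move=> lL; apply: slice_component AB0 dif_dAB A_cov B_cov dA_A dB_B _ _ lL. Qed.

Lemma gA_dA m : gA (dA (inc m)) = conv hq (fun u => XA (r u)) (pval m).
Proof. by rewrite /gA /coef slice_dA //; exact: fcls_linear. Qed.

Lemma XA1 : XA 1 = 0.
Proof.
have := dA_leibniz 1 1; rewrite mulr1 inc1 mulr1 mul1r => /eqP.
by rewrite -subr_eq0 opprD addrA subrr sub0r oppr_eq0 /XA inc1 => /eqP ->; rewrite cls0 linear0.
Qed.

Lemma XA_bA : XA bA = 1.
Proof.
have := fA_A; rewrite eA_def dif_dAB clsD linearD /= (fA_cls_B (dB_B _)).
by rewrite [_ + 0]addr0.
Qed.

Lemma XA_bB : XA bB = 0.
Proof.
have := fA_B; rewrite eB_def dif_dAB clsD linearD /= (fA_cls_B (dB_B _)).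
by rewrite [_ + 0]addr0.
Qed.

Lemma r1 : r 1 = 1.
Proof. by rewrite -pval1 rK. Qed.

Lemma conv_b0 (L : M -> C) : linear (fun u => L (r u) : C^o) -> 
  conv hq (fun u => L (r u)) (b * c) = (q^-1 * L (b_minus q)) *: (a * c)
    + (L b_zero *: (a * d + q^-1 *: (b * c)) + L 1 *: (b * c)) + (q^-1 * L (b_plus q)) *: (b * d).
Proof.
move=> lL; rewrite conv_bc // -pval_minus -pval_zero -pval_plus !rK r1 !addrA //.
Qed.

Lemma part_words : [/\ part (-2) (a * c), part 0 (a * d), part 0 (b * c) & part 2 (b * d)].
Proof.
have h i j := partM (part_gen q i) (part_gen q j).
by split; [exact: (h Ga Gc)|exact: (h Ga Gd)|exact: (h Gb Gc)|exact: (h Gb Gd)].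
Qed.

Lemma middle_neq0 u k : eps u = 1 -> u * (k *: (a * d + q^-1 *: (b * c))) = 0 -> k = 0.
Proof.
move=> u1 e; have := congr1 (@eps C q) e.
by rewrite epsM epsZ epsD epsZ !epsM !eps_gen u1 eps0 /= !(mulr0, addr0, mulr1, mul1r).
Qed.

(** The summands of [u (id (x) L)(b c)] have different degrees. *)
Lemma conv_b0_degree (L : M -> C) s t u : linear (fun u => L (r u) : C^o) ->
  part s u -> (exists w, u = word w) -> part t (u * conv hq (fun u => L (r u)) (b * c)) ->
  [/\ t != s - 2 -> L (b_minus q) = 0,
       t != s -> L 1 = 0 -> eps u = 1 -> L b_zero = 0 & t != s + 2 -> L (b_plus q) = 0].
Proof.
move=> lL su [w uw]; rewrite conv_b0 // 2!mulrDr.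
have [p1 p2 p3 p4] := part_words.
have nz i j k : u * (k *: (SU2_gen q i * SU2_gen q j)) = 0 -> k = 0.
  rewrite uw -scalerAr => /eqP; rewrite scaler_eq0 => /orP[/eqP//|].
  have -> : SU2_gen q i * SU2_gen q j = word [:: i; j] by rewrite word_cons.
  by rewrite SU2_wordM (negPf (word_neq0 hq _)).
have qi : q^-1 != 0 by rewrite invr_eq0.
have Z x : q^-1 * x = 0 -> x = 0 by move/eqP; rewrite mulf_eq0 (negPf qi) => /eqP.
have q1 k : part (s - 2) (u * (k *: (a * c))) by apply: partM => //; exact: spZ.
have q2 x y : part s (u * (x *: (a * d + q^-1 *: (b * c)) + y *: (b * c))).
  rewrite -[s]addr0; apply: partM => //; apply: spD; last exact: spZ.
  by apply: spZ; apply: spD => //; exact: spZ.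
have q3 k : part (s + 2) (u * (k *: (b * d))) by apply: partM => //; exact: spZ.
move=> /(homogeneous_sum hq (q1 _) (q2 _ _) (q3 _))[h1 h2 h3].
split=> [/h1/nz/Z//|ts L1 u1|/h3/nz/Z//].
by move: (h2 ts); rewrite L1 scale0r addr0; exact: middle_neq0.
Qed.

(** This value sits in the degree 0 summand of the coefficient of dA b_0, while that coefficient has
    the nonzero degree [tA]. *)
Lemma XA_b0 : XA b_zero = 0.
Proof.
have [pA _ _ _] := A_props; have := pA _ (dA_A b_zero).
rewrite gA_dA pval_zero -[conv _ _ _]mul1r.
move=> /(conv_b0_degree XA_linear (part1 q)) [|_ h _]; first by exists [::].
by apply: h => //; [exact: XA1|exact: eps1].
Qed.

Lemma gA_values : [/\ gA (dA (inc bA)) = word wA, gA (dA (inc bB)) = word wB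
    & gA (dA (inc b_zero)) = q^-1 *: word w0].
Proof.
rewrite !gA_dA pval_zero; apply: conv_values; first exact: XA_linear.
- by rewrite r1 XA1.
- by rewrite -pval_zero rK XA_b0.
- by rewrite rK XA_bA.
- by rewrite rK XA_bB.
Qed.

Lemma fA0 : fA 0 = 0. Proof. exact: linear0. Qed.
Lemma fAZ k x : fA (k *: x) = k * fA x. Proof. exact: linearZ. Qed.
Lemma fAD x y : fA (x + y) = fA x + fA y. Proof. exact: linearD. Qed.

(** The right action of forms on the fibre of A, seen on the generator eta. Restricted to M it is a
    character, shown to be the counit in [chi_eps]. *)
Let chi (v : Om) : C := fA (cls (eta * v)).

Lemma chi_linear : linear (chi : Om -> C^o).
Proof.
by move=> k x y; rewrite /chi mulrDr -scalerAr fcls_linear.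
Qed.

Lemma cls_eta : cls eta = eA.
Proof. by rewrite (cls_A (dA_A _)) -/(XA bA) XA_bA scale1r. Qed.

Lemma fA_cls_mul w v : A w -> fA (cls (w * v)) = fA (cls w) * chi v.
Proof.
move=> /cls_A e; have -> : cls (w * v) = cls ((fA (cls w) *: eta) * v).
  by apply: cls_mulr; rewrite clsZ cls_eta.
by rewrite -scalerAl clsZ fAZ.
Qed.

Lemma gA_mulr_chi w m : A w -> gA (w * inc m) = gA w * conv hq (fun u => chi (inc (r u))) (pval m).
Proof.
move=> Aw; rewrite /gA /coef DM -slice_D_inc; last exact: chi_linear.
apply: (sliceM_in _ _ chi_linear _ (A_cov Aw) (D_inc_in m)); try exact: fcls_linear.
by move=> v _ Av [m' ->]; exact: fA_cls_mul.
Qed.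

Lemma chi_inc_linear : linear (fun u => chi (inc (r u)) : C^o).
Proof. by move=> k x y; rewrite linearP linc chi_linear. Qed.

Lemma chi1 : chi (inc 1) = 1.
Proof. by rewrite /chi inc1 mulr1 cls_eta fA_A. Qed.

Lemma chiM m m' : chi (inc (m * m')) = chi (inc m) * chi (inc m').
Proof.
rewrite {1}/chi incM mulrA fA_cls_mul //; apply: A_mulr; exact: dA_A.
Qed.

(** The values at b_- and b_+ vanish because eta b_0 stays in degree [tA]. The one at b_0 follows
    from dA applied to bA b_0 = k b_0 bA: in the fibre the left side gives chi(b_0), the right side
    zero. *)
Lemma chi_b : [/\ chi (inc (b_minus q)) = 0, chi (inc b_zero) = 0 & chi (inc (b_plus q)) = 0].
Proof.
have [pA _ _ _] := A_props; have [vA _ _] := gA_values.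
have := pA _ (A_mulr b_zero (dA_A bA)); rewrite gA_mulr_chi //= pval_zero => pt.
have pw : part tA (word wA) by rewrite -wA_deg; exact: part_word.
rewrite -/gA vA in pt.
have [//|h1 _ h3] := conv_b0_degree (L := fun m => chi (inc m)) chi_inc_linear pw _ pt.
  by exists wA.
have cm : chi (inc (b_minus q)) = 0 by apply: h1; lia.
have cp : chi (inc (b_plus q)) = 0 by apply: h3; lia.
split=> //; have [k bAb0] := bA_b0; have {bAb0} bAb0 : bA * b_zero = k *: (b_zero * bA).
  by apply: pval_inj; rewrite -[k *: _]addr0 pval_linear !pvalM bAb0 [pval 0](_ : _ = 0) ?addr0 //.
have := congr1 (fun m => fA (cls (dA (inc m)))) bAb0.
have -> : inc (k *: (b_zero * bA)) = k *: inc (b_zero * bA) by exact: linearZ.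
rewrite linearZ /= !dA_leibniz clsZ !clsD fAZ !fAD.
have [em e0 ep] := eps_b.
have eA0 : eps (pval bA) = 0 by case: bAB => -[-> _].
rewrite !cls_inc e0 eA0 !scale0r !fA0 (fA_cls_mul _ (dA_A bA)) (fA_cls_mul _ (dA_A b_zero)).
by rewrite -/(XA bA) -/(XA b_zero) XA_b0 XA_bA mul1r mul0r !addr0 mulr0.
Qed.

Lemma chi_eps m : chi (inc m) = eps (pval m).
Proof.
have cl := chi_inc_linear; have el := @eps_linear C q.
have dl : linear (fun u => chi (inc (r u)) - eps u : C^o).
  by move=> k x y; rewrite cl el; lmod.
have W u : part 0 u -> sp_ker (mk_linear dl) u.
  have [c1 c2 c3] := chi_b; have [e1 e2 e3] := eps_b.
  apply: (part0_gen hq); first by rewrite /= r1 chi1 eps1 subrr.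
  move=> v /pval_onto[m' <-] _ /=; rewrite -pval_minus -pval_zero -pval_plus -!pvalM !rK !chiM.
  by rewrite !pvalM !epsM c1 c2 c3 e1 e2 e3 !mul0r subrr.
by have /= /eqP := W _ (pval_part m); rewrite rK subr_eq0 => /eqP.
Qed.

Lemma gA_mulr w m : A w -> gA (w * inc m) = gA w * pval m.
Proof.
move=> Aw; rewrite gA_mulr_chi // -[in RHS]conv_eps_r; congr (_ * conv hq _ _).
by apply/funext => u; rewrite chi_eps.
Qed.

(** By [coef_mull] and [gA_mulr] the coefficient of dA is a derivation of M, so comparison on the
    three generators suffices. *)
Lemma gA_derivation (G : {linear SU -> SU}) :
  G 1 = 0 -> (forall u v, part 0 v -> G (u * v) = u * G v + G u * v) ->
  G (pval bA) = word wA -> G (pval bB) = word wB -> G (b * c) = q^-1 *: word w0 ->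
  forall m, gA (dA (inc m)) = G (pval m).
Proof.
move=> G1 GM GA GB G0 m; have [vA vB v0] := gA_values.
have dl : linear (fun u => gA (dA (inc (r u))) - G u).
  by move=> k x y; rewrite !linearP /= /gA coef_linear; lmod.
have gD x y : gA (x + y) = gA x + gA y.
  by have := coef_linear fA 1 x y; rewrite !scale1r.
have W u : part 0 u -> sp_ker (mk_linear dl) u.
  apply: (part0_gen hq).
    have dA1 : dA (inc 1) = 0.
      have := dA_leibniz 1 1; rewrite mulr1 inc1 mulr1 mul1r => /eqP.
      by rewrite -subr_eq0 opprD addrA subrr sub0r oppr_eq0 => /eqP.
    by rewrite /= r1 G1 subr0 dA1 -(subrr 0) -scaleN1r addrC /gA coef_linear scaleN1r addNr.
  have gM m1 m2 : gA (dA (inc (m1 * m2))) = gA (dA (inc m1)) * pval m2 + pval m1 * gA (dA (inc m2)).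
    by rewrite dA_leibniz gD gA_mulr // /gA coef_mull.
  move=> v /pval_onto[m' <-] /= /eqP; rewrite rK subr_eq0 => /eqP Wm.
  rewrite -pval_minus -pval_zero -pval_plus -!pvalM !rK !gM !pvalM !GM ?Wm; try exact: pval_part.
  have [-> -> ->] : [/\ gA (dA (inc (b_minus q))) = G (pval (b_minus q)),
      gA (dA (inc b_zero)) = G (pval b_zero) & gA (dA (inc (b_plus q))) = G (pval (b_plus q))].
    rewrite pval_zero v0 G0; case: bAB => -[eA' eB']; move: vA vB GA GB;
    by rewrite eA' eB' => -> -> -> ->.
  by split; rewrite [X in _ - X]addrC subrr.
by have /= /eqP := W _ (pval_part m); rewrite rK subr_eq0 => /eqP.
Qed.

Variables (GA GB : {linear SU -> SU}) (tB : int) (fB fT : {linear fibre X -> C^o}).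
Hypothesis GA_E : forall m, gA (dA (inc m)) = GA (pval m).
Hypothesis GB_E : forall m, coef fB (dB (inc m)) = GB (pval m).
Hypotheses (B_id : identified D B tB eB) (fB_B : fB eB = 1).
Hypotheses (T_id : identified D (forms X 2) 0 (tau X)) (fT_T : fT (tau X) = 1).
Hypothesis B_mull : forall m w, B w -> B (inc m * w).
Hypothesis AB_T : forall u v, A u -> B v -> forms X 2 (u * v).
Hypothesis dA_dif : forall w, B w -> dA w = dif w.
Hypothesis dA_T : forall w, B w -> forms X 2 (dA w).
Hypothesis dA_leibnizB : forall m w, B w -> dA (inc m * w) = dA (inc m) * w + inc m * dA w.
Hypothesis dB_1 : dB 1 = 0.
Hypothesis B_gen : forall W : subspace SU,
  (forall u, part 0 u -> [/\ W (u * GB (a * b)), W (u * GB (b * c)) & W (u * GB (c * d))]) ->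
  forall u, part tB u -> W u.
Hypothesis XB_values : [/\ fB (cls (dB (inc bA))) = 0, fB (cls (dB (inc b_zero))) = 0
  & fB (cls (dB (inc bB))) = 1].
Hypothesis tA_val : (bA = b_plus q /\ tA = 2) \/ (bA = b_minus q /\ tA = -2).
Hypothesis wA_eps : eps (word wA) = 1.

Let gB := coef fB.
Let gT := coef fT.
Let Z (v : Om) : C := fT (cls (eta * v)).

(** The two unknowns of the second-order part: in coefficients the wedge of A with B is [zeta] times
    the product, and [lambda] is the tau-component of dA dB b_0 at the fibre. *)
Definition zeta : C := Z (dB (inc bB)).
Definition lambda : C := fT (cls (dA (dB (inc b_zero)))).

Lemma slice_dB L m : linear (L : Om -> C^o) ->
  slice L (D (dB (inc m))) = conv hq (fun u => L (dB (inc (r u)))) (pval m).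
Proof.
move=> lL; apply: (@slice_component B A dB dA) lL => // [w Bw Aw|w]; first exact: AB0.
by rewrite addrC.
Qed.

Lemma Z_linear : linear (Z : Om -> C^o).
Proof. by move=> k x y; rewrite /Z mulrDr -scalerAr fcls_linear. Qed.

Lemma T_props : [/\ forall w, forms X 2 w -> part 0 (gT w), forall w, forms X 2 w -> gT w = 0 -> w = 0,
      forall u, part 0 u -> exists2 w, forms X 2 w & gT w = u
    & forall w, forms X 2 w -> cls w = eps (gT w) *: tau X].
Proof. exact: identified_coef T_id fT_T. Qed.

Lemma B_props : [/\ forall w, B w -> part tB (gB w), forall w, B w -> gB w = 0 -> w = 0,
      forall u, part tB u -> exists2 w, B w & gB w = u
    & forall w, B w -> cls w = eps (gB w) *: eB].
Proof. exact: identified_coef B_id fB_B. Qed.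

Lemma gT_mul w v : A w -> B v -> gT (w * v) = gA w * slice Z (D v).
Proof.
move=> Aw Bv; rewrite /gT /coef DM.
apply: (sliceM_in _ _ Z_linear _ (A_cov Aw) (B_cov Bv)); try exact: fcls_linear.
move=> w' v' /cls_A e _; have -> : cls (w' * v') = cls ((fA (cls w') *: eta) * v').
  by apply: cls_mulr; rewrite clsZ cls_eta.
by rewrite -scalerAl clsZ [LHS]linearZ.
Qed.

Lemma gA_eta : gA eta = word wA.
Proof. by case: gA_values. Qed.

Lemma Z_dB_linear : linear (fun u => Z (dB (inc (r u))) : C^o).
Proof. by move=> k x y; rewrite !linearP Z_linear. Qed.

(** The coefficient of eta dB b_0 has degree 0 and contains the factor [word wA] of degree 2 or -2.
    Only the summand that compensates this degree survives, and it carries the value at bB. *)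
Lemma Z_values : Z (dB (inc bA)) = 0 /\ Z (dB (inc b_zero)) = 0.
Proof.
have [pT _ _ _] := T_props; have := pT _ (AB_T (dA_A bA) (dB_B b_zero)).
rewrite gT_mul // slice_dB; last exact: Z_linear.
rewrite -/eta gA_eta pval_zero => pt.
have pw : part tA (word wA) by rewrite -wA_deg; exact: part_word.
have [|h1 h2 h3] := conv_b0_degree (L := fun m => Z (dB (inc m))) Z_dB_linear pw _ pt.
  by exists wA.
split; last by apply: h2; rewrite 1?eq_sym // inc1 dB_1; exact: (linear0 (mk_linear Z_linear)).
by case: tA_val => -[-> tE]; [apply: h3|apply: h1]; rewrite tE.
Qed.

Lemma cls_eta_inc m v : cls (eta * (inc m * v)) = eps (pval m) *: cls (eta * v).
Proof.
rewrite mulrA -clsZ scalerAl; apply: cls_mulr; rewrite clsZ cls_eta.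
rewrite (cls_A (A_mulr m (dA_A bA))) fA_cls_mul //.
by rewrite chi_eps -/(XA bA) XA_bA mul1r.
Qed.

Definition B_pred (Q : Om -> SU -> Prop) (u : SU) := exists w, [/\ B w, gB w = u & Q w u].

(** The coefficients of the forms m dB m', with m' a generator, span degree [tB] by [B_gen]; as [gB]
    is injective on B, these forms span B. *)
Lemma B_ind (Q : Om -> SU -> Prop) : Q 0 0 ->
  (forall k w u w' u', Q w u -> Q w' u' -> Q (k *: w + w') (k *: u + u')) ->
  (forall m m', m' = b_minus q \/ m' = b_zero \/ m' = b_plus q ->
     Q (inc m * dB (inc m')) (pval m * GB (pval m'))) ->
  forall w, B w -> Q w (gB w).
Proof.
move=> Q0 QP Qg w Bw; have [pB Binj _ _] := B_props.
have S0 : B_pred Q 0.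
  exists 0; split=> //; first exact: sp_set0.
  exact: coef_zero.
have SP k u u' : B_pred Q u -> B_pred Q u' -> B_pred Q (k *: u + u').
  move=> [v [Bv gv Qv]] [v' [Bv' gv' Qv']]; exists (k *: v + v'); split.
  - exact: sp_setP.
  - by rewrite /gB coef_linear -/gB gv gv'.
  - exact: QP.
pose S := Subspace S0 SP.
have [v [Bv gv Qv]] : S (gB w).
  apply: B_gen (pB _ Bw) => _ /pval_onto[m <-].
  rewrite -pval_minus -pval_zero -pval_plus.
  have H m' : m' = b_minus q \/ m' = b_zero \/ m' = b_plus q -> B_pred Q (pval m * GB (pval m')).
    move=> hm; exists (inc m * dB (inc m')); split; [exact: B_mull|..].
      by rewrite /gB coef_mull GB_E.
    exact: Qg.
  by split; apply: H; auto.
suff <- : v = w by rewrite gv.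
apply/eqP; rewrite -subr_eq0; apply/eqP; apply: Binj; first exact: spB.
by rewrite -scaleN1r addrC /gB coef_linear -/gB gv scaleN1r addNr.
Qed.

Lemma Z_zeta w : B w -> Z w = zeta * fB (cls w).
Proof.
pose Q (v : Om) (_ : SU) := Z v = zeta * fB (cls v).
apply: (B_ind (Q := Q)); rewrite /Q.
- rewrite cls0 linear0 mulr0; exact: (linear0 (mk_linear Z_linear)).
- by move=> k v _ v' _ e e'; rewrite Z_linear e e' fcls_linear [RHS]mulrDr mulrCA.
move=> m m' hm; rewrite {1}/Z cls_eta_inc cls_inc !linearZ /=.
have -> : Z (dB (inc m')) = zeta * fB (cls (dB (inc m'))) -> 
    eps (pval m) *: fT (cls (eta * dB (inc m'))) = zeta * (eps (pval m) *: fB (cls (dB (inc m')))).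
  by rewrite /Z => ->; rewrite [RHS]mulrCA.
  by [].
have [zA z0] := Z_values; have [xA x0 xB] := XB_values.
have eB1 : Z (dB (inc bB)) = zeta * fB (cls (dB (inc bB))) by rewrite xB mulr1.
have eA1 : Z (dB (inc bA)) = zeta * fB (cls (dB (inc bA))) by rewrite xA mulr0.
by case: hm => [->|[->|->]]; [|by rewrite z0 x0 mulr0|]; case: bAB eA1 eB1 => -[-> ->].
Qed.

Lemma slice_Z w : B w -> slice Z (D w) = zeta *: gB w.
Proof.
move=> Bw; have zl : linear (fun v => zeta * fB (cls v) : C^o).
  by move=> k x y; rewrite fcls_linear [LHS]mulrDr mulrCA.
rewrite (slice_eq_in Z_linear zl Z_zeta (B_cov Bw)) /gB /coef.
move: (D w); apply: tensor_lin_ext; first exact: slice_linear.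
  by move=> k x y; rewrite slice_linear ?scalerDr ?scalerA 1?mulrC //; exact: fcls_linear.
move=> u v; rewrite !sliceE ?scalerA //; exact: fcls_linear.
Qed.

Lemma gTD x y : gT (x + y) = gT x + gT y.
Proof. by have := coef_linear fT 1 x y; rewrite !scale1r. Qed.

Lemma gT_dA_mull m w : B w ->
  gT (dA (inc m * w)) = zeta *: (GA (pval m) * gB w) + pval m * gT (dA w).
Proof.
move=> Bw; rewrite dA_leibnizB // gTD /gT [in X in _ + X]coef_mull; congr (_ + _).
by rewrite -/gT gT_mul // slice_Z // GA_E -scalerAr.
Qed.

Let L2 m : C := fT (cls (dA (dB (inc m)))).

Lemma L2_linear : linear (fun u => L2 (r u) : C^o).
Proof. by move=> k x y; rewrite /L2 !linearP fcls_linear. Qed.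

Lemma gT_dAdB m : gT (dA (dB (inc m))) = conv hq (fun u => L2 (r u)) (pval m).
Proof.
have ld : linear (fun v => fT (cls (dif v)) : C^o) by move=> k x y; rewrite linearP fcls_linear.
rewrite dA_dif // /gT /coef slice_dif; last exact: fcls_linear.
rewrite slice_dB //; congr (conv hq _ _); apply/funext => u.
by rewrite /L2 dA_dif.
Qed.

Lemma L2_values : [/\ L2 (b_minus q) = 0, L2 1 = 0 & L2 (b_plus q) = 0].
Proof.
have [pT _ _ _] := T_props; have := pT _ (dA_T (dB_B b_zero)).
rewrite gT_dAdB pval_zero -[conv _ _ _]mul1r.
move=> /(conv_b0_degree L2_linear (part1 q)) [|h1 _ h3]; first by exists [::].
by split; [exact: h1|rewrite /L2 inc1 dB_1 linear0 cls0 linear0|exact: h3].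
Qed.

Lemma gT_values :
  [/\ gT (dA (dB (inc (b_minus q)))) = (lambda * (q + q^-1)) *: (a * b),
      gT (dA (dB (inc b_zero))) = lambda *: (a * d + q^-1 *: (b * c))
    & gT (dA (dB (inc (b_plus q)))) = (lambda * (q + q^-1)) *: (c * d)].
Proof.
have [lm l1 lp] := L2_values.
have rm : L2 (r (a * b)) = 0 by rewrite -pval_minus rK.
have rz : L2 (r (b * c)) = lambda by rewrite -pval_zero rK.
have rp : L2 (r (c * d)) = 0 by rewrite -pval_plus rK.
have ro : L2 (r 1) = 0 by rewrite r1.
have lL := L2_linear.
rewrite !gT_dAdB pval_minus pval_zero pval_plus conv_ab // conv_bc // conv_cd //.
rewrite rm rz rp ro; split; lmod.
Qed.

Lemma gT_dA_eq (G : {linear SU -> SU}) :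
  (forall u v, part 0 u -> part tB v -> G (u * v) = zeta *: (GA u * v) + u * G v) ->
  G (GB (a * b)) = (lambda * (q + q^-1)) *: (a * b) ->
  G (GB (b * c)) = lambda *: (a * d + q^-1 *: (b * c)) ->
  G (GB (c * d)) = (lambda * (q + q^-1)) *: (c * d) ->
  forall w, B w -> gT (dA w) = G (gB w).
Proof.
move=> GM Gm G0 Gp; have [vm v0 vp] := gT_values; have [pB _ _ _] := B_props.
apply: (B_ind (Q := fun w u => gT (dA w) = G u)).
- rewrite !linear0; exact: coef_zero.
- by move=> k w u w' u' e e'; rewrite !linearP /gT coef_linear -/gT e e'.
move=> m m' hm; rewrite gT_dA_mull // GM; first last.
- by rewrite -GB_E; exact: pB.
- exact: pval_part.
rewrite /gB GB_E; congr (_ + _ * _).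
by case: hm => [->|[->|->]]; rewrite ?vm ?v0 ?vp ?pval_minus ?pval_zero ?pval_plus.
Qed.

(** The hypothesis is the relation bB dB b_0 = k b_0 dB bB in coefficients. Applying dA to it gives
    a linear equation in [zeta] and [lambda], from which either one is found once the other is
    known. *)
Lemma relation_eq k : pval bB * GB (b * c) = k *: (b * c * GB (pval bB)) ->
  zeta *: (GA (pval bB) * GB (b * c)) + pval bB * (lambda *: (a * d + q^-1 *: (b * c))) =
  k *: (zeta *: (GA (b * c) * GB (pval bB)) + b * c * ((lambda * (q + q^-1)) *: pval bB)).
Proof.
move=> e; have [_ Binj _ _] := B_props.
have rel : inc bB * dB (inc b_zero) = k *: (inc b_zero * dB (inc bB)).
  apply/eqP; rewrite -subr_eq0; apply/eqP; apply: Binj.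
    by apply: spB; [|apply: spZ]; apply: B_mull.
  rewrite addrC -scaleNr /gB coef_linear !coef_mull !GB_E pval_zero e.
  by rewrite scaleNr addNr.
have := congr1 (fun w => gT (dA w)) rel; rewrite [dA (k *: _)]linearZ /=.
rewrite /gT coef_scale -/gT.
rewrite !gT_dA_mull // /gB !GB_E pval_zero; have [vm -> vp] := gT_values.
suff -> : gT (dA (dB (inc bB))) = (lambda * (q + q^-1)) *: pval bB by [].
by case: bAB => -[_ ->]; rewrite ?vm ?vp ?pval_minus ?pval_plus.
Qed.

End Side.

End Calculus.

(** * Bidegrees, Leibniz rules and the fibre of one-forms *)

Section DoubleComplex.
Variables (C : numClosedFieldType) (q : C).
Hypothesis hq : q != 0.
Variable X : dolbeault q.

Notation SU := (SU2 q).
Notation a := (SU2_gen q Ga).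
Notation b := (SU2_gen q Gb).
Notation c := (SU2_gen q Gc).
Notation d := (SU2_gen q Gd).
Notation word := (@SU2_word C q).
Notation part := (SU2_part q).
Notation M := (podles q).
Notation pval := (@podles_val C q).
Notation Om := (calc X).
Notation inc := (inc X).
Notation dif := (dif X).
Notation D := (coact X).
Notation cls := (@cls C q X).

Notation G := (bideg X).
Notation E := (der hq 0 1).
Notation F := (der hq 1 0).
Notation line10 := (bideg X 1 0).
Notation line01 := (bideg X 0 1).

Lemma bideg_forms p s w : G p s w -> forms X (p + s) w.
Proof.
have [dsum _ _ _] := bidegP X; have [+ _] := dsum (p + s)%N => /(_ w) h Gw.
apply/h; exists [:: (p, s)], (fun=> w); split=> //=; first by rewrite eqxx.
  by move=> i; rewrite inE => /eqP ->.
by rewrite big_seq1.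
Qed.

Lemma bideg_disjoint p s p' s' w : (p + s = p' + s')%N -> (p, s) != (p', s') ->
  G p s w -> G p' s' w -> w = 0.
Proof.
move=> e ne Gw Gw'; have [dsum _ _ _] := bidegP X; have [_ h] := dsum (p + s)%N.
pose f i := if i == (p, s) then w else - w.
have := h [:: (p, s); (p', s')] f; rewrite /= inE ne e !eqxx => /(_ isT isT).
have -> : \sum_(i <- [:: (p, s); (p', s')]) f i = 0.
  by rewrite !big_cons big_nil /f eqxx eq_sym (negPf ne) addr0 subrr.
move=> /(_ _ erefl (p, s)); rewrite inE eqxx /f eqxx; apply=> // i.
rewrite !inE => /orP[/eqP ->|/eqP ->]; first by rewrite eqxx.
by rewrite eq_sym (negPf ne) -scaleN1r; exact: spZ.
Qed.

Lemma bideg20 w : G 2 0 w -> w = 0.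
Proof. by move=> Gw; apply: (@bideg_disjoint 2 0 1 1) => //; apply/forms11/(bideg_forms Gw). Qed.

Lemma bideg02 w : G 0 2 w -> w = 0.
Proof. by move=> Gw; apply: (@bideg_disjoint 0 2 1 1) => //; apply/forms11/(bideg_forms Gw). Qed.

Lemma bidegM p s p' s' u v : G p s u -> G p' s' v -> G (p + p')%N (s + s')%N (u * v).
Proof. by have [_ h _ _] := bidegP X; exact: h. Qed.

Lemma line10_01 w : line10 w -> line01 w -> w = 0.
Proof. exact: bideg_disjoint. Qed.

Lemma bideg00 m : G 0 0 (inc m).
Proof.
have [dsum _ _ _] := bidegP X; have [+ _] := dsum 0%N => /(_ (inc m)) h.
have [|r [f [_ ar Gf ->]]] := h.1; first by apply/forms0; exists m.
apply: sp_sum => i ri; have := allP ar _ ri; have := Gf _ ri.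
by case: i {ri} => -[|?] [|?].
Qed.

Lemma forms1P w : forms X 1 w -> exists u v, [/\ line10 u, line01 v & w = u + v].
Proof.
have [dsum _ _ _] := bidegP X; have [+ _] := dsum 1%N => /(_ w) h /h [r [f [_ ar Gf ->]]].
have S0 : exists u v, [/\ line10 u, line01 v & 0 = u + v :> Om].
  by exists 0, 0; split; rewrite ?addr0 //; exact: sp_set0.
have SP k x y : (exists u v, [/\ line10 u, line01 v & x = u + v]) ->
    (exists u v, [/\ line10 u, line01 v & y = u + v]) ->
    exists u v, [/\ line10 u, line01 v & k *: x + y = u + v].
  move=> [u [v [hu hv ->]]] [u' [v' [hu' hv' ->]]]; exists (k *: u + u'), (k *: v + v').
  by split; [exact: sp_setP|exact: sp_setP|rewrite scalerDr addrACA].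
apply: (sp_sum (S := Subspace S0 SP)) => i ri /=.
have := allP ar _ ri; have := Gf _ ri.
case: i {ri} => -[|[|?]] [|[|?]] //= h' _; [exists 0, (f (0, 1)%N)|exists (f (1, 0)%N), 0].
  by split=> //; [exact: sp_set0|rewrite add0r].
by split=> //; [exact: sp_set0|rewrite addr0].
Qed.

Lemma mull10 m w : line10 w -> line10 (inc m * w).
Proof. exact: bidegM (bideg00 m). Qed.
Lemma mulr10 m w : line10 w -> line10 (w * inc m).
Proof. by move=> h; exact: (bidegM h (bideg00 m)). Qed.
Lemma mull01 m w : line01 w -> line01 (inc m * w).
Proof. exact: bidegM (bideg00 m). Qed.
Lemma mulr01 m w : line01 w -> line01 (w * inc m).
Proof. by move=> h; exact: (bidegM h (bideg00 m)). Qed.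

Lemma del10 m : line10 (del X (inc m)).
Proof. exact: del_bideg (bideg00 m). Qed.
Lemma delbar01 m : line01 (delbar X (inc m)).
Proof. exact: delbar_bideg (bideg00 m). Qed.

Lemma del_line10 w : line10 w -> del X w = 0.
Proof. by move=> h; apply: bideg20; exact: del_bideg h. Qed.
Lemma delbar_line01 w : line01 w -> delbar X w = 0.
Proof. by move=> h; apply: bideg02; exact: delbar_bideg h. Qed.

Lemma forms2_10_01 u v : line10 u -> line01 v -> forms X 2 (u * v).
Proof. by move=> hu hv; apply/forms11; exact: (bidegM hu hv). Qed.
Lemma forms2_01_10 u v : line01 u -> line10 v -> forms X 2 (u * v).
Proof. by move=> hu hv; apply/forms11; exact: (bidegM hu hv). Qed.

Lemma dif_leibniz0 m w : dif (inc m * w) = dif (inc m) * w + inc m * dif w.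
Proof. by rewrite (@dif_leibniz _ _ X 0) ?expr0 ?scale1r //; apply/forms0; exists m. Qed.

Lemma line_sum0 u v : line10 u -> line01 v -> u + v = 0 -> u = 0 /\ v = 0.
Proof.
move=> hu hv /eqP; rewrite addr_eq0 => /eqP e.
have u0 : u = 0 by apply: line10_01 => //; rewrite e -scaleN1r; exact: spZ.
by split=> //; apply/eqP; rewrite -oppr_eq0 -e u0.
Qed.

(** The axioms state the Leibniz rule for d alone; its parts of bidegree (1,0) and (0,1) separate
    because such forms have zero intersection. *)
Lemma component_leibniz m m' :
  del X (inc (m * m')) = del X (inc m) * inc m' + inc m * del X (inc m') /\
  delbar X (inc (m * m')) = delbar X (inc m) * inc m' + inc m * delbar X (inc m').
Proof.
pose u := del X (inc (m * m')) - (del X (inc m) * inc m' + inc m * del X (inc m')).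
pose v := delbar X (inc (m * m')) - (delbar X (inc m) * inc m' + inc m * delbar X (inc m')).
have hu : line10 u.
  by apply: spB; [exact: del10|apply: spD; [apply: mulr10|apply: mull10]; exact: del10].
have hv : line01 v.
  by apply: spB; [exact: delbar01|apply: spD; [apply: mulr01|apply: mull01]; exact: delbar01].
have uv : u + v = 0.
  rewrite /u /v addrACA -opprD -dif_split addrACA -mulrDl -mulrDr -!dif_split.
  by rewrite rmorphM -dif_leibniz0 subrr.
by have [/eqP + /eqP] := line_sum0 hu hv uv; rewrite !subr_eq0 => /eqP -> /eqP ->.
Qed.

Lemma del_line01 w : line01 w -> del X w = dif w.
Proof. by move=> h; rewrite dif_split delbar_line01 // addr0. Qed.
Lemma delbar_line10 w : line10 w -> delbar X w = dif w.
Proof. by move=> h; rewrite dif_split del_line10 // add0r. Qed.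

Lemma del_leibniz01 m w : line01 w -> del X (inc m * w) = del X (inc m) * w + inc m * del X w.
Proof.
move=> h; rewrite (del_line01 (mull01 m h)) (del_line01 h).
rewrite dif_leibniz0 (dif_split (inc m)) mulrDl; congr (_ + _); rewrite -[RHS]addr0; congr (_ + _).
by apply: bideg02; exact: (bidegM (delbar01 m) h).
Qed.

Lemma delbar_leibniz10 m w : line10 w ->
  delbar X (inc m * w) = delbar X (inc m) * w + inc m * delbar X w.
Proof.
move=> h; rewrite (delbar_line10 (mull10 m h)) (delbar_line10 h).
rewrite dif_leibniz0 (dif_split (inc m)) mulrDl; congr (_ + _); rewrite -[RHS]add0r; congr (_ + _).
by apply: bideg20; exact: (bidegM (del10 m) h).
Qed.

Lemma del1 : del X 1 = 0.
Proof.
have [] := component_leibniz 1 1; rewrite mulr1 inc1 mulr1 mul1r => /eqP + _.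
by rewrite -subr_eq0 opprD addrA subrr sub0r oppr_eq0 => /eqP.
Qed.

Lemma delbar1 : delbar X 1 = 0.
Proof.
have [_] := component_leibniz 1 1; rewrite mulr1 inc1 mulr1 mul1r => /eqP.
by rewrite -subr_eq0 opprD addrA subrr sub0r oppr_eq0 => /eqP.
Qed.

Lemma identified_line (S : subspace Om) k e w : identified D S k e -> S w ->
  exists x, cls w = x *: e.
Proof.
move=> [_ h _] /h [u _ e1]; exists (eps u).
by rewrite cls_counit e1 eps_teval_pure.
Qed.

(** The classes of one-forms are spanned by [e_plus] and [e_minus]; if these were proportional, the
    fibre could not have the dimension 2 given by [classical_dim]. *)
Lemma fibre_independent : ~ line (e_minus X) (e_plus X) /\ ~ line (e_plus X) (e_minus X).
Proof.
have [e eind eP] := classical_dim X.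
have one (v : fibre X) : line v (e_plus X) -> line v (e_minus X) -> False.
  move=> [x ex] [y ey]; apply: (@dependent_in_span _ _ 1 (fun=> v) e) eind => i.
  have : exists k, e i = k *: v.
    have [|w /forms1P[w1 [w2 [h1 h2 ->]]] <-] := (eP (e i)).2.
      exists (fun j => (j == i)%:R); rewrite (bigD1 i) //= eqxx scale1r big1 ?addr0 // => j.
      by move=> /negPf ->; rewrite scale0r.
    have [k1 e1] := identified_line (forms10 X) h1.
    have [k2 e2] := identified_line (forms01 X) h2.
    exists (k1 * x + k2 * y); rewrite scalerDl -!scalerA -ex -ey -e1 -e2.
    exact: clsD.
  by move=> [k ->]; exists (fun=> k); rewrite big_ord1.
by split=> h; [apply: (one (e_minus X))|apply: (one (e_plus X))] => //; exists 1; rewrite scale1r.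
Qed.

End DoubleComplex.

(** * The four differentials in coefficients *)

Section Coefficients.
Variables (C : numClosedFieldType) (q : C).
Hypothesis hq : q != 0.
Variable X : dolbeault q.

Notation SU := (SU2 q).
Notation a := (SU2_gen q Ga).
Notation b := (SU2_gen q Gb).
Notation c := (SU2_gen q Gc).
Notation d := (SU2_gen q Gd).
Notation word := (@SU2_word C q).
Notation part := (SU2_part q).
Notation M := (podles q).
Notation pval := (@podles_val C q).
Notation Om := (calc X).
Notation inc := (inc X).
Notation dif := (dif X).
Notation D := (coact X).
Notation cls := (@cls C q X).

Notation E := (der hq 0 1).
Notation F := (der hq 1 0).

Ltac normal_form := do ?[progress rewrite -?mulrA |
  progress rewrite ?(normal_order hq, =^~ scalerAl, =^~ scalerAr, mulrDl, mulrDr)].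

Lemma scaled_linear k (f : {linear SU -> SU}) : linear (fun u => k *: f u).
Proof. by move=> x u v; rewrite linearP; lmod. Qed.
Definition scaled k (f : {linear SU -> SU}) : {linear SU -> SU} :=
  mk_linear (scaled_linear k f).
Lemma scaledE k f u : scaled k f u = k *: f u. Proof. by []. Qed.
(** The factor comes from the normalisation [d b_+] = e^+: E(c d) = q d^2 has counit q, while F(a b)
    = a^2 has counit 1. *)
Notation E' := (scaled q^-1 E).

Lemma word2 i j : word [:: i; j] = SU2_gen q i * SU2_gen q j.
Proof. by rewrite !word_cons word_nil mulr1. Qed.

Lemma der_gen2 be ga i j : der hq be ga (SU2_gen q i * SU2_gen q j) =
  SU2_gen q i * der hq be ga (SU2_gen q j) +
  q ^ deg_gen j *: (der hq be ga (SU2_gen q i) * SU2_gen q j).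
Proof. exact: derM (part_gen q j). Qed.

Ltac der_values := rewrite !der_gen2 !der_gen /= !(scale0r, scale1r, mulr0, mul0r, expr1z, exprN1).

Lemma E_values : [/\ E (a * b) = q *: (b * b), E (b * c) = b * d & E (c * d) = q *: (d * d)].
Proof. by der_values; split; lmod. Qed.

Lemma F_values : [/\ F (a * b) = a * a, F (b * c) = q^-1 *: (a * c) & F (c * d) = c * c].
Proof. by der_values; split; lmod. Qed.

Lemma E2_values : [/\ E (a * a) = (1 + q^-2) *: (a * b),
  E (a * c) = a * d + q^-1 *: (b * c) & E (c * c) = (1 + q^-2) *: (c * d)].
Proof.
der_values; have [-> _ _ -> _] := SU2_rules hq.
by split; lmod.
Qed.

Lemma F2_values : [/\ F (b * b) = (q^-1 + q) *: (a * b),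
  F (b * d) = b * c + q *: (a * d) & F (d * d) = (q^-1 + q) *: (c * d)].
Proof.
der_values; have [-> _ _ -> _] := SU2_rules hq.
by split; lmod.
Qed.

Lemma derZ be ga k u : der hq be ga (k *: u) = k *: der hq be ga u.
Proof. exact: linearZ. Qed.

Lemma conv_plus (L : SU -> C) : linear (L : SU -> C^o) ->
  L 1 = 0 -> L (b * c) = 0 -> L (pval (b_plus q)) = 1 -> L (pval (b_minus q)) = 0 ->
  [/\ conv hq L (pval (b_plus q)) = word [:: Gd; Gd], conv hq L (pval (b_minus q)) = word [:: Gb; Gb]
    & conv hq L (b * c) = q^-1 *: word [:: Gb; Gd]].
Proof.
rewrite pval_plus pval_minus => lL L1 L0 Lp Lm.
by rewrite conv_ab // conv_bc // conv_cd // L1 L0 Lp Lm !word2; split; lmod.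
Qed.

Lemma conv_minus (L : SU -> C) : linear (L : SU -> C^o) ->
  L 1 = 0 -> L (b * c) = 0 -> L (pval (b_minus q)) = 1 -> L (pval (b_plus q)) = 0 ->
  [/\ conv hq L (pval (b_minus q)) = word [:: Ga; Ga], conv hq L (pval (b_plus q)) = word [:: Gc; Gc]
    & conv hq L (b * c) = q^-1 *: word [:: Ga; Gc]].
Proof.
rewrite pval_plus pval_minus => lL L1 L0 Lm Lp.
by rewrite conv_ab // conv_bc // conv_cd // L1 L0 Lp Lm !word2; split; lmod.
Qed.

Lemma b_plus_zero : exists k : C, pval (b_plus q) * pval (b_zero q) = k *: (pval (b_zero q) * pval (b_plus q)).
Proof.
exists (q ^- 2); rewrite pval_plus pval_zero.
by normal_form; lmod.
Qed.

Lemma b_minus_zero : exists k : C, pval (b_minus q) * pval (b_zero q) = k *: (pval (b_zero q) * pval (b_minus q)).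
Proof.
exists (q ^+ 2); rewrite pval_minus pval_zero.
by normal_form; lmod.
Qed.

Notation line10 := (bideg X 1 0).
Notation line01 := (bideg X 0 1).
Notation ep := (e_plus X).
Notation em := (e_minus X).

Lemma grading_covariant p s w : bideg X p s w -> tensors_in (bideg X p s) (D w).
Proof. exact: bideg_covariant. Qed.

Section Functionals.
Variables (r : {linear SU -> M}) (fp fm ft : {linear fibre X -> C^o}).
Hypothesis rK : forall m, r (pval m) = m.
Hypotheses (fpp : fp ep = 1) (fpm : fp em = 0).
Hypotheses (fmm : fm em = 1) (fmp : fm ep = 0).
Hypothesis ftt : ft (tau X) = 1.

Let A0 w : line10 w -> line01 w -> w = 0. Proof. exact: line10_01. Qed.
Let B0 w : line01 w -> line10 w -> w = 0. Proof. by move=> *; exact: line10_01. Qed.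
Let dif_split' w : dif w = delbar X w + del X w. Proof. by rewrite addrC dif_split. Qed.
Let line10P w : line10 w -> exists k, cls w = k *: ep.
Proof. exact: identified_line (forms10 X). Qed.
Let line01P w : line01 w -> exists k, cls w = k *: em.
Proof. exact: identified_line (forms01 X). Qed.
Let del_leibniz m m' : del X (inc (m * m')) = del X (inc m) * inc m' + inc m * del X (inc m').
Proof. by case: (component_leibniz X m m'). Qed.
Let delbar_leibniz m m' : delbar X (inc (m * m')) = delbar X (inc m) * inc m' + inc m * delbar X (inc m').
Proof. by case: (component_leibniz X m m'). Qed.

Lemma coef_del m : coef fp (del X (inc m)) = E' (pval m).
Proof.
have [Eab Ebc Ecd] := E_values; move: m.
apply: (gA_derivation rK (@mulr10 _ _ X) (@del10 _ _ X) (@delbar01 _ _ X) A0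
  (@dif_split _ _ X) del_leibniz (@grading_covariant 1 0) (@grading_covariant 0 1)
  (forms10 X) line01P fpp fpm erefl erefl (or_introl (conj erefl erefl)) _ _ conv_plus b_plus_zero) => //; rewrite ?scaledE.
- by rewrite /deg unlock.
- by rewrite der1 scaler0.
- by move=> u v pv; rewrite !scaledE (derM _ _ _ _ pv) expr0z -scalerAr -scalerAl; lmod.
- by rewrite pval_plus Ecd word2; lmod.
- by rewrite pval_minus Eab word2; lmod.
- by rewrite Ebc word2.
Qed.

Lemma coef_delbar m : coef fm (delbar X (inc m)) = F (pval m).
Proof.
have [Fab Fbc Fcd] := F_values; move: m.
apply: (gA_derivation rK (@mulr01 _ _ X) (@delbar01 _ _ X) (@del10 _ _ X) B0
  dif_split' delbar_leibniz (@grading_covariant 0 1) (@grading_covariant 1 0)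
  (forms01 X) line10P fmm fmp erefl erefl (or_intror (conj erefl erefl)) _ _ conv_minus b_minus_zero) => //.
- by rewrite /deg unlock.
- exact: der1.
- by move=> u v pv; rewrite (derM _ _ _ _ pv) expr0z scale1r.
- by rewrite pval_minus Fab word2.
- by rewrite pval_plus Fcd word2.
- by rewrite Fbc word2.
Qed.

Let del_values : [/\ fp (cls (del X (inc (b_minus q)))) = 0,
  fp (cls (del X (inc (b_zero q)))) = 0 & fp (cls (del X (inc (b_plus q)))) = 1].
Proof.
split.
- exact: (XA_bB (@delbar01 _ _ X) (@dif_split _ _ X) line01P fpm erefl).
- exact: (XA_b0 hq rK (@del10 _ _ X) (@delbar01 _ _ X) A0 (@dif_split _ _ X) del_leibniz
    (@grading_covariant 1 0) (@grading_covariant 0 1) (forms10 X) fpp).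
- exact: (XA_bA (@delbar01 _ _ X) (@dif_split _ _ X) line01P fpp fpm erefl).
Qed.

Let delbar_values : [/\ fm (cls (delbar X (inc (b_plus q)))) = 0,
  fm (cls (delbar X (inc (b_zero q)))) = 0 & fm (cls (delbar X (inc (b_minus q)))) = 1].
Proof.
split.
- exact: (XA_bB (@del10 _ _ X) dif_split' line10P fmp erefl).
- exact: (XA_b0 hq rK (@delbar01 _ _ X) (@del10 _ _ X) B0 dif_split' delbar_leibniz
    (@grading_covariant 0 1) (@grading_covariant 1 0) (forms01 X) fmm).
- exact: (XA_bA (@del10 _ _ X) dif_split' line10P fmm fmp erefl).
Qed.

(** In tau = [d b_+ d b_-] the left factor may be replaced by del b_+, which has the same class;
    then del b_- contributes a (2,0)-form, that is, zero. *)
Let zeta1 : zeta (del X) (delbar X) (b_plus q) (b_minus q) ft = 1.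
Proof.
rewrite -ftt /zeta /tau; congr (ft _).
have -> : cls (dif (inc (b_plus q)) * dif (inc (b_minus q))) =
    cls (del X (inc (b_plus q)) * dif (inc (b_minus q))).
  apply: cls_mulr.
  by rewrite (cls_eta (@del10 _ _ X) (@delbar01 _ _ X) (@dif_split _ _ X) (forms10 X) line01P fpp fpm erefl).
rewrite (dif_split (inc (b_minus q))) mulrDr.
by rewrite [X in X + _](bideg20 (bidegM (del10 X _) (del10 X _))) add0r.
Qed.

Let gen01 (W : subspace SU) :
  (forall u, part 0 u -> [/\ W (u * F (a * b)), W (u * F (b * c)) & W (u * F (c * d))]) ->
  forall u, part (-2) u -> W u.
Proof.
have [-> -> ->] := F_values => h; apply: (partN2_gen hq) => u /h[h1 h2 h3]; split=> //.
have -> : u * (a * c) = q *: (u * (q^-1 *: (a * c))) by rewrite -scalerAr; lmod.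
exact: spZ.
Qed.

Let gen10 (W : subspace SU) :
  (forall u, part 0 u -> [/\ W (u * E' (a * b)), W (u * E' (b * c)) & W (u * E' (c * d))]) ->
  forall u, part 2 u -> W u.
Proof.
rewrite !scaledE; have [-> -> ->] := E_values => h; apply: (part2_gen hq) => u /h[h1 h2 h3].
split.
- by have -> : b * b = q^-1 *: (q *: (b * b)) by lmod.
- have -> : u * (b * d) = q *: (u * (q^-1 *: (b * d))) by rewrite -scalerAr; lmod.
  exact: spZ.
- by have -> : d * d = q^-1 *: (q *: (d * d)) by lmod.
Qed.

Let two0 : (2 : int) != 0. Proof. by []. Qed.
Let mtwo0 : (-2 : int) != 0. Proof. by []. Qed.
Let deg_dd : deg [:: Gd; Gd] = 2. Proof. by rewrite /deg unlock. Qed.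
Let deg_aa : deg [:: Ga; Ga] = -2. Proof. by rewrite /deg unlock. Qed.
Let eps_dd : eps (word [:: Gd; Gd]) = 1. Proof. by rewrite word2 epsM eps_gen mulr1. Qed.
Let eps_aa : eps (word [:: Ga; Ga]) = 1. Proof. by rewrite word2 epsM eps_gen mulr1. Qed.
Let del_forms2 w : line01 w -> forms X 2 (del X w).
Proof. by move=> h; apply/forms11; exact: del_bideg. Qed.
Let delbar_forms2 w : line10 w -> forms X 2 (delbar X w).
Proof. by move=> h; apply/forms11; exact: delbar_bideg. Qed.

Lemma scaled_word_eq0 k w : k *: word w = 0 -> k = 0.
Proof.
by move/eqP; rewrite scaler_eq0 (negPf (word_neq0 hq w)) orbF => /eqP.
Qed.

(** The next two lemmas come from [b_- b_0 = q^2 b_0 b_-] and its analogue for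
    [b_+], with [delbar], resp. [del], applied to the right-hand factor. *)
Lemma lambda_plus : lambda (del X) (delbar X) ft = 1.
Proof.
have [Eab Ebc Ecd] := E_values; have [Fab Fbc Fcd] := F_values.
have rel : pval (b_minus q) * F (b * c) = q ^+ 2 *: (b * c * F (pval (b_minus q))).
  rewrite pval_minus Fab Fbc.
  by normal_form; lmod.
have := relation_eq rK (@mulr10 _ _ X) (@del10 _ _ X) (@delbar01 _ _ X) A0
  (@dif_split _ _ X) del_leibniz (@grading_covariant 1 0) (@grading_covariant 0 1)
  (forms10 X) line01P fpp fpm erefl erefl (or_introl (conj erefl erefl)) two0 deg_dd conv_plus b_plus_zero
  coef_del coef_delbar (forms01 X) fmm (forms2 X) ftt (@mull01 _ _ X) (@forms2_10_01 _ _ X)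
  (@del_line01 _ _ X) del_forms2 (@del_leibniz01 _ _ X) (delbar1 X) gen01 delbar_values
  (or_introl (conj erefl erefl)) eps_dd rel.
rewrite zeta1; set la := lambda _ _ _.
rewrite scaledE pval_minus Eab Fbc scaledE Ebc Fab => e.
suff : (la - 1) *: word [:: Gb; Ga] = 0 by move/scaled_word_eq0/eqP; rewrite subr_eq0 => /eqP.
rewrite word2; move/eqP: e; rewrite -subr_eq0 => /eqP e.
(* In normal order the two sides of e differ by q (la - 1) b a, the terms in b^2 c a cancelling. *)
rewrite -[RHS](scaler0 _ q^-1) -e; normal_form; lmod.
Qed.

(** The sign is that of del delbar + delbar del = 0 on functions, which is d^2 = 0. *)
Lemma lambda_minus : lambda (delbar X) (del X) ft = -1.
Proof.
rewrite -lambda_plus /lambda -linearN; congr (ft _).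
rewrite (delbar_line10 (del10 X _)) (del_line01 (delbar01 X _)).
apply/eqP; rewrite -addr_eq0 -clsD -linearD /= -dif_split dif_dif.
by rewrite cls0.
Qed.

Lemma zeta_minus : zeta (delbar X) (del X) (b_minus q) (b_plus q) ft = - q ^+ 2.
Proof.
have [Eab Ebc Ecd] := E_values; have [Fab Fbc Fcd] := F_values.
have rel : pval (b_plus q) * E' (b * c) = q ^- 2 *: (b * c * E' (pval (b_plus q))).
  rewrite !scaledE pval_plus Ecd Ebc.
  by normal_form; lmod.
have := relation_eq rK (@mulr01 _ _ X) (@delbar01 _ _ X) (@del10 _ _ X) B0
  dif_split' delbar_leibniz (@grading_covariant 0 1) (@grading_covariant 1 0)
  (forms01 X) line10P fmm fmp erefl erefl (or_intror (conj erefl erefl)) mtwo0 deg_aa conv_minus b_minus_zero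
  coef_delbar coef_del (forms10 X) fpp (forms2 X) ftt (@mull10 _ _ X) (@forms2_01_10 _ _ X)
  (@delbar_line10 _ _ X) delbar_forms2 (@delbar_leibniz10 _ _ X) (del1 X) gen10 del_values
  (or_intror (conj erefl erefl)) eps_aa rel.
rewrite lambda_minus; set ze := zeta _ _ _ _ _.
rewrite scaledE pval_plus Fcd Ebc scaledE Fbc Ecd => e.
suff : (ze + q ^+ 2) *: word [:: Gc; Gd] = 0 by move/scaled_word_eq0/eqP; rewrite addr_eq0 => /eqP.
rewrite word2; move/eqP: e; rewrite -subr_eq0 => /eqP e.
rewrite -[RHS](scaler0 _ (- q ^+ 2)) -e; normal_form; lmod.
Qed.

(** The scalar is forced: in degree -2 the Leibniz rule of x E has x q^-2 in front of E(u) v, and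
    this must be [zeta] q^-1 = q^-1. In [coef_delbar10] likewise x q^2 = - q^2. *)
Lemma coef_del01 w : line01 w -> coef ft (del X w) = scaled q E (coef fm w).
Proof.
have [Faa Fbc Fcc] := F_values; have [Eaa Eac Ecc] := E2_values.
apply: (gT_dA_eq rK (@mulr10 _ _ X) (@del10 _ _ X) (@delbar01 _ _ X) A0
  (@dif_split _ _ X) del_leibniz (@grading_covariant 1 0) (@grading_covariant 0 1)
  (forms10 X) line01P fpp fpm erefl erefl (or_introl (conj erefl erefl)) two0 deg_dd conv_plus b_plus_zero
  coef_del coef_delbar (forms01 X) fmm (forms2 X) ftt (@mull01 _ _ X) (@forms2_10_01 _ _ X)
  (@del_line01 _ _ X) del_forms2 (@del_leibniz01 _ _ X) (delbar1 X) gen01 delbar_values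
  (or_introl (conj erefl erefl)) eps_dd).
- move=> u v _ pv; rewrite zeta1 !scaledE (derM _ _ _ _ pv) -!scalerAl -!scalerAr; have -> : q ^ (-2) = q ^- 2 by []; lmod.
- rewrite lambda_plus Faa scaledE Eaa; lmod.
- rewrite lambda_plus Fbc scaledE derZ Eac; lmod.
- rewrite lambda_plus Fcc scaledE Ecc; lmod.
Qed.

Lemma coef_delbar10 w : line10 w -> coef ft (delbar X w) = scaled (-1) F (coef fp w).
Proof.
have [Ebb Ebc Edd] := E_values; have [Fbb Fbd Fdd] := F2_values.
apply: (gT_dA_eq rK (@mulr01 _ _ X) (@delbar01 _ _ X) (@del10 _ _ X) B0
  dif_split' delbar_leibniz (@grading_covariant 0 1) (@grading_covariant 1 0)
  (forms01 X) line10P fmm fmp erefl erefl (or_intror (conj erefl erefl)) mtwo0 deg_aa conv_minus b_minus_zero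
  coef_delbar coef_del (forms10 X) fpp (forms2 X) ftt (@mull10 _ _ X) (@forms2_01_10 _ _ X)
  (@delbar_line10 _ _ X) delbar_forms2 (@delbar_leibniz10 _ _ X) (del1 X) gen10 del_values
  (or_intror (conj erefl erefl)) eps_aa).
- move=> u v _ pv; rewrite zeta_minus !scaledE (derM _ _ _ _ pv) -!scalerAr; have -> : q ^ 2 = q ^+ 2 by []; lmod.
- rewrite lambda_minus !scaledE Ebb !derZ Fbb; lmod.
- rewrite lambda_minus !scaledE Ebc derZ Fbd; lmod.
- rewrite lambda_minus !scaledE Edd !derZ Fdd; lmod.
Qed.

End Functionals.

Definition coefficient_map (S : subspace Om) (t : int) (g : {linear Om -> SU}) : Prop :=
  [/\ forall w, S w -> part t (g w), forall w, S w -> g w = 0 -> w = 0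
    & forall u, part t u -> exists2 w, S w & g w = u].

Lemma coef_coefficient_map (S : subspace Om) t e (f : {linear fibre X -> C^o}) :
  identified D S t e -> f e = 1 -> coefficient_map S t (mk_linear (coef_linear f)).
Proof. by move=> Sid fe; have [? ? ? _] := identified_coef Sid fe. Qed.

Lemma coefficient_maps : exists gp gm gt : {linear Om -> SU},
  [/\ coefficient_map line10 2 gp, coefficient_map line01 (-2) gm
    & coefficient_map (forms X 2) 0 gt] /\
  [/\ forall m, gp (del X (inc m)) = q^-1 *: E (pval m),
      forall m, gm (delbar X (inc m)) = F (pval m),
      forall w, line01 w -> gt (del X w) = q *: E (gm w)
    & forall w, line10 w -> gt (delbar X w) = - F (gp w)].
Proof.
have [r rK] := podles_retraction q.
have [/dual_vector[fp [fpp fp0]] /dual_vector[fm [fmm fm0]]] := fibre_independent X.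
have [ft [ftt _]] : exists f : {linear fibre X -> C^o}, f (tau X) = 1 /\ forall x, sp_zero x -> f x = 0.
  by apply: dual_vector => t0; have [/eqP] := forms2 X.
have fpm : fp (e_minus X) = 0 by apply: fp0; exists 1; rewrite scale1r.
have fmp : fm (e_plus X) = 0 by apply: fm0; exists 1; rewrite scale1r.
exists (mk_linear (coef_linear fp)), (mk_linear (coef_linear fm)), (mk_linear (coef_linear ft)).
split; split.
- exact: coef_coefficient_map (forms10 X) fpp.
- exact: coef_coefficient_map (forms01 X) fmm.
- exact: coef_coefficient_map (forms2 X) ftt.
- by move=> m; exact: (coef_del rK fpp fpm).
- by move=> m; exact: (coef_delbar rK fmm fmp).
- by move=> w hw; exact: (coef_del01 rK fpp fpm fmm fmp ftt).
- by move=> w hw; have := coef_delbar10 rK fpp fpm fmm fmp ftt hw; rewrite scaledE scaleN1r.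
Qed.

Lemma words_countdim : countdim SU.
Proof.
(* [gen] has only a classical choice structure; pairs of booleans are countable, which provides
   [pickle] for words. *)
pose dec (p : bool * bool) := match p with
  (true, true) => Ga | (true, false) => Gb | (false, true) => Gc | (false, false) => Gd end.
pose enc i := match i with
  Ga => (true, true) | Gb => (true, false) | Gc => (false, true) | Gd => (false, false) end.
have encK : cancel enc dec by case.
pose s n := if @unpickle (seq (bool * bool)) n is Some w then word (map dec w) else 0.
exists s => v.
have [p _ <-] : sp_img (mk_linear (poly_comb_linear s)) sp_full v.
  apply: SU2_ind => w; exists 'X^(pickle (map enc w)) => //.
  by rewrite /= poly_combXn /s pickleK (mapK encK).
by exists (size p), (fun i => p`_i).
Qed.

End Coefficients.

(** * Cohomology *)

Section Cohomology.
Variables (C : numClosedFieldType) (q : C).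
Hypothesis hq : q != 0.
Variable X : dolbeault q.

Notation SU := (SU2 q).
Notation a := (SU2_gen q Ga).
Notation b := (SU2_gen q Gb).
Notation part := (SU2_part q).
Notation pval := (@podles_val C q).
Notation Om := (calc X).
Notation inc := (inc X).
Notation dif := (dif X).
Notation E := (der hq 0 1).
Notation F := (der hq 1 0).
Notation line10 := (bideg X 1 0).
Notation line01 := (bideg X 0 1).
Notation hat := (hat hq).

Lemma bideg00P w : bideg X 0 0 w <-> exists m, w = inc m.
Proof.
by split=> [h|[m ->]]; [exact: (forms0 w).1 (bideg_forms h)|exact: bideg00].
Qed.

Lemma zero_form_map : exists g : {linear Om -> SU},
  coefficient_map (forms X 0) 0 g /\ forall m, g (inc m) = pval m.
Proof.
have [s sK] := retraction (f := inc) (@inc_inj _ _ X).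
exists (pval \o s : {linear Om -> SU}).
have e m : pval (s (inc m)) = pval m by rewrite sK.
split=> //; split=> [w _|w /forms0[m ->] /=|u /pval_onto[m <-]]; first exact: pval_part.
  by rewrite sK => m0; rewrite (_ : m = 0) ?linear0 //; exact: pval_inj.
by exists (inc m); [apply/forms0; exists m|exact: e].
Qed.

(** Common scheme of the six infinite-dimensional cases: forms with coefficients a^N b^M z^s are
    cocycles, and a coordinate that vanishes on all coboundaries keeps their classes independent. *)
Lemma infdim_model (Z B S : subspace Om) t (g : {linear Om -> SU}) (N M : nat -> nat) s :
  coefficient_map S t g -> injective N -> (forall j, (M j)%:Z - (N j)%:Z = t) ->
  (forall j w, S w -> g w = mon q (N j) (M j) s -> Z w) ->
  (forall j w, B w -> (hat (g w) (N j) (M j))`_s = 0) ->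
  infdim (subquot Z B).
Proof.
move=> [_ _ gS] Ninj NM hZ hB.
have ex j : exists w, S w /\ g w = mon q (N j) (M j) s.
  have [|w Sw gw] := gS (mon q (N j) (M j) s); last by exists w.
  by rewrite -(NM j); exact: part_mon_t.
have [e eP] := choice ex.
apply: (subquot_infdim (e := e)) => [j|n k Bk].
  by have [Se ge] := eP j; exact: hZ Se ge.
apply: (@dual_family _ _ hq N M s (sp_img g B)) => //.
  by move=> j _ [w Bw <-]; exact: hB.
exists (\sum_i k i *: e i) => //; rewrite linear_sum; apply: eq_bigr => i _.
by rewrite linearZ; have [_ ->] := eP i.
Qed.

Lemma countdim_model (Z B S : subspace Om) t (g : {linear Om -> SU}) :
  coefficient_map S t g -> (forall w, Z w -> S w) -> countdim (subquot Z B).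
Proof.
move=> [_ ginj _] ZS; apply: (@subquot_countdim _ _ Z B _ g); last exact: words_countdim.
by move=> w /ZS; exact: ginj.
Qed.

Lemma img_zero (f : {linear Om -> Om}) w : sp_img f sp_zero w -> w = 0.
Proof. by move=> [_ -> <-]; exact: linear0. Qed.

Lemma hat_zero n m s : (hat 0 n m)`_s = 0.
Proof. by rewrite /hat act0 coef0. Qed.

Lemma dif_forms2 w : forms X 2 w -> dif w = 0.
Proof. by move=> h; apply: (@forms_gt2 _ _ X 3) => //; exact: dif_forms h. Qed.

Section Model.
Variables (g0 gp gm gt : {linear Om -> SU}).
Hypothesis g0P : coefficient_map (forms X 0) 0 g0.
Hypothesis gpP : coefficient_map line10 2 gp.
Hypothesis gmP : coefficient_map line01 (-2) gm.
Hypothesis gtP : coefficient_map (forms X 2) 0 gt.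
Hypothesis g0_inc : forall m, g0 (inc m) = pval m.
Hypothesis gp_del : forall m, gp (del X (inc m)) = q^-1 *: E (pval m).
Hypothesis gm_delbar : forall m, gm (delbar X (inc m)) = F (pval m).
Hypothesis gt_del : forall w, line01 w -> gt (del X w) = q *: E (gm w).
Hypothesis gt_delbar : forall w, line10 w -> gt (delbar X w) = - F (gp w).

Lemma del_eq0 w : line01 w -> (del X w = 0 <-> E (gm w) = 0).
Proof.
move=> hw; have [_ inj _] := gtP; split=> [w0|e0].
  have := gt_del hw; rewrite w0 linear0 => /esym/eqP.
  by rewrite scaler_eq0 (negPf hq) => /eqP.
apply: inj; first by apply/forms11; exact: del_bideg.
by rewrite gt_del // e0 scaler0.
Qed.

Lemma delbar_eq0 w : line10 w -> (delbar X w = 0 <-> F (gp w) = 0).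
Proof.
move=> hw; have [_ inj _] := gtP; split=> [w0|e0].
  have := gt_delbar hw; rewrite w0 linear0 => /esym/eqP.
  by rewrite oppr_eq0 => /eqP.
apply: inj; first by apply/forms11; exact: delbar_bideg.
by rewrite gt_delbar // e0 oppr0.
Qed.

Lemma dif_inc_eq0 m : dif (inc m) = 0 <-> E (pval m) = 0 /\ F (pval m) = 0.
Proof.
have [_ injp _] := gpP; have [_ injm _] := gmP; split.
  rewrite dif_split => /(line_sum0 (del10 X m) (delbar01 X m))[d0 db0].
  split; last by rewrite -gm_delbar db0 linear0.
  have /esym/eqP := gp_del m; rewrite d0 linear0 scaler_eq0 invr_eq0 (negPf hq).
  by move/eqP.
move=> [e0 f0]; rewrite dif_split.
rewrite [del X _](injp _ (del10 X m)) ?gp_del ?e0 ?scaler0 // add0r.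
by apply: (injm _ (delbar01 X m)); rewrite gm_delbar.
Qed.

Lemma gt_dif1 u v : line10 u -> line01 v -> gt (dif (u + v)) = q *: E (gm v) - F (gp u).
Proof.
move=> hu hv; rewrite linearD -delbar_line10 // -(del_line01 hv) linearD /=.
by rewrite gt_del // gt_delbar // addrC.
Qed.

(** This is d^2 = 0 on functions, read in coefficients. *)
Lemma F_E m : F (E (pval m)) = q ^+ 2 *: E (F (pval m)).
Proof.
have := congr1 gt (@dif_dif _ _ X (inc m)).
rewrite [dif (inc m)]dif_split gt_dif1; [|exact: del10|exact: delbar01].
rewrite linear0 gp_del gm_delbar derZ => /eqP; rewrite subr_eq0 => /eqP h.
by rewrite expr2 -scalerA h scalerA mulfV // scale1r.
Qed.

Lemma F_part m : part (-2) (F (pval m)).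
Proof. by have [h _ _] := gmP; rewrite -gm_delbar; apply: h; exact: delbar01. Qed.

Section Generic.
Hypothesis gen : generic q.

Lemma generic_Hdel10 (x : Hdel X 1 0) : x = 0.
Proof.
move: x; apply: subquot_zero => w [hw _]; have [pp inj _] := gpP.
have [_ /pval_onto[m <-] ev] := generic_E_onto hq gen (pp _ hw).
exists (q *: inc m); first by rewrite /=; apply: spZ; exact: bideg00.
apply/eqP; rewrite -subr_eq0 linearZ /=; apply/eqP; apply: inj.
  by apply: spB => //; apply: spZ; exact: del10.
by rewrite linearB linearZ /= gp_del ev scalerA mulfV // scale1r subrr.
Qed.

Lemma generic_Hdelbar01 (x : Hdelbar X 0 1) : x = 0.
Proof.
move: x; apply: subquot_zero => w [hw _]; have [pp inj _] := gmP.
have [_ /pval_onto[m <-] ev] := generic_F_onto hq gen (pp _ hw).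
exists (inc m); first exact: bideg00.
apply/eqP; rewrite -subr_eq0; apply/eqP; apply: inj; first by apply: spB => //; exact: delbar01.
by rewrite linearB /= gm_delbar ev subrr.
Qed.

Lemma generic_Hdel01 (x : Hdel X 0 1) : x = 0.
Proof.
move: x; apply: subquot_zero => w [hw w0]; have [pp inj _] := gmP.
suff -> : w = 0 by exact: sp_set0.
apply: inj => //; apply: (generic_E_inj gen (pp _ hw)).
exact: (proj1 (del_eq0 hw)).
Qed.

Lemma generic_Hdelbar10 (x : Hdelbar X 1 0) : x = 0.
Proof.
move: x; apply: subquot_zero => w [hw w0]; have [pp inj _] := gpP.
suff -> : w = 0 by exact: sp_set0.
apply: inj => //; apply: (generic_F_inj gen (pp _ hw)).
exact: (proj1 (delbar_eq0 hw)).
Qed.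

Lemma generic_deRham0 : is_line (deRham X 0).
Proof.
have dif1 : dif (inc 1) = 0.
  by apply/dif_inc_eq0; rewrite pval1 !der1.
apply: (subquot_line (e := inc 1)).
- by split=> //; apply/forms0; exists 1.
- move=> /img_zero; rewrite -(linear0 inc) => /inc_inj /eqP.
  by rewrite oner_eq0.
move=> z [/forms0[m ->] /dif_inc_eq0[e0 _]].
have [k ek] := generic_ker_E gen (pval_part m) e0.
exists k; suff -> : inc m - k *: inc 1 = 0 by exact: sp_set0.
apply/eqP; rewrite subr_eq0 -linearZ; apply/eqP; congr (inc _).
apply: pval_inj; rewrite ek.
by have := pval_linear k 1 (0 : podles q); rewrite !addr0 pval1 => ->.
Qed.

(** As E maps S_0 onto S_2, [F_E] turns F on S_2 into q^2 E F on S_0. Exact 2-forms therefore have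
    coefficients in E(S_-2), which misses 1 and together with 1 spans S_0. *)
Lemma generic_deRham2 : is_line (deRham X 2).
Proof.
have [pt injt ont] := gtP; have [pp _ _] := gpP; have [pm _ onm] := gmP.
have [e he ge] := ont 1 (part1 q).
apply: (subquot_line (e := e)); first by split=> //; exact: dif_forms2.
  move=> [_ /forms1P[u [v [hu hv ->]]] e1].
  have [_ /pval_onto[m <-] ev] := generic_E_onto hq gen (pp _ hu).
  apply: (@generic_one_notin _ _ hq (q *: gm v - q ^+ 2 *: F (pval m)) gen).
    by apply: spB; apply: spZ; [exact: pm|exact: F_part].
  by rewrite linearB !derZ -F_E ev -gt_dif1 // e1.
move=> z [hz _]; have [k [v [pv ez]]] := generic_part0 hq gen (pt _ hz).
have [w hw gw] := onm _ pv; exists k, (q^-1 *: w).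
  by apply: spZ; exact: (bideg_forms hw).
rewrite linearZ /= -(del_line01 hw); apply/eqP; rewrite -subr_eq0; apply/eqP; apply: injt.
  apply: spB; last by apply: spB => //; exact: spZ.
  by apply: spZ; apply/forms11; exact: del_bideg.
rewrite !linearB !linearZ /= gt_del // gw ez ge; lmod.
Qed.

End Generic.

(** * Infinite-dimensional cohomology when some [k] vanishes *)

Section Root.
Variable l : nat.
Hypothesis l0 : nb q l.+1 = 0.

Let l1 : (0 < l)%N. Proof. exact: root_gt1 l0. Qed.

Lemma root_Hdel10 : infdim (Hdel X 1 0).
Proof.
(* Every (1,0)-form is del-closed; z^l at a multiple of l + 1 is a coordinate that vanishes on the
   image of E. *)
apply: (@infdim_model _ _ _ _ _ (fun j => (j * l.+1)%N) (fun j => (j * l.+1 + 2)%N) l gpP).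
- by move=> i j; nia.
- by move=> j; lia.
- by move=> j w hw _; split=> //; exact: del_line10.
move=> j _ [_ /bideg00P[m ->] <-].
by rewrite gp_del -derZ root_E_vanish.
Qed.

Lemma root_Hdel01 : infdim (Hdel X 0 1).
Proof.
(* There are no coboundaries here, and E kills these monomials. The subtraction in [nat] is exact
   because l > 0 gives l + 1 >= 2. *)
apply: (@infdim_model _ _ _ _ _ (fun j => (j.+1 * l.+1)%N) (fun j => (j.+1 * l.+1 - 2)%N) 0 gmP).
- by move=> i j; nia.
- by move=> j; nia.
- by move=> j w hw gw; split=> //; apply/del_eq0; rewrite // gw mon_ab; exact: root_E_ker.
by move=> j w /img_zero ->; rewrite linear0 hat_zero.
Qed.

Lemma root_Hdelbar10 : infdim (Hdelbar X 1 0).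
Proof.
apply: (@infdim_model _ _ _ _ _ (fun j => (j.+1 * l.+1 - 2)%N) (fun j => (j.+1 * l.+1)%N) 0 gpP).
- by move=> i j; nia.
- by move=> j; nia.
- by move=> j w hw gw; split=> //; apply/delbar_eq0; rewrite // gw mon_ab; exact: root_F_ker.
by move=> j w /img_zero ->; rewrite linear0 hat_zero.
Qed.

Lemma root_Hdelbar01 : infdim (Hdelbar X 0 1).
Proof.
(* At z^0 the scalar of F is [M + 1] for the target exponent M of b, so M + 1 is taken to be a
   multiple of l + 1. *)
apply: (@infdim_model _ _ _ _ _ (fun j => (j.+1 * l.+1).+1%N) (fun j => (j.+1 * l.+1).-1%N) 0 gmP).
- by move=> i j; nia.
- by move=> j; nia.
- by move=> j w hw _; split=> //; exact: delbar_line01.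
by move=> j _ [_ /bideg00P[m ->] <-]; rewrite gm_delbar root_F_vanish0.
Qed.

Lemma root_deRham0 : infdim (deRham X 0).
Proof.
apply: (@infdim_model _ _ _ _ _ (fun j => (j.+1 * l.+1)%N) (fun j => (j.+1 * l.+1)%N) 0 g0P).
- by move=> i j; nia.
- by move=> j; lia.
- move=> j w /[dup] hw /forms0[m ->]; rewrite g0_inc mon_ab => e; split; first by apply/forms0; exists m.
  by apply/dif_inc_eq0; rewrite e root_E_ker ?root_F_ker.
by move=> j w /img_zero ->; rewrite linear0 hat_zero.
Qed.

Lemma root_deRham2 : infdim (deRham X 2).
Proof.
(* With both exponents multiples of l + 1, the coordinate z^l vanishes on the images of E and of F
   at once. *)
apply: (@infdim_model _ _ _ _ _ (fun j => (j * l.+1)%N) (fun j => (j * l.+1)%N) l gtP).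
- by move=> i j; nia.
- by move=> j; lia.
- by move=> j w hw _; split=> //; exact: dif_forms2.
move=> j _ [_ /forms1P[u [v [hu hv ->]]] <-]; rewrite gt_dif1 // addrC -scaleN1r hat_linear coefD coefZ.
by rewrite -derZ root_E_vanish // root_F_vanish // mulr0 addr0.
Qed.

End Root.

Lemma deRham_lines_or_infdim :
  (is_line (deRham X 0) /\ is_line (deRham X 2)) \/
  (infdim (deRham X 0) /\ infdim (deRham X 2)).
Proof.
have [[l l0]|no] := pselect (exists l, nb q l.+1 = 0).
  by right; split; [exact: root_deRham0 l0|exact: root_deRham2 l0].
have gen : generic q by move=> k; apply/eqP => k0; apply: no; exists k.
by left; split; [exact: generic_deRham0|exact: generic_deRham2].
Qed.

Lemma Hdel_iso : lmod_iso (Hdel X 1 0) (Hdel X 0 1).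
Proof.
have [[l l0]|no] := pselect (exists l, nb q l.+1 = 0).
  apply: infdim_iso (root_Hdel10 l0) (root_Hdel01 l0).
    by apply: (countdim_model _ gpP) => w [].
  by apply: (countdim_model _ gmP) => w [].
have gen : generic q by move=> k; apply/eqP => k0; apply: no; exists k.
by apply: lmod_iso_zero; [exact: generic_Hdel10|exact: generic_Hdel01].
Qed.

Lemma Hdelbar_iso : lmod_iso (Hdelbar X 1 0) (Hdelbar X 0 1).
Proof.
have [[l l0]|no] := pselect (exists l, nb q l.+1 = 0).
  apply: infdim_iso (root_Hdelbar10 l0) (root_Hdelbar01 l0).
    by apply: (countdim_model _ gpP) => w [].
  by apply: (countdim_model _ gmP) => w [].
have gen : generic q by move=> k; apply/eqP => k0; apply: no; exists k.
by apply: lmod_iso_zero; [exact: generic_Hdelbar10|exact: generic_Hdelbar01].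
Qed.

Lemma deRham_iso : [/\ lmod_iso (deRham X 0) (deRham X 2),
  dim_ge (deRham X 0) 1 & dim_ge (deRham X 2) 1].
Proof.
have c0 : countdim (deRham X 0) by apply: (countdim_model _ g0P) => w [].
have c2 : countdim (deRham X 2) by apply: (countdim_model _ gtP) => w [].
have [[L0 L2]|[i0 i2]] := deRham_lines_or_infdim.
  split; try exact: is_line_dim_ge.
  by apply: lmod_iso_trans (lmod_iso_sym _) (is_line_iso L2); exact: is_line_iso.
by split; [exact: infdim_iso|exact: i0|exact: i2].
Qed.

End Model.
End Cohomology.

Theorem corollary3p7 (R : realType) (q : R[i]) (hq : q != 0)
    (X : dolbeault q) :
  [/\ lmod_iso (deRham X 0) (deRham X 2),
      dim_ge (deRham X 0) 1 & dim_ge (deRham X 2) 1] /\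
  (lmod_iso (Hdel X 1 0) (Hdel X 0 1) /\
   lmod_iso (Hdelbar X 1 0) (Hdelbar X 0 1)).
Proof.
have [gp [gm [gt [[gpP gmP gtP] [gpd gmd gtd gtb]]]]] := coefficient_maps hq X.
have [g0 [g0P g0i]] := zero_form_map X.
split; first exact: (deRham_iso g0P gpP gmP gtP g0i gpd gmd gtd gtb).
by split; [exact: (Hdel_iso gpP gmP gtP gpd gtd)|exact: (Hdelbar_iso gpP gmP gtP gmd gtb)].
Qed.
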